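(* For $j=1,2$ let $\varepsilon_j,\mu_j:\mathbf{R}\to(0,\infty)$ be piecewise continuous, $1$-periodic and even, and let $\mathcal{L}_j\psi=-\frac{1}{\varepsilon_j(x)}\frac{d}{dx}\left(\frac{1}{\mu_j(x)}\frac{d\psi}{dx}\right)$. Define the glued operator $\tilde{\mathcal{L}}\psi=\mathcal{L}_1\psi$ for $x<0$ and $\tilde{\mathcal{L}}\psi=\mathcal{L}_2\psi$ for $x>0$. Assume: (i) there are positive integers $m_1,m_2$ such that the common band gap $I:=(E_{m_1}^{(1),+},E_{m_1+1}^{(1),-})\cap(E_{m_2}^{(2),+},E_{m_2+1}^{(2),-})$ is nonempty (with $E_{m_j}^{(j),+}<E_{m_j+1}^{(j),-}$); (ii) the bulk indices differ: $\gamma_{m_1}^{(1)}\neq\gamma_{m_2}^{(2)}$. Then there exists a unique interface mode of $\tilde{\mathcal{L}}$ with energy in $I$: there is exactly one $E\in I$ for which $\tilde{\mathcal{L}}$ has an interface mode at energy $E$.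
   Context: For each operator $\mathcal{L}_j$ (coefficients $\varepsilon_j,\mu_j$) and $k\in[-\pi,\pi]$, let $V_k=\{u\in AC[0,1]: u(1)=e^{ik}u(0),\ \frac{u'}{\mu_j}\in AC[0,1],\ \frac{u'(1)}{\mu_j(1)}=e^{ik}\frac{u'(0)}{\mu_j(0)}\}$; the self-adjoint problem $\mathcal{L}_j\psi=E\psi$ in $V_k$ (inner product $\int_0^1\varepsilon_j\bar u v$) has eigenvalues $E^{(j)}_1(k)\le E^{(j)}_2(k)\le\cdots$, and $E_m^{(j),-}=\min_kE_m^{(j)}(k)$, $E_m^{(j),+}=\max_kE_m^{(j)}(k)$. When $E_m^{(j),+}<E_{m+1}^{(j),-}$, the maximum $E_m^{(j),+}$ is attained at some $k^*\in\{0,\pi\}$ and the corresponding eigenspace in $V_{k^*}$ is one-dimensional, spanned by a real function whose extension to $\mathbf{R}$ via $u(x+n)=e^{ik^*n}u(x)$ (the Bloch mode) is either even or odd. The bulk index $\gamma_m^{(j)}\in\{+1,-1\}$ is defined as $+1$ if this Bloch mode at $E_m^{(j),+}$ is even and $-1$ if it is odd. An interface mode of $\tilde{\mathcal{L}}$ at energy $E\in\mathbf{R}$ is a nonzero $\psi\in L^2(\mathbf{R})$ such that $\psi$ and $\psi'/\tilde\mu$ are locally absolutely continuous on $\mathbf{R}$ (where $\tilde\mu=\mu_1$ on $x<0$, $\tilde\mu=\mu_2$ on $x>0$) and $(\tilde{\mathcal{L}}-E)\psi=0$. *)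

(* Defs.v *)
From Stdlib Require Import Reals List ClassicalEpsilon.
From Coquelicot Require Import Coquelicot.
Open Scope R_scope.

Definition piecewise_continuous (f : R -> R) : Prop :=
  (forall x, (exists l, filterlim f (at_left x) (locally l)) /\
             (exists r, filterlim f (at_right x) (locally r))) /\
  (forall a b, exists disc : list R,
     forall x, a <= x <= b -> ~ In x disc -> continuous f x).

Definition one_periodic (f : R -> R) : Prop := forall x, f (x + 1) = f x.
Definition even_fun (f : R -> R) : Prop := forall x, f (- x) = f x.

Definition admissible_coef (f : R -> R) : Prop :=
  (forall x, 0 < f x) /\ piecewise_continuous f /\ one_periodic f /\ even_fun f.

Fixpoint Rsum_lt (f : nat -> R) (n : nat) : R :=
  match n with O => 0 | S p => Rsum_lt f p + f p end.
Fixpoint Csum_lt (f : nat -> C) (n : nat) : C :=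
  match n with O => RtoC 0 | S p => Cplus (Csum_lt f p) (f p) end.

Definition abs_cont_on (a b : R) (f : R -> C) : Prop :=
  forall eps, 0 < eps -> exists delta, 0 < delta /\
    forall (n : nat) (l r : nat -> R),
      (forall i, (i < n)%nat -> a <= l i <= r i /\ r i <= b) ->
      (forall i j, (i < j < n)%nat -> r i <= l j \/ r j <= l i) ->
      Rsum_lt (fun i => r i - l i) n < delta ->
      Rsum_lt (fun i => Cmod (Cminus (f (r i)) (f (l i)))) n < eps.

Definition loc_abs_cont (f : R -> C) : Prop :=
  forall a b, abs_cont_on a b f.

Definition null_set (N : R -> Prop) : Prop :=
  forall eps, 0 < eps -> exists l r : nat -> R,
    (forall i, l i <= r i) /\
    (forall x, N x -> exists i, l i < x < r i) /\
    (forall n, Rsum_lt (fun i => r i - l i) n <= eps).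

Definition ae_on (D : R -> Prop) (P : R -> Prop) : Prop :=
  exists N, null_set N /\ forall x, D x -> ~ N x -> P x.

Definition in01 (x : R) : Prop := 0 <= x <= 1.

Definition cexpi (t : R) : C := (cos t, sin t).

(* u belongs to V_k and solves  L u = E u  (with L = -(1/eps) d/dx (1/mu) d/dx):
   u in AC[0,1], the quasi-derivative w = u'/mu is (a.e. equal to) an AC[0,1]
   function, (w)' = - E eps u a.e., and the quasi-periodic conditions hold.
   The zero function is included (this is the eigenspace). *)
Definition in_eigenspace (eps mu : R -> R) (k E : R) (u : R -> C) : Prop :=
  abs_cont_on 0 1 u /\
  exists w : R -> C, abs_cont_on 0 1 w /\
    ae_on in01 (fun x => is_derive u x (Cmult (RtoC (mu x)) (w x))) /\
    ae_on in01 (fun x => is_derive w x (Cmult (RtoC (- E * eps x)) (u x))) /\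
    u 1 = Cmult (cexpi k) (u 0) /\
    w 1 = Cmult (cexpi k) (w 0).

Definition eig_dim (eps mu : R -> R) (k E : R) (d : nat) : Prop :=
  exists f : nat -> R -> C,
    (forall i, (i < d)%nat -> in_eigenspace eps mu k E (f i)) /\
    (forall c : nat -> C,
        (forall x, in01 x -> Csum_lt (fun i => Cmult (c i) (f i x)) d = RtoC 0) ->
        forall i, (i < d)%nat -> c i = RtoC 0) /\
    (forall u, in_eigenspace eps mu k E u ->
        exists c : nat -> C, forall x, in01 x ->
          u x = Csum_lt (fun i => Cmult (c i) (f i x)) d).

(* lam is the nondecreasing list of eigenvalues in V_k repeated according to
   multiplicity; lam 0 = E_1(k), lam 1 = E_2(k), ... *)
Definition is_eigen_seq (eps mu : R -> R) (k : R) (lam : nat -> R) : Prop :=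
  (forall m, lam m <= lam (S m)) /\
  forall E d, eig_dim eps mu k E d ->
    exists idx : list nat, NoDup idx /\ length idx = d /\
      forall m, In m idx <-> lam m = E.

(* E_m(k) for m >= 1 (junk value 0 when m = 0) *)
Definition band (eps mu : R -> R) (m : nat) (k : R) : R :=
  match m with
  | O => 0
  | S p => epsilon (inhabits (fun _ : nat => 0))
                   (fun lam => is_eigen_seq eps mu k lam) p
  end.

Definition inPi (k : R) : Prop := - PI <= k <= PI.

Definition band_max (eps mu : R -> R) (m : nat) : R :=
  epsilon (inhabits 0) (fun M =>
    (exists k, inPi k /\ band eps mu m k = M) /\
    forall k, inPi k -> band eps mu m k <= M).
Definition band_min (eps mu : R -> R) (m : nat) : R :=
  epsilon (inhabits 0) (fun M =>
    (exists k, inPi k /\ band eps mu m k = M) /\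
    forall k, inPi k -> M <= band eps mu m k).

Definition bloch_ext (k : R) (u : R -> C) (x : R) : C :=
  Cmult (cexpi (k * IZR (Int_part x))) (u (x - IZR (Int_part x))).

Definition even_C (f : R -> C) : Prop := forall x, f (- x) = f x.
Definition odd_C (f : R -> C) : Prop := forall x, f (- x) = Copp (f x).

Definition bulk_index (eps mu : R -> R) (m : nat) (g : Z) : Prop :=
  exists kstar u, (kstar = 0 \/ kstar = PI) /\
    band eps mu m kstar = band_max eps mu m /\
    in_eigenspace eps mu kstar (band_max eps mu m) u /\
    (exists x, in01 x /\ u x <> RtoC 0) /\
    ((g = 1%Z /\ even_C (bloch_ext kstar u)) \/
     (g = (-1)%Z /\ odd_C (bloch_ext kstar u))).

Definition glue (f1 f2 : R -> R) (x : R) : R := if Rlt_dec x 0 then f1 x else f2 x.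

(* psi in L^2(R) (psi is continuous here, so the improper Riemann integral
   of |psi|^2 is the Lebesgue integral) *)
Definition L2R (psi : R -> C) : Prop :=
  ex_RInt_gen (fun x => Cmod (psi x) ^ 2)
              (Rbar_locally m_infty) (Rbar_locally p_infty).

Definition interface_mode (eps1 mu1 eps2 mu2 : R -> R) (E : R) (psi : R -> C) : Prop :=
  (exists x, psi x <> RtoC 0) /\ L2R psi /\
  loc_abs_cont psi /\
  exists w : R -> C, loc_abs_cont w /\
    ae_on (fun _ => True)
      (fun x => is_derive psi x (Cmult (RtoC (glue mu1 mu2 x)) (w x))) /\
    ae_on (fun _ => True)
      (fun x => is_derive w x (Cmult (RtoC (- E * glue eps1 eps2 x)) (psi x))).

(* Main.v *)
Require Import Defs.
From Stdlib Require Import Reals Lra Lia List ClassicalEpsilon Cantor.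
From Coquelicot Require Import Coquelicot.
Open Scope R_scope.

(** Hill's equation is written as the system [u' = mu w], [w' = - E eps u], whose monodromy matrix
    over one period is [[p, q], [r, p]] (equal diagonal entries because the coefficients are even),
    with [p^2 - q r = 1].  The energy [E] is an eigenvalue in [V_k] iff [p(E) = cos k], doubly degenerate iff moreover
    [q = r = 0].  The derivatives of [p], [q], [r] in [E] are quadratic forms weighted by [eps]; they show
    that [p] is strictly monotone where [|p| < 1], so bands are separated by closed intervals where
    [|p| >= 1], and a Prüfer angle argument shows that there are infinitely many of them.

    In a gap the solution decaying at [+oo] has [w/u = -s sqrt(r/q)] at the origin, [s] being the sign of
    [p q], and the one decaying at [-oo] has the opposite value.  An even Bloch mode at the bottom of the
    gap means [r = 0] there, hence [s = -1] and [r/q] increases from [0] to [+oo]; an odd one means [q = 0], [s = 1] and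
    [r/q] decreases from [+oo] to [0].  Modes of the two media therefore match iff the bulk indices
    differ and [r1/q1 = r2/q2], which happens at exactly one energy of the common gap. *)

(** * Calculus with finitely many exceptional points *)

(** The obstacle is the weak form of the definitions. Eigenfunctions and modes are only absolutely
    continuous and satisfy the equation off an arbitrary null set, so a mean value inequality for
    such functions ([rac_bound]) is proved first. It gives uniqueness, and so identifies every weak
    solution with a combination of two fundamental solutions built by Picard iteration, which are
    differentiable off a locally finite set; from there on classical calculus and Riemann integrals
    suffice. Likewise [band] and its extrema are chosen by [epsilon] and say nothing until an
    eigenvalue sequence is shown to exist and to be unique; existence needs infinitely many bands,
    which is the purpose of the oscillation argument. The dependence on the energy rests on one
    exact identity: Lagrange's identity between solutions at two energies expresses the difference
    quotient of a monodromy entry through integrals that are continuous in the second energy. *)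

Lemma cont_plus (f g : R -> R) x : continuous f x -> continuous g x ->
  continuous (fun y => f y + g y) x.
Proof. intros; apply (continuous_plus f g x); assumption. Qed.
Lemma cont_minus (f g : R -> R) x : continuous f x -> continuous g x ->
  continuous (fun y => f y - g y) x.
Proof. intros; apply (continuous_minus f g x); assumption. Qed.
Lemma cont_mult (f g : R -> R) x : continuous f x -> continuous g x ->
  continuous (fun y => f y * g y) x.
Proof. intros; apply (continuous_mult f g x); assumption. Qed.
Lemma cont_const (c x : R) : continuous (fun _ : R => c) x.
Proof. apply continuous_const. Qed.
Lemma cont_comp (f g : R -> R) x : continuous f x -> continuous g (f x) ->
  continuous (fun y => g (f y)) x.
Proof. intros; apply (continuous_comp f g x); assumption. Qed.
Lemma cont_id (x : R) : continuous (fun y : R => y) x.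
Proof. apply continuous_id. Qed.
Lemma cont_opp (f : R -> R) x : continuous f x -> continuous (fun y => - f y) x.
Proof. intros; apply (continuous_opp f x); assumption. Qed.
Lemma cont_div (f g : R -> R) x : continuous f x -> continuous g x -> g x <> 0 ->
  continuous (fun y => f y / g y) x.
Proof.
  intros Hf Hg Hn; apply cont_mult; [assumption|].
  apply (cont_comp g Rinv x Hg). now apply continuous_Rinv.
Qed.
Lemma cont_derive (f : R -> R) (x d : R) : is_derive f x d -> continuous f x.
Proof. intros H; apply (@ex_derive_continuous R_AbsRing R_NormedModule); now exists d. Qed.

Lemma der_eq (f : R -> R) (x a b : R) : is_derive f x a -> a = b -> is_derive f x b.
Proof. now intros H <-. Qed.
Lemma der_plus (f g : R -> R) (x a b : R) : is_derive f x a -> is_derive g x b ->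
  is_derive (fun y => f y + g y) x (a + b).
Proof. intros; now apply (is_derive_plus f g). Qed.
Lemma der_minus (f g : R -> R) (x a b : R) : is_derive f x a -> is_derive g x b ->
  is_derive (fun y => f y - g y) x (a - b).
Proof. intros; now apply (is_derive_minus f g). Qed.
Lemma der_opp (f : R -> R) (x a : R) : is_derive f x a -> is_derive (fun y => - f y) x (- a).
Proof. intros; now apply (is_derive_opp f). Qed.
Lemma der_mult (f g : R -> R) (x a b : R) : is_derive f x a -> is_derive g x b ->
  is_derive (fun y => f y * g y) x (a * g x + f x * b).
Proof. intros; apply (is_derive_mult f g); auto; intros; apply Rmult_comm. Qed.
Lemma der_const (c x : R) : is_derive (fun _ : R => c) x 0.
Proof. apply @is_derive_const. Qed.
Lemma der_scal (c : R) (f : R -> R) (x a : R) : is_derive f x a ->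
  is_derive (fun y => c * f y) x (c * a).
Proof. intros H; eapply der_eq; [apply der_mult; [apply der_const|exact H]|cbv beta; ring]. Qed.
Lemma der_id (x : R) : is_derive (fun y : R => y) x 1.
Proof. apply @is_derive_id. Qed.
Lemma der_comp (f g : R -> R) (x a b : R) : is_derive f x a -> is_derive g (f x) b ->
  is_derive (fun y => g (f y)) x (a * b).
Proof. intros; now apply (is_derive_comp g f). Qed.
Lemma der_div (f g : R -> R) (x a b : R) : is_derive f x a -> is_derive g x b -> g x <> 0 ->
  is_derive (fun y => f y / g y) x ((a * g x - f x * b) / (g x)^2).
Proof. intros; now apply (is_derive_div f g). Qed.

(** The exceptional points are finite in number on each bounded interval. This is how
    [piecewise_continuous] supplies them, and it is stable under conjunction, so several
    coefficients share one exceptional set. *)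
Definition off_finite (G : R -> Prop) : Prop :=
  forall a b, exists disc : list R, forall x, a <= x <= b -> ~ In x disc -> G x.

Lemma off_finite_and (G H : R -> Prop) :
  off_finite G -> off_finite H -> off_finite (fun x => G x /\ H x).
Proof.
  intros HG HH a b.
  destruct (HG a b) as [l1 H1], (HH a b) as [l2 H2].
  exists (l1 ++ l2); intros x Hx Hn; split.
  - apply H1; auto; intros K; apply Hn, in_or_app; auto.
  - apply H2; auto; intros K; apply Hn, in_or_app; auto.
Qed.

Lemma off_finite_imp (G H : R -> Prop) :
  (forall x, G x -> H x) -> off_finite G -> off_finite H.
Proof.
  intros I HG a b; destruct (HG a b) as [l Hl]; exists l; intros; apply I, Hl; auto.
Qed.

(** Induction on the exceptional points: the interval is cut at each of them, and the mean value
    theorem settles an interval without any. *)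
Lemma mono_list (h : R -> R) (l : list R) : forall a b, a <= b ->
  (forall x, continuous h x) ->
  (forall x, a < x < b -> ~ In x l -> exists d, is_derive h x d /\ 0 <= d) ->
  h a <= h b.
Proof.
  induction l as [|c l IH]; intros a b Hab Hc Hd.
  - destruct (Rle_lt_or_eq_dec a b Hab) as [Hlt| ->]; [|lra].
    (* [MVT_gen] may return an endpoint, where nothing is known about the derivative; the default
       value 0 is harmless there. *)
    set (df := fun x => match excluded_middle_informative (a < x < b) with
                 | left _ => Derive h x | right _ => 0 end).
    destruct (MVT_gen h a b df) as [x [Hx E]].
    + rewrite Rmin_left, Rmax_right by lra; intros x Hx; unfold df.
      destruct (excluded_middle_informative _) as [_|n]; [|tauto].
      destruct (Hd x Hx (fun f => f)) as [d [D _]].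
      apply Derive_correct; now exists d.
    + intros x _; apply continuity_pt_filterlim, Hc.
    + assert (0 <= df x).
      { unfold df; destruct (excluded_middle_informative _) as [p|n]; [|lra].
        destruct (Hd x p (fun f => f)) as [d [D Dp]].
        now rewrite (is_derive_unique _ _ _ D). }
      assert (0 <= df x * (b - a)) by (apply Rmult_le_pos; lra). lra.
  - destruct (Rlt_dec a c) as [Hac|Hac]; [destruct (Rlt_dec c b) as [Hcb|Hcb]|].
    + apply Rle_trans with (h c).
      * apply IH; try lra; auto; intros x Hx Hn; apply Hd; [lra|].
        intros [->|K]; [lra|tauto].
      * apply IH; try lra; auto; intros x Hx Hn; apply Hd; [lra|].
        intros [->|K]; [lra|tauto].
    + apply IH; auto; intros x Hx Hn; apply Hd; auto; intros [->|K]; [lra|tauto].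
    + apply IH; auto; intros x Hx Hn; apply Hd; auto; intros [->|K]; [lra|tauto].
Qed.

Section OffFinite.
Variable G : R -> Prop.
Hypothesis HG : off_finite G.

Lemma off_mono (h : R -> R) a b : a <= b -> (forall x, continuous h x) ->
  (forall x, a < x < b -> G x -> exists d, is_derive h x d /\ 0 <= d) -> h a <= h b.
Proof.
  intros Hab Hc Hd; destruct (HG a b) as [l Hl].
  apply (mono_list h l); auto; intros x Hx Hn; apply Hd; auto; apply Hl; auto; lra.
Qed.

(** Monotonicity of [B x - h] and of [B x + h]. *)
Lemma off_bound (h : R -> R) B a b : a <= b -> (forall x, continuous h x) ->
  (forall x, a < x < b -> G x -> exists d, is_derive h x d /\ Rabs d <= B) ->
  Rabs (h b - h a) <= B * (b - a).
Proof.
  intros Hab Hc Hd.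
  assert (H1 : B * a - h a <= B * b - h b).
  { apply (off_mono (fun x => B * x - h x)); auto.
    - intros; apply cont_minus; auto; apply cont_mult; [apply cont_const|apply cont_id].
    - intros x Hx Gx; destruct (Hd x Hx Gx) as [d [D Db]]; exists (B * 1 - d); split.
      + apply der_minus; auto; apply der_scal, der_id.
      + apply Rabs_le_between in Db; lra. }
  assert (H2 : B * a + h a <= B * b + h b).
  { apply (off_mono (fun x => B * x + h x)); auto.
    - intros; apply cont_plus; auto; apply cont_mult; [apply cont_const|apply cont_id].
    - intros x Hx Gx; destruct (Hd x Hx Gx) as [d [D Db]]; exists (B * 1 + d); split.
      + apply der_plus; auto; apply der_scal, der_id.
      + apply Rabs_le_between in Db; lra. }
  apply Rabs_le; lra.
Qed.

Lemma off_const (h : R -> R) a b : a <= b -> (forall x, continuous h x) ->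
  (forall x, a < x < b -> G x -> is_derive h x 0) -> h b = h a.
Proof.
  intros Hab Hc Hd.
  assert (H : Rabs (h b - h a) <= 0 * (b - a)).
  { apply off_bound; auto; intros x Hx Gx; exists 0; split; auto; rewrite Rabs_R0; lra. }
  rewrite Rmult_0_l in H. generalize (Rabs_pos (h b - h a)); intros.
  assert (E : Rabs (h b - h a) = 0) by lra.
  destruct (Req_dec (h b - h a) 0) as [K|K]; [lra|].
  now apply Rabs_no_R0 in K.
Qed.

(** The product [h x * exp (- c x)] does not increase. *)
Lemma off_gronwall (h : R -> R) c a b : a <= b -> (forall x, continuous h x) ->
  (forall x, a < x < b -> G x -> exists d, is_derive h x d /\ d <= c * h x) ->
  h b <= h a * exp (c * (b - a)).
Proof.
  intros Hab Hc Hd.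
  assert (De : forall x, is_derive (fun y => exp (- c * y)) x (- c * exp (- c * x))).
  { intros x; eapply der_eq.
    - apply (der_comp (fun y => - c * y) exp); [apply der_scal, der_id|apply is_derive_exp].
    - simpl; ring. }
  assert (H1 : - (h a * exp (- c * a)) <= - (h b * exp (- c * b))).
  { apply (off_mono (fun x => - (h x * exp (- c * x)))); auto.
    - intros; apply cont_opp, cont_mult; auto. eapply cont_derive, De.
    - intros x Hx Gx; destruct (Hd x Hx Gx) as [d [D Db]]; eexists; split.
      + apply der_opp, der_mult; [exact D|apply De].
      + simpl. generalize (exp_pos (- c * x)); intros.
        assert (0 <= (c * h x - d) * exp (- c * x)) by (apply Rmult_le_pos; lra). lra. }
  assert (E : exp (- c * a) = exp (c * (b - a)) * exp (- c * b)).
  { rewrite <- exp_plus; f_equal; ring. }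
  rewrite E in H1.
  apply Rmult_le_reg_r with (exp (- c * b)); [apply exp_pos|]. lra.
Qed.

Lemma off_exists a b : a < b -> exists x, a < x < b /\ G x.
Proof.
  intros Hab; destruct (HG a b) as [l Hl].
  assert (H : forall l a b, a < b -> exists x, a < x < b /\ ~ In x l).
  { clear; induction l as [|c l IH]; intros a b Hab.
    - exists ((a + b) / 2); simpl; split; [lra|tauto].
    - destruct (Rlt_dec c ((a + b) / 2)) as [Hc|Hc].
      + destruct (IH ((a + b) / 2) b) as [x [Hx Hn]]; [lra|].
        exists x; split; [lra|]; intros [->|K]; [lra|tauto].
      + destruct (IH a ((a + b) / 2)) as [x [Hx Hn]]; [lra|].
        exists x; split; [lra|]; intros [->|K]; [lra|tauto]. }
  destruct (H l a b Hab) as [x [Hx Hn]].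
  exists x; split; auto; apply Hl; auto; lra.
Qed.

(** Equal end values would make [h] constant in between, against the positive derivative at a single
    point of [G]. *)
Lemma off_strict (h : R -> R) a b : a < b -> (forall x, continuous h x) ->
  (forall x, a < x < b -> G x -> exists d, is_derive h x d /\ 0 < d) -> h a < h b.
Proof.
  intros Hab Hc Hd.
  assert (M : forall x y, a <= x <= y -> y <= b -> h x <= h y).
  { intros x y H1 H2; apply off_mono; auto; try lra; intros z Hz Gz.
    destruct (Hd z) as [d [D Dp]]; [lra|auto|]; exists d; split; auto; lra. }
  destruct (Rlt_dec (h a) (h b)) as [|N]; [assumption|exfalso].
  destruct (off_exists a b Hab) as [x [Hx Gx]].
  destruct (Hd x Hx Gx) as [d [D Dp]].
  assert (D0 : is_derive h x 0).
  { apply (is_derive_ext_loc (fun _ => h a)); [|apply der_const].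
    assert (P : 0 < Rmin (x - a) (b - x)) by (apply Rmin_pos; lra).
    exists (mkposreal _ P); intros y Hy.
    change (Rabs (y - x) < Rmin (x - a) (b - x)) in Hy.
    apply Rabs_lt_between in Hy.
    generalize (Rmin_l (x - a) (b - x)) (Rmin_r (x - a) (b - x)); intros.
    assert (h a <= h y) by (apply M; lra). assert (h y <= h b) by (apply M; lra). lra. }
  apply is_derive_unique in D; apply is_derive_unique in D0; lra.
Qed.

(** A nonzero value would persist on a neighbourhood, which meets the dense set [G]. *)
Lemma off_zero (h : R -> R) a b : (forall x, continuous h x) ->
  (forall x, a < x < b -> G x -> h x = 0) -> forall x, a < x < b -> h x = 0.
Proof.
  intros Hc Hz x Hx.
  destruct (Req_dec (h x) 0) as [|N]; [assumption|exfalso].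
  assert (P : 0 < Rabs (h x)) by (apply Rabs_pos_lt; auto).
  destruct (Hc x (ball (h x) (mkposreal _ P)) (locally_ball _ _)) as [d Hd].
  assert (Q : 0 < Rmin d (b - x)) by (apply Rmin_pos; [apply cond_pos|lra]).
  destruct (off_exists x (x + Rmin d (b - x))) as [y [Hy Gy]]; [lra|].
  generalize (Rmin_l d (b - x)) (Rmin_r d (b - x)); intros.
  assert (B : ball (h x) (mkposreal _ P) (h y)).
  { apply Hd. change (Rabs (y - x) < d). apply Rabs_lt_between; lra. }
  rewrite (Hz y) in B; auto; [|lra].
  change (Rabs (0 - h x) < Rabs (h x)) in B.
  rewrite Rminus_0_l, Rabs_Ropp in B; lra.
Qed.
End OffFinite.

(** * Piecewise continuous functions and their primitives *)

Lemma pwc_off (f : R -> R) : piecewise_continuous f -> off_finite (continuous f).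
Proof. intros [_ H]; exact H. Qed.

Lemma pwc_mult (f g : R -> R) : piecewise_continuous f -> piecewise_continuous g ->
  piecewise_continuous (fun x => f x * g x).
Proof.
  intros [Hf1 Hf2] [Hg1 Hg2]; split.
  - intros x; destruct (Hf1 x) as [[l Hl] [r Hr]], (Hg1 x) as [[l' Hl'] [r' Hr']]; split.
    + exists (l * l'). eapply filterlim_comp_2; [exact Hl|exact Hl'|].
      apply (filterlim_mult l l').
    + exists (r * r'). eapply filterlim_comp_2; [exact Hr|exact Hr'|].
      apply (filterlim_mult r r').
  - apply (off_finite_imp (fun x => continuous f x /\ continuous g x)).
    + intros x [? ?]; now apply cont_mult.
    + now apply off_finite_and.
Qed.

Lemma pwc_plus (f g : R -> R) : piecewise_continuous f -> piecewise_continuous g ->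
  piecewise_continuous (fun x => f x + g x).
Proof.
  intros [Hf1 Hf2] [Hg1 Hg2]; split.
  - intros x; destruct (Hf1 x) as [[l Hl] [r Hr]], (Hg1 x) as [[l' Hl'] [r' Hr']]; split.
    + exists (l + l'). eapply filterlim_comp_2; [exact Hl|exact Hl'|].
      apply (filterlim_plus l l').
    + exists (r + r'). eapply filterlim_comp_2; [exact Hr|exact Hr'|].
      apply (filterlim_plus r r').
  - apply (off_finite_imp (fun x => continuous f x /\ continuous g x)).
    + intros x [? ?]; now apply cont_plus.
    + now apply off_finite_and.
Qed.

Lemma pwc_cont (f : R -> R) : (forall x, continuous f x) -> piecewise_continuous f.
Proof.
  intros H; split.
  - intros x; split; exists (f x); intros P HP; destruct (H x P HP) as [d Hd];
      exists d; intros y Hy _; now apply Hd.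
  - intros a b; exists nil; auto.
Qed.

Lemma pwc_const (c : R) : piecewise_continuous (fun _ => c).
Proof. apply pwc_cont; intros; apply cont_const. Qed.

Lemma pwc_scal (c : R) (f : R -> R) : piecewise_continuous f ->
  piecewise_continuous (fun x => c * f x).
Proof. intros; apply pwc_mult; auto; apply pwc_const. Qed.

(** Between consecutive discontinuities the one-sided limits extend [f] to a continuous function;
    the list of discontinuities is consumed by cutting the interval. *)
Lemma pwc_ex_RInt (f : R -> R) a b : piecewise_continuous f -> ex_RInt f a b.
Proof.
  intros [Hlim Hd].
  assert (H : forall l a b, a < b ->
    (forall x, a < x < b -> ~ In x l -> continuous f x) -> ex_RInt f a b).
  { clear a b; induction l as [|c l IH]; intros a b Hab Hc.
    - destruct (Hlim a) as [_ [r Hr]], (Hlim b) as [[s Hs] _].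
      destruct (C0_extension_lt f r s a b Hab) as [g [G1 [G2 _]]]; auto.
      { intros c Hc'; apply Hc; auto. }
      apply (ex_RInt_ext g).
      + rewrite Rmin_left, Rmax_right by lra; auto.
      + apply @ex_RInt_continuous; intros z _; apply G1.
    - destruct (Rlt_dec a c) as [Hac|Hac]; [destruct (Rlt_dec c b) as [Hcb|Hcb]|].
      + apply ex_RInt_Chasles with c.
        * apply IH; try lra; auto; intros x Hx Hn; apply Hc; [lra|].
          intros [->|K]; [lra|tauto].
        * apply IH; try lra; auto; intros x Hx Hn; apply Hc; [lra|].
          intros [->|K]; [lra|tauto].
      + apply IH; auto; intros x Hx Hn; apply Hc; auto; intros [->|K]; [lra|tauto].
      + apply IH; auto; intros x Hx Hn; apply Hc; auto; intros [->|K]; [lra|tauto]. }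
  destruct (Rtotal_order a b) as [L|[->|L]].
  - destruct (Hd a b) as [l Hl]; apply (H l); auto; intros; apply Hl; auto; lra.
  - apply ex_RInt_point.
  - apply ex_RInt_swap; destruct (Hd b a) as [l Hl]; apply (H l); auto; intros; apply Hl; auto; lra.
Qed.

Lemma pwc_bounded (f : R -> R) a b : piecewise_continuous f ->
  exists K, 0 < K /\ forall x, a <= x <= b -> Rabs (f x) <= K.
Proof.
  intros Hf; destruct (Rle_dec a b) as [Hab|N].
  - destruct (ex_RInt_ub f a b (pwc_ex_RInt f a b Hf)) as [K HK].
    exists (Rmax K 1); split.
    + generalize (Rmax_r K 1); lra.
    + intros x Hx; eapply Rle_trans; [|apply Rmax_l].
      apply HK; rewrite Rmin_left, Rmax_right; lra.
  - exists 1; split; [lra|]; intros; lra.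
Qed.

Lemma prim_cont (f : R -> R) a x : piecewise_continuous f -> continuous (fun y => RInt f a y) x.
Proof.
  intros Hf.
  apply (continuous_RInt_1 f a x (fun y => RInt f a y)).
  apply filter_forall; intros z; apply (@RInt_correct R_CompleteNormedModule), pwc_ex_RInt; auto.
Qed.

Lemma prim_derive (f : R -> R) a x : piecewise_continuous f -> continuous f x ->
  is_derive (fun y => RInt f a y) x (f x).
Proof.
  intros Hf Hc; apply (is_derive_RInt f _ a); auto.
  apply filter_forall; intros z; apply (@RInt_correct R_CompleteNormedModule), pwc_ex_RInt; auto.
Qed.

(** The difference of [h] and the primitive of [k] has zero derivative off a locally finite set. *)
Lemma RInt_FTC (h k : R -> R) (G : R -> Prop) a b : a <= b -> off_finite G ->
  piecewise_continuous k -> (forall x, continuous h x) ->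
  (forall x, a < x < b -> G x -> is_derive h x (k x)) -> RInt k a b = h b - h a.
Proof.
  intros Hab HG Hk Hc Hd.
  assert (E : h b - RInt k a b = h a - RInt k a a).
  { apply (off_const _ (off_finite_and _ _ HG (pwc_off _ Hk)) (fun x => h x - RInt k a x)); auto.
    - intros x; apply cont_minus; auto; now apply prim_cont.
    - intros x Hx [Gx Kx]; eapply der_eq; [apply der_minus; [now apply Hd|now apply prim_derive]|cbv beta; ring]. }
  rewrite RInt_point in E. change (@zero R_CompleteNormedModule) with 0 in E. lra.
Qed.

(** * Absolutely continuous functions *)

Lemma Rsum_ext f g n : (forall i, (i < n)%nat -> f i = g i) -> Rsum_lt f n = Rsum_lt g n.
Proof.
  induction n as [|n IH]; intros H; simpl; auto; rewrite IH, (H n); auto; intros; apply H; lia.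
Qed.
Lemma Rsum_le f g n : (forall i, (i < n)%nat -> f i <= g i) -> Rsum_lt f n <= Rsum_lt g n.
Proof.
  induction n as [|n IH]; intros H; simpl; [lra|].
  apply Rplus_le_compat; [apply IH; intros; apply H; lia|apply H; lia].
Qed.
Lemma Rsum_nonneg f n : (forall i, (i < n)%nat -> 0 <= f i) -> 0 <= Rsum_lt f n.
Proof.
  induction n as [|n IH]; intros H; simpl; [lra|].
  assert (0 <= f n) by (apply H; lia). assert (0 <= Rsum_lt f n) by (apply IH; intros; apply H; lia). lra.
Qed.
Lemma Rsum_scal c f n : Rsum_lt (fun i => c * f i) n = c * Rsum_lt f n.
Proof. induction n as [|n IH]; simpl; [ring|rewrite IH; ring]. Qed.
Lemma Rsum_plus f g n : Rsum_lt (fun i => f i + g i) n = Rsum_lt f n + Rsum_lt g n.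
Proof. induction n as [|n IH]; simpl; [ring|rewrite IH; ring]. Qed.
Lemma Rsum_mono f n m : (forall i, 0 <= f i) -> (n <= m)%nat -> Rsum_lt f n <= Rsum_lt f m.
Proof.
  intros H Hnm; induction Hnm; [lra|]; simpl. generalize (H m); lra.
Qed.

(** * Null sets *)

Lemma null_union (N1 N2 : R -> Prop) : null_set N1 -> null_set N2 ->
  null_set (fun x => N1 x \/ N2 x).
Proof.
  intros H1 H2 eps He.
  destruct (H1 (eps / 2)) as [l1 [r1 [A1 [B1 C1]]]]; [lra|].
  destruct (H2 (eps / 2)) as [l2 [r2 [A2 [B2 C2]]]]; [lra|].
  (* Interleaves two covers: the first takes the even indices, the second the odd ones. *)
  set (mix := fun (s t : nat -> R) i => if Nat.even i then s (Nat.div2 i) else t (Nat.div2 i)).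
  assert (M0 : forall s t i, mix s t (2 * i)%nat = s i).
  { intros; unfold mix; rewrite Nat.even_even, Nat.div2_even; auto. }
  assert (M1 : forall s t i, mix s t (S (2 * i))%nat = t i).
  { intros; unfold mix. replace (S (2 * i))%nat with (2 * i + 1)%nat by lia.
    rewrite Nat.even_odd, Nat.add_1_r, Nat.div2_succ_double; auto. }
  exists (mix l1 l2), (mix r1 r2); split; [|split].
  - intros i; unfold mix; destruct (Nat.even i); auto.
  - intros x [Hx|Hx].
    + destruct (B1 x Hx) as [i Hi]; exists (2 * i)%nat; now rewrite !M0.
    + destruct (B2 x Hx) as [i Hi]; exists (S (2 * i)); now rewrite !M1.
  - assert (E : forall n, Rsum_lt (fun i => mix r1 r2 i - mix l1 l2 i) (2 * n) =
       Rsum_lt (fun i => r1 i - l1 i) n + Rsum_lt (fun i => r2 i - l2 i) n).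
    { induction n as [|n IH]; [simpl; ring|].
      replace (2 * S n)%nat with (S (S (2 * n))) by lia.
      cbn [Rsum_lt]. rewrite IH, !M0, !M1; ring. }
    intros n; apply Rle_trans with (Rsum_lt (fun i => mix r1 r2 i - mix l1 l2 i) (2 * n)).
    + apply Rsum_mono; [|lia]. intros i; unfold mix; destruct (Nat.even i);
      [generalize (A1 (Nat.div2 i))|generalize (A2 (Nat.div2 i))]; lra.
    + rewrite E; generalize (C1 n) (C2 n); lra.
Qed.

(** The [j]-th point gets an interval of length [eps / 2^(j+1)], so the lengths add up to at most
    [eps]. *)
Lemma null_countable (N : R -> Prop) (e : nat -> R) :
  (forall x, N x -> exists j, e j = x) -> null_set N.
Proof.
  intros H eps He.
  exists (fun i => e i - eps * (/ 2) ^ (i + 2)), (fun i => e i + eps * (/ 2) ^ (i + 2)).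
  assert (P : forall i, 0 < eps * (/ 2) ^ (i + 2)).
  { intros; apply Rmult_lt_0_compat; [lra|apply pow_lt; lra]. }
  split; [|split].
  - intros i; generalize (P i); lra.
  - intros x Hx; destruct (H x Hx) as [j <-]; exists j; generalize (P j); lra.
  - intros n; apply Rle_trans with (eps - eps * (/ 2) ^ n).
    + induction n as [|n IH]; [simpl; lra|]. cbn [Rsum_lt].
      replace (n + 2)%nat with (S (S n)) by lia. simpl in *; lra.
    + assert (0 < eps * (/ 2) ^ n) by (apply Rmult_lt_0_compat; [lra|apply pow_lt; lra]). lra.
Qed.


Lemma null_point (c : R) : null_set (fun x => x = c).
Proof. apply (null_countable _ (fun _ => c)); intros x ->; now exists 0%nat. Qed.

Lemma off_finite_null (G : R -> Prop) : off_finite G -> null_set (fun x => ~ G x).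
Proof.
  intros HG.
  (* One list per interval [[-n, n]]; pairing the list with the position in it enumerates all
     exceptional points. *)
  set (disc := fun n : nat => proj1_sig (constructive_indefinite_description _ (HG (- INR n) (INR n)))).
  assert (D : forall n x, - INR n <= x <= INR n -> ~ In x (disc n) -> G x).
  { intros n x; unfold disc; destruct (constructive_indefinite_description _ _) as [l Hl]; apply Hl. }
  apply (null_countable _ (fun j => let (n, i) := Cantor.of_nat j in nth i (disc n) 0)).
  intros x Nx; destruct (nfloor_ex (Rabs x) (Rabs_pos x)) as [n [_ Hn]].
  assert (Hx : - INR (S n) <= x <= INR (S n)).
  { rewrite S_INR; apply Rabs_le_between; lra. }
  destruct (classic (In x (disc (S n)))) as [I|I]; [|exfalso; apply Nx, (D (S n)); auto].
  destruct (In_nth _ _ 0 I) as [i [_ Hi]].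
  exists (Cantor.to_nat (S n, i)); now rewrite Cantor.cancel_of_to.
Qed.

(** * Real absolutely continuous functions and weak solutions *)

Definition rac (a b : R) (f : R -> R) : Prop :=
  forall eps, 0 < eps -> exists delta, 0 < delta /\
    forall (n : nat) (l r : nat -> R),
      (forall i, (i < n)%nat -> a <= l i <= r i /\ r i <= b) ->
      (forall i j, (i < j < n)%nat -> r i <= l j \/ r j <= l i) ->
      Rsum_lt (fun i => r i - l i) n < delta ->
      Rsum_lt (fun i => Rabs (f (r i) - f (l i))) n < eps.

Lemma rac_sub a b a' b' f : a <= a' -> b' <= b -> rac a b f -> rac a' b' f.
Proof.
  intros Ha Hb H eps He; destruct (H eps He) as [d [Hd K]]; exists d; split; auto.
  intros n l r H1 H2 H3; apply K; auto; intros i Hi; specialize (H1 i Hi); lra.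
Qed.

Lemma rac_lin a b f g s t : rac a b f -> rac a b g -> rac a b (fun x => s * f x + t * g x).
Proof.
  intros Hf Hg eps He.
  set (c := Rabs s + Rabs t + 1).
  assert (Hc : 0 < c) by (unfold c; generalize (Rabs_pos s) (Rabs_pos t); lra).
  assert (He' : 0 < eps / c) by (apply Rdiv_lt_0_compat; auto).
  destruct (Hf _ He') as [d [Hd Kf]], (Hg _ He') as [d' [Hd' Kg]].
  exists (Rmin d d'); split; [now apply Rmin_pos|].
  intros n l r H1 H2 H3.
  generalize (Rmin_l d d') (Rmin_r d d'); intros.
  assert (F := Kf n l r H1 H2 ltac:(lra)). assert (Gg := Kg n l r H1 H2 ltac:(lra)).
  eapply Rle_lt_trans.
  - apply (Rsum_le _ (fun i => Rabs s * Rabs (f (r i) - f (l i)) + Rabs t * Rabs (g (r i) - g (l i)))).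
    intros i _. rewrite <- !Rabs_mult. eapply Rle_trans; [|apply Rabs_triang].
    apply Req_le; f_equal; ring.
  - rewrite Rsum_plus, !Rsum_scal.
    assert (E : eps = c * (eps / c)) by (field; lra).
    assert (N1 := Rsum_nonneg (fun i => Rabs (f (r i) - f (l i))) n (fun i _ => Rabs_pos _)).
    assert (N2 := Rsum_nonneg (fun i => Rabs (g (r i) - g (l i))) n (fun i _ => Rabs_pos _)).
    assert (Rabs s * Rsum_lt (fun i => Rabs (f (r i) - f (l i))) n <= Rabs s * (eps / c))
      by (apply Rmult_le_compat_l; [apply Rabs_pos|lra]).
    assert (Rabs t * Rsum_lt (fun i => Rabs (g (r i) - g (l i))) n <= Rabs t * (eps / c))
      by (apply Rmult_le_compat_l; [apply Rabs_pos|lra]).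
    rewrite E at 1; unfold c at 1; lra.
Qed.

(** With tolerance 1, a step shorter than [d] changes [f] by less than 1, and finitely many steps of
    length [d / 2] reach every point. *)
Lemma rac_bounded a b f : rac a b f -> exists C, 0 < C /\ forall x, a <= x <= b -> Rabs (f x) <= C.
Proof.
  intros H; destruct (H 1 Rlt_0_1) as [d [Hd K]].
  assert (S1 : forall x y, a <= x <= y -> y <= b -> y - x < d -> Rabs (f y - f x) < 1).
  { intros x y Hx Hy Hxy.
    assert (Q := K 1%nat (fun _ => x) (fun _ => y)).
    simpl in Q. rewrite !Rplus_0_l in Q. apply Q; auto; intros; try lra; lia. }
  assert (S2 : forall n x, a <= x <= b -> x - a <= INR n * (d / 2) -> Rabs (f x - f a) <= INR n).
  { induction n as [|n IH]; intros x Hx Hn.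
    - simpl in *; replace x with a by lra; rewrite Rminus_diag, Rabs_R0; lra.
    - rewrite S_INR in *; destruct (Rle_dec (x - a) (INR n * (d / 2))) as [L|L].
      + specialize (IH x Hx L); lra.
      + set (y := a + INR n * (d / 2)).
        assert (a <= y) by (unfold y; generalize (pos_INR n); intros; assert (0 <= INR n * (d / 2)) by (apply Rmult_le_pos; lra); lra).
        assert (Rabs (f y - f a) <= INR n) by (apply IH; unfold y in *; lra).
        assert (Rabs (f x - f y) < 1) by (apply S1; unfold y in *; lra).
        replace (f x - f a) with ((f x - f y) + (f y - f a)) by ring.
        eapply Rle_trans; [apply Rabs_triang|lra]. }
  destruct (nfloor_ex (Rabs ((b - a) / (d / 2))) (Rabs_pos _)) as [n [_ Hn]].
  exists (INR (S n) + Rabs (f a) + 1); split.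
  - generalize (pos_INR (S n)) (Rabs_pos (f a)); lra.
  - intros x Hx.
    assert (Q : Rabs (f x - f a) <= INR (S n)).
    { apply S2; auto. rewrite S_INR. generalize (Rle_abs ((b - a) / (d / 2))); intros.
      replace (x - a) with ((x - a) / (d / 2) * (d / 2)) by (field; lra).
      apply Rmult_le_compat_r; [lra|].
      apply Rle_trans with ((b - a) / (d / 2)); [|lra].
      apply Rmult_le_compat_r; [|lra]. left; apply Rinv_0_lt_compat; lra. }
    replace (f x) with ((f x - f a) + f a) by ring.
    eapply Rle_trans; [apply Rabs_triang|lra].
Qed.

(* Real induction on the right endpoint: points outside the null set are crossed by differentiability,
   points of the null set by an interval of the cover.  The part of the cover to the left of the current
   point, [Rsum_lt (cov y) J], bounds the total length of the intervals spent so far. *)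
Lemma rac_bound a b f B (N : R -> Prop) : a <= b -> rac a b f -> null_set N -> 0 <= B ->
  (forall x, a <= x <= b -> ~ N x -> exists d, is_derive f x d /\ Rabs d <= B) ->
  Rabs (f b - f a) <= B * (b - a).
Proof.
  intros Hab Hac HN HB Hd.
  assert (Main : forall eps, 0 < eps -> Rabs (f b - f a) <= (B + eps) * (b - a) + eps).
  { intros eps He. destruct (Hac eps He) as [delta [Hdel Kac]].
    (* The cover is shorter than [delta], so the increments of [f] over disjoint pieces charged to
       it will sum to less than [eps]. *)
    destruct (HN (delta / 2)) as [l [r [A [Cov Sz]]]]; [lra|].
    set (cov := fun y j => Rmax 0 (Rmin (r j) y - l j)).
    assert (cov_nn : forall y j, 0 <= cov y j) by (intros; apply Rmax_l).
    assert (cov_mono : forall y z j, y <= z -> cov y j <= cov z j).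
    { intros y z j Hyz; unfold cov; apply Rle_max_compat_l.
      assert (Rmin (r j) y <= Rmin (r j) z) by (apply Rle_min_compat_l; auto). lra. }
    assert (cov_le : forall y j, cov y j <= r j - l j).
    { intros y j; unfold cov; apply Rmax_lub; [generalize (A j); lra|].
      generalize (Rmin_l (r j) y); lra. }
    (* Points [y] up to which the increment is accounted for: slope [B + eps] along [[a, y]], plus
       the increments over finitely many disjoint intervals [[l' i, r' i]], whose total length is
       charged to the cover. *)
    set (S := fun y => a <= y <= b /\ exists n (l' r' : nat -> R) J,
      (forall i, (i < n)%nat -> a <= l' i <= r' i /\ r' i <= y) /\
      (forall i j, (i < j < n)%nat -> r' i <= l' j) /\
      Rsum_lt (fun i => r' i - l' i) n <= Rsum_lt (cov y) J /\
      Rabs (f y - f a) <= (B + eps) * (y - a) + Rsum_lt (fun i => Rabs (f (r' i) - f (l' i))) n).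
    assert (Sa : S a).
    { split; [lra|]. exists 0%nat, (fun _ => 0), (fun _ => 0), 0%nat; simpl.
      rewrite Rminus_diag, Rabs_R0; repeat split; intros; try lia; lra. }
    assert (Ext1 : forall y z, S y -> y <= z <= b -> Rabs (f z - f y) <= (B + eps) * (z - y) -> S z).
    { intros y z [Hy [n [l' [r' [J [F1 [F2 [F3 F4]]]]]]]] Hz Hf; split; [lra|].
      exists n, l', r', J; split; [|split; [|split]]; auto.
      - intros i Hi; specialize (F1 i Hi); lra.
      - eapply Rle_trans; [exact F3|apply Rsum_le; intros; apply cov_mono; lra].
      - replace (f z - f a) with ((f z - f y) + (f y - f a)) by ring.
        eapply Rle_trans; [apply Rabs_triang|]. lra. }
    assert (Ext2 : forall y z t, S y -> y <= z <= b -> l t <= y -> z <= r t -> S z).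
    { intros y z t [Hy [n [l' [r' [J [F1 [F2 [F3 F4]]]]]]]] Hz Hl Hr; split; [lra|].
      exists (Datatypes.S n), (fun i => if Nat.ltb i n then l' i else y),
        (fun i => if Nat.ltb i n then r' i else z), (Nat.max J (Datatypes.S t)).
      assert (LT : forall i, (i < n)%nat -> Nat.ltb i n = true) by (intros; now apply Nat.ltb_lt).
      assert (GE : Nat.ltb n n = false) by (apply Nat.ltb_irrefl).
      split; [|split; [|split]].
      - intros i Hi; destruct (Nat.ltb_spec i n) as [L|L]; [specialize (F1 i L); lra|lra].
      - intros i j Hij; rewrite (LT i) by lia; destruct (Nat.ltb_spec j n) as [L|L].
        + apply F2; lia.
        + apply F1; lia.
      - cbn [Rsum_lt]; rewrite GE.
        rewrite (Rsum_ext _ (fun i => r' i - l' i)); [|intros i Hi; now rewrite LT].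
        (* Inside the [t]-th covering interval, moving from [y] to [z] adds [z - y] to the covered
           length, which pays for the new piece. *)
        assert (Inc : forall J, Rsum_lt (cov y) J + (if Nat.ltb t J then z - y else 0) <= Rsum_lt (cov z) J).
        { induction J0 as [|K IH]; [simpl; lra|]. cbn [Rsum_lt].
          assert (M := cov_mono y z K ltac:(lra)).
          destruct (Nat.ltb_spec t (Datatypes.S K)), (Nat.ltb_spec t K); try lra; try lia.
          assert (K = t) by lia; subst K.
          assert (E : cov z t - cov y t = z - y).
          { unfold cov; rewrite !Rmin_right, !Rmax_right by lra; ring. }
          lra. }
        specialize (Inc (Nat.max J (Datatypes.S t))).
        replace (Nat.ltb t (Nat.max J (Datatypes.S t))) with true in Inc by (symmetry; apply Nat.ltb_lt; lia).
        assert (M := Rsum_mono (cov y) J (Nat.max J (Datatypes.S t)) (cov_nn y) ltac:(lia)).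
        lra.
      - cbn [Rsum_lt]; rewrite GE.
        rewrite (Rsum_ext _ (fun i => Rabs (f (r' i) - f (l' i)))); [|intros i Hi; now rewrite LT].
        replace (f z - f a) with ((f z - f y) + (f y - f a)) by ring.
        eapply Rle_trans; [apply Rabs_triang|].
        assert (0 <= (B + eps) * (z - y)) by (apply Rmult_le_pos; lra). lra. }
    destruct (completeness S) as [s [Ub Lub]].
    { exists b; intros y [Hy _]; lra. }
    { now exists a. }
    assert (Hs : a <= s <= b).
    { split; [now apply Ub|apply Lub; intros y [Hy _]; lra]. }
    assert (Near : forall d, 0 < d -> exists y, S y /\ s - d < y <= s).
    { intros d Hdd; destruct (classic (exists y, S y /\ s - d < y)) as [[y [Sy Hy]]|Nn].
      - exists y; split; auto; split; auto; now apply Ub.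
      - exfalso; assert (s <= s - d); [|lra].
        apply Lub; intros y Sy; destruct (Rle_dec y (s - d)); auto; exfalso; apply Nn; exists y; split; auto; lra. }
    (* The supremum [s] is passed, or [b] is reached: through a covering interval if [s] lies in
       [N], by differentiability otherwise. *)
    assert (Hz : exists z, S z /\ (s < z \/ z = b)).
    { destruct (classic (N s)) as [Ns|Ns].
      - destruct (Cov s Ns) as [t Ht].
        destruct (Near (s - l t)) as [y [Sy Hy]]; [lra|].
        exists (Rmin ((s + r t) / 2) b).
        generalize (Rmin_l ((s + r t) / 2) b) (Rmin_r ((s + r t) / 2) b); intros Q1 Q2.
        assert (Q3 : s <= Rmin ((s + r t) / 2) b) by (apply Rmin_glb; lra).
        split.
        + apply (Ext2 y _ t Sy); lra.
        + destruct (Rle_dec ((s + r t) / 2) b); [rewrite Rmin_left by lra; left; lra|rewrite Rmin_right by lra; right; lra].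
      - destruct (Hd s Hs Ns) as [d [[_ Dd] Db]].
        specialize (Dd s (fun P H => H) (mkposreal eps He)).
        destruct Dd as [del Hdl].
        assert (Q : forall y, Rabs (y - s) < del -> Rabs (f y - f s) <= (B + eps) * Rabs (y - s)).
        { intros y Hy; specialize (Hdl y Hy); simpl in Hdl.
          change (Rabs ((f y - f s) - (y - s) * d) <= eps * Rabs (y - s)) in Hdl.
          replace (f y - f s) with (((f y - f s) - (y - s) * d) + (y - s) * d) by ring.
          eapply Rle_trans; [apply Rabs_triang|].
          rewrite Rabs_mult.
          assert (Rabs (y - s) * Rabs d <= Rabs (y - s) * B) by (apply Rmult_le_compat_l; [apply Rabs_pos|auto]).
          lra. }
        destruct (Near del (cond_pos del)) as [y [Sy Hy]].
        set (z := Rmin (s + del / 2) b).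
        assert (Pd := cond_pos del).
        assert (Q1 : z <= s + del / 2) by apply Rmin_l. assert (Q2 : z <= b) by apply Rmin_r.
        assert (Q3 : s <= z) by (apply Rmin_glb; lra).
        exists z; split.
        + apply (Ext1 y); auto; [lra|].
          replace (f z - f y) with ((f z - f s) - (f y - f s)) by ring.
          eapply Rle_trans; [apply Rabs_triang|]. rewrite Rabs_Ropp.
          assert (K1 := Q z). assert (K2 := Q y).
          rewrite Rabs_right in K1 by lra. rewrite (Rabs_left1 (y - s)) in K2 by lra.
          specialize (K1 ltac:(lra)). specialize (K2 ltac:(lra)). lra.
        + unfold z; destruct (Rle_dec (s + del / 2) b); [rewrite Rmin_left by lra; left; lra|rewrite Rmin_right by lra; right; lra]. }
    destruct Hz as [z [Sz' [Lt| ->]]]; [generalize (Ub z Sz'); lra|].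
    destruct Sz' as [_ [n [l' [r' [J [F1 [F2 [F3 F4]]]]]]]].
    assert (Rsum_lt (cov b) J <= Rsum_lt (fun i => r i - l i) J) by (apply Rsum_le; auto).
    assert (V := Kac n l' r' F1 (fun i j H => or_introl (F2 i j H))).
    specialize (Sz J). specialize (V ltac:(lra)). lra. }
  destruct (Rle_dec (Rabs (f b - f a)) (B * (b - a))) as [|Nle]; auto; exfalso.
  set (g := Rabs (f b - f a) - B * (b - a)).
  assert (Hg : 0 < g) by (unfold g; lra).
  assert (Hp : 0 < 2 * (b - a + 1)) by lra.
  specialize (Main (g / (2 * (b - a + 1))) ltac:(apply Rdiv_lt_0_compat; auto)).
  assert (E : g / (2 * (b - a + 1)) * (b - a) + g / (2 * (b - a + 1)) = g / 2) by (field; lra).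
  unfold g in *; lra.
Qed.

(** Weak solutions of a system with general coefficients, so that [mu] and [- E eps] play symmetric
    parts. *)
Definition wsol (f g : R -> R) (a b : R) (u w : R -> R) : Prop :=
  rac a b u /\ rac a b w /\ exists N, null_set N /\ forall x, a <= x <= b -> ~ N x ->
    is_derive u x (f x * w x) /\ is_derive w x (g x * u x).

Lemma wsol_lin f g a b u w u' w' s t : wsol f g a b u w -> wsol f g a b u' w' ->
  wsol f g a b (fun x => s * u x + t * u' x) (fun x => s * w x + t * w' x).
Proof.
  intros [U [W [N [HN D]]]] [U' [W' [N' [HN' D']]]]; split; [|split].
  - now apply rac_lin.
  - now apply rac_lin.
  - exists (fun x => N x \/ N' x); split; [now apply null_union|].
    intros x Hx Hn; destruct (D x Hx) as [D1 D2]; [tauto|]. destruct (D' x Hx) as [D1' D2']; [tauto|].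
    split; (eapply der_eq; [apply der_plus; apply der_scal; eassumption|cbv beta; ring]).
Qed.

(** Within distance [1 / (2 K)] of a common zero, each use of [rac_bound] halves an a priori bound
    on both functions, so both vanish there; steps of that length then exhaust [[a, b]]. *)
Lemma wsol_zero f g a b u w c : (exists K, 0 < K /\ forall x, a <= x <= b -> Rabs (f x) <= K /\ Rabs (g x) <= K) ->
  wsol f g a b u w -> a <= c <= b -> u c = 0 -> w c = 0 ->
  forall x, a <= x <= b -> u x = 0 /\ w x = 0.
Proof.
  intros [K [HK Kb]] [U [W [N [HN D]]]] Hc Uc Wc.
  destruct (rac_bounded a b u U) as [C1 [HC1 B1]], (rac_bounded a b w W) as [C2 [HC2 B2]].
  set (C := C1 + C2).
  assert (Loc : forall c, a <= c <= b -> u c = 0 -> w c = 0 -> forall n x, a <= x <= b ->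
     Rabs (x - c) <= / (2 * K) -> Rabs (u x) <= C * (/ 2) ^ n /\ Rabs (w x) <= C * (/ 2) ^ n).
  { clear c Hc Uc Wc; intros c Hc Uc Wc; induction n as [|n IH]; intros x Hx Hxc.
    - simpl; specialize (B1 x Hx); specialize (B2 x Hx); unfold C; lra.
    - assert (Pn : 0 < C * (/ 2) ^ n) by (unfold C; apply Rmult_lt_0_compat; [lra|apply pow_lt; lra]).
      assert (Bd : forall h k, rac a b h -> (forall y, a <= y <= b -> ~ N y -> is_derive h y (k y)) ->
         (forall y, a <= y <= b -> Rabs (y - c) <= / (2 * K) -> Rabs (k y) <= K * (C * (/ 2) ^ n)) -> h c = 0 ->
         Rabs (h x) <= C * (/ 2) ^ S n).
      { intros h k Hh Dh Kk h0.
        assert (Q : Rabs (h x) <= K * (C * (/ 2) ^ n) * Rabs (x - c)).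
        { assert (0 <= K * (C * (/ 2) ^ n)) by (apply Rmult_le_pos; lra).
          destruct (Rle_dec c x) as [L|L].
          - rewrite (Rabs_right (x - c)) in * by lra.
            replace (h x) with (h x - h c) by (rewrite h0; ring).
            apply (rac_bound c x h _ N); auto; try lra.
            + apply (rac_sub a b); auto; lra.
            + intros y Hy Ny; exists (k y); split; [apply Dh; auto; lra|].
              apply Kk; [lra|]. rewrite Rabs_right; lra.
          - rewrite (Rabs_left (x - c)) in * by lra.
            replace (- (x - c)) with (c - x) by ring.
            replace (h x) with (- (h c - h x)) by (rewrite h0; ring). rewrite Rabs_Ropp.
            apply (rac_bound x c h _ N); auto; try lra.
            + apply (rac_sub a b); auto; lra.
            + intros y Hy Ny; exists (k y); split; [apply Dh; auto; lra|].
              apply Kk; [lra|]. rewrite Rabs_left1; lra. }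
        eapply Rle_trans; [exact Q|].
        replace (C * (/ 2) ^ S n) with (K * (C * (/ 2) ^ n) * / (2 * K)) by (simpl; field; lra).
        apply Rmult_le_compat_l; auto; apply Rmult_le_pos; lra. }
      split.
      + apply (Bd u (fun y => f y * w y)); auto.
        * intros y Hy Ny; now apply D.
        * intros y Hy Hyc; rewrite Rabs_mult; apply Rmult_le_compat; try apply Rabs_pos; [apply Kb; auto|apply IH; auto].
      + apply (Bd w (fun y => g y * u y)); auto.
        * intros y Hy Ny; now apply D.
        * intros y Hy Hyc; rewrite Rabs_mult; apply Rmult_le_compat; try apply Rabs_pos; [apply Kb; auto|apply IH; auto]. }
  assert (Z : forall v, (forall n, Rabs v <= C * (/ 2) ^ n) -> v = 0).
  { intros v Hv; destruct (Req_dec v 0) as [|Nv]; auto; exfalso.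
    assert (Pv := Rabs_pos_lt v Nv).
    assert (HC : 0 < C) by (unfold C; lra).
    destruct (pow_lt_1_zero (/ 2) ltac:(rewrite Rabs_right; lra) (Rabs v / C) ltac:(apply Rdiv_lt_0_compat; auto)) as [n Hn].
    specialize (Hn n (Nat.le_refl n)). specialize (Hv n).
    rewrite Rabs_right in Hn by (left; apply Rlt_gt, pow_lt; lra).
    assert (C * (/ 2) ^ n < C * (Rabs v / C)) by (apply Rmult_lt_compat_l; auto).
    replace (C * (Rabs v / C)) with (Rabs v) in H by (field; lra). lra. }
  assert (Glob : forall m x, a <= x <= b -> Rabs (x - c) <= INR m * / (2 * K) -> u x = 0 /\ w x = 0).
  { assert (HK2 : 0 < / (2 * K)) by (apply Rinv_0_lt_compat; lra).
    induction m as [|m IH]; intros x Hx Hm.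
    - simpl in Hm; rewrite Rmult_0_l in Hm; assert (x = c); [|subst; auto].
      apply Rminus_diag_uniq; destruct (Req_dec (x - c) 0) as [|Nz]; auto.
      generalize (Rabs_pos_lt _ Nz); lra.
    - rewrite S_INR in Hm.
      assert (Pm := pos_INR m). assert (Pm2 : 0 <= INR m * / (2 * K)) by (apply Rmult_le_pos; lra).
      assert (Y : exists y, a <= y <= b /\ Rabs (y - c) <= INR m * / (2 * K) /\ Rabs (x - y) <= / (2 * K)).
      { destruct (Rle_dec (Rabs (x - c)) (INR m * / (2 * K))) as [L|L].
        - exists x; rewrite Rminus_diag, Rabs_R0; repeat split; try lra.
        - destruct (Rle_dec c x) as [L'|L'].
          + exists (c + INR m * / (2 * K)).
            rewrite Rabs_right in Hm, L by lra. split; [lra|split; rewrite Rabs_right; lra].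
          + exists (c - INR m * / (2 * K)).
            rewrite Rabs_left in Hm, L by lra. split; [lra|split; rewrite Rabs_left1; lra]. }
      destruct Y as [y [Hy [Hyc Hxy]]].
      destruct (IH y Hy Hyc) as [Uy Wy].
      split; apply Z; intros n; apply (Loc y Hy Uy Wy n x Hx Hxy). }
  intros x Hx.
  destruct (nfloor_ex (Rabs (x - c) * (2 * K))) as [m [_ Hm]].
  { apply Rmult_le_pos; [apply Rabs_pos|lra]. }
  apply (Glob (S m)); auto. rewrite S_INR.
  replace (Rabs (x - c)) with (Rabs (x - c) * (2 * K) * / (2 * K)) by (field; lra).
  apply Rmult_le_compat_r; [|lra]. left; apply Rinv_0_lt_compat; lra.
Qed.

(** * Solutions of the initial value problem *)

(** The weight [exp (2 K |x|)] is chosen so that integrating a derivative of size [K] times the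
    bound gains a factor 1/2, on an interval of any length. Negative arguments are reduced to
    positive ones by reflection. *)
Lemma off_exp_bound (G : R -> Prop) (h : R -> R) A K L : off_finite G -> 0 <= A -> 0 <= K ->
  (forall x, continuous h x) -> h 0 = 0 ->
  (forall x, - L < x < L -> G x -> exists d, is_derive h x d /\ Rabs d <= K * (A * exp (2 * K * Rabs x))) ->
  forall x, - L <= x <= L -> Rabs (h x) <= A / 2 * exp (2 * K * Rabs x).
Proof.
  intros HG HA HK.
  assert (Pos : forall (G : R -> Prop) (h : R -> R), off_finite G -> (forall x, continuous h x) -> h 0 = 0 ->
    (forall x, 0 < x < L -> G x -> exists d, is_derive h x d /\ Rabs d <= K * (A * exp (2 * K * Rabs x))) ->
    forall x, 0 <= x <= L -> Rabs (h x) <= A / 2 * exp (2 * K * Rabs x)).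
  { clear G h HG; intros G h HG Hc H0 Hd x Hx.
    assert (De : forall y, is_derive (fun z => A / 2 * exp (2 * K * z)) y (K * (A * exp (2 * K * y)))).
    { intros y; eapply der_eq.
      - apply der_scal, (der_comp (fun y => 2 * K * y) exp); [apply der_scal, der_id|apply is_derive_exp].
      - field. }
    assert (M1 : A / 2 * exp (2 * K * 0) - h 0 <= A / 2 * exp (2 * K * x) - h x).
    { apply (off_mono G HG (fun z => A / 2 * exp (2 * K * z) - h z)); [lra| |].
      - intros y; apply cont_minus; auto; eapply cont_derive, De.
      - intros y Hy Gy; destruct (Hd y) as [d [D B]]; [lra|auto|].
        eexists; split; [apply der_minus; [apply De|exact D]|].
        rewrite (Rabs_right y) in B by lra. apply Rabs_le_between in B; lra. }
    assert (M2 : A / 2 * exp (2 * K * 0) + h 0 <= A / 2 * exp (2 * K * x) + h x).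
    { apply (off_mono G HG (fun z => A / 2 * exp (2 * K * z) + h z)); [lra| |].
      - intros y; apply cont_plus; auto; eapply cont_derive, De.
      - intros y Hy Gy; destruct (Hd y) as [d [D B]]; [lra|auto|].
        eexists; split; [apply der_plus; [apply De|exact D]|].
        rewrite (Rabs_right y) in B by lra. apply Rabs_le_between in B; lra. }
    rewrite Rmult_0_r, exp_0, H0 in *. rewrite (Rabs_right x) by lra. apply Rabs_le; lra. }
  intros Hc H0 Hd x Hx; destruct (Rle_dec 0 x) as [L0|L0].
  - apply (Pos G h); auto; try lra; intros y Hy; apply Hd; lra.
  - rewrite <- (Rabs_Ropp x). replace (h x) with (h (- - x)) by (f_equal; ring).
    apply (Pos (fun y => G (- y)) (fun y => h (- y))); try lra.
    + intros a b; destruct (HG (- b) (- a)) as [l Hl]; exists (map Ropp l); intros y Hy Ny.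
      apply Hl; [lra|]. intros I; apply Ny. apply in_map_iff; exists (- y); split; [ring|auto].
    + intros y; apply (cont_comp Ropp h); auto; apply cont_opp, cont_id.
    + rewrite Ropp_0; auto.
    + intros y Hy Gy; destruct (Hd (- y)) as [d [D B]]; [lra|auto|].
      rewrite Rabs_Ropp in B.
      exists (- (1) * d); split; [apply (der_comp Ropp h); auto; apply der_opp, der_id|].
      replace (- (1) * d) with (- d) by ring; now rewrite Rabs_Ropp.
Qed.

Lemma geom_tail (a : nat -> R) M N : 0 <= M -> (forall n, Rabs (a n) <= M * (/ 2) ^ n) ->
  Rabs (Series a - sum_f_R0 a N) <= M * (/ 2) ^ N.
Proof.
  intros HM Ha.
  assert (G : Rabs (/ 2) < 1) by (rewrite Rabs_right; lra).
  assert (Eg : ex_series (fun n => (/ 2) ^ n)) by (now apply ex_series_geom).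
  assert (Ea : ex_series a).
  { apply (@ex_series_le R_AbsRing R_CompleteNormedModule a (fun n => M * (/ 2) ^ n)); auto.
    now apply (ex_series_scal_l M (fun n => (/ 2) ^ n)). }
  rewrite (Series_incr_n a (S N)) by (auto; lia). simpl pred.
  replace (sum_f_R0 a N + Series (fun k => a (S N + k)%nat) - sum_f_R0 a N)
    with (Series (fun k => a (S N + k)%nat)) by ring.
  assert (E2 : ex_series (fun k => M * (/ 2) ^ S N * (/ 2) ^ k)) by now apply (ex_series_scal_l (M * (/ 2) ^ S N) (fun k => (/ 2) ^ k)).
  assert (B2 : forall k, 0 <= Rabs (a (S N + k)%nat) <= M * (/ 2) ^ S N * (/ 2) ^ k).
  { intros k; split; [apply Rabs_pos|]. rewrite Rmult_assoc, <- pow_add; apply Ha. }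
  eapply Rle_trans; [apply Series_Rabs|].
  - apply (@ex_series_le R_AbsRing R_CompleteNormedModule _ (fun k => M * (/ 2) ^ S N * (/ 2) ^ k)); auto.
    intros k; change (Rabs (Rabs (a (S N + k)%nat)) <= M * (/ 2) ^ S N * (/ 2) ^ k).
    rewrite Rabs_Rabsolu; apply B2.
  - eapply Rle_trans; [apply (Series_le _ (fun k => M * (/ 2) ^ S N * (/ 2) ^ k)); auto|].
    rewrite Series_scal_l, Series_geom by auto. simpl pow. apply Req_le; field.
Qed.

(* The iterates for [u' = f w], [w' = g u] are [u_n = picard f g u0 w0 n] and [w_n = picard g f w0 u0 n];
   the solution is their sum over [n]. *)
Fixpoint picard (f g : R -> R) (u0 w0 : R) (n : nat) : R -> R :=
  match n with
  | O => fun _ => u0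
  | S m => fun x => RInt (fun y => f y * picard g f w0 u0 m y) 0 x
  end.

Lemma picard_cont f g u0 w0 n : piecewise_continuous f -> piecewise_continuous g ->
  forall x, continuous (picard f g u0 w0 n) x.
Proof.
  intros Hf Hg; revert f g u0 w0 Hf Hg; induction n as [|n IH]; intros f g u0 w0 Hf Hg x.
  - apply cont_const.
  - apply prim_cont, pwc_mult; auto; apply pwc_cont; auto.
Qed.

(** Each iterate of one component integrates the previous iterate of the other, so the induction
    runs over both orders of [f] and [g] at once; for that reason the constant is symmetric in the
    initial data. *)
Lemma picard_bound f g u0 w0 L K : piecewise_continuous f -> piecewise_continuous g -> 0 <= K ->
  (forall x, - L <= x <= L -> Rabs (f x) <= K /\ Rabs (g x) <= K) ->
  forall n x, - L <= x <= L ->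
    Rabs (picard f g u0 w0 n x) <= (Rabs u0 + Rabs w0) * (/ 2) ^ n * exp (2 * K * Rabs x).
Proof.
  intros Hf Hg HK Hb n; revert f g u0 w0 Hf Hg Hb; induction n as [|n IH]; intros f g u0 w0 Hf Hg Hb x Hx.
  - simpl. assert (1 <= exp (2 * K * Rabs x)).
    { apply Rle_trans with (1 + 2 * K * Rabs x).
      - assert (0 <= 2 * K * Rabs x) by (apply Rmult_le_pos; [lra|apply Rabs_pos]); lra.
      - apply exp_ineq1_le. }
    generalize (Rabs_pos u0) (Rabs_pos w0); intros.
    rewrite Rmult_1_r. apply Rle_trans with ((Rabs u0 + Rabs w0) * 1); [lra|apply Rmult_le_compat_l; lra].
  - replace ((Rabs u0 + Rabs w0) * (/ 2) ^ S n) with ((Rabs w0 + Rabs u0) * (/ 2) ^ n / 2) by (simpl; field).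
    assert (Hw := fun y => picard_cont g f w0 u0 n Hg Hf y).
    assert (Pf : piecewise_continuous (fun y => f y * picard g f w0 u0 n y)) by (apply pwc_mult; auto; apply pwc_cont; auto).
    apply (off_exp_bound (continuous f) _ _ K L); auto.
    + now apply pwc_off.
    + apply Rmult_le_pos; [generalize (Rabs_pos u0) (Rabs_pos w0); lra|apply pow_le; lra].
    + intros; now apply prim_cont.
    + apply (RInt_point (V := R_CompleteNormedModule)).
    + intros y Hy Gy; exists (f y * picard g f w0 u0 n y); split.
      * apply (prim_derive _ 0 y Pf), cont_mult; auto.
      * rewrite Rabs_mult; apply Rmult_le_compat; try apply Rabs_pos; [apply Hb; lra|].
        apply IH; auto; [|lra]. intros z Hz; destruct (Hb z Hz); auto.
Qed.

Lemma pwc_bounded2 f g L : piecewise_continuous f -> piecewise_continuous g ->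
  exists K, 0 < K /\ forall x, - L <= x <= L -> Rabs (f x) <= K /\ Rabs (g x) <= K.
Proof.
  intros Hf Hg; destruct (pwc_bounded f (- L) L Hf) as [K1 [P1 B1]], (pwc_bounded g (- L) L Hg) as [K2 [P2 B2]].
  exists (K1 + K2); split; [lra|]; intros x Hx; specialize (B1 x Hx); specialize (B2 x Hx); lra.
Qed.

Lemma picard_unif f g u0 w0 L : piecewise_continuous f -> piecewise_continuous g ->
  exists M, 0 <= M /\ forall N x, - L <= x <= L ->
   Rabs (Series (fun n => picard f g u0 w0 n x) - sum_f_R0 (fun n => picard f g u0 w0 n x) N) <= M * (/ 2) ^ N.
Proof.
  intros Hf Hg; destruct (pwc_bounded2 f g L Hf Hg) as [K [HK Kb]].
  set (M := (Rabs u0 + Rabs w0) * exp (2 * K * L)).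
  assert (HM : 0 <= M).
  { apply Rmult_le_pos; [generalize (Rabs_pos u0) (Rabs_pos w0); lra|left; apply exp_pos]. }
  exists M; split; auto; intros N x Hx; apply geom_tail; auto; intros n.
  eapply Rle_trans; [apply (picard_bound f g u0 w0 L K); auto; lra|].
  unfold M. replace ((Rabs u0 + Rabs w0) * exp (2 * K * L) * (/ 2) ^ n) with
    ((Rabs u0 + Rabs w0) * (/ 2) ^ n * exp (2 * K * L)) by ring.
  apply Rmult_le_compat_l.
  - apply Rmult_le_pos; [generalize (Rabs_pos u0) (Rabs_pos w0); lra|apply pow_le; lra].
  - assert (Q : 2 * K * Rabs x <= 2 * K * L) by (apply Rmult_le_compat_l; [lra|apply Rabs_le; lra]).
    destruct Q as [Q|Q]; [left; now apply exp_increasing|rewrite Q; lra].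
Qed.

Lemma half_pow_small M eps : 0 <= M -> 0 < eps -> exists N, M * (/ 2) ^ N < eps.
Proof.
  intros HM He.
  destruct (pow_lt_1_zero (/ 2) ltac:(rewrite Rabs_right; lra) (eps / (M + 1)) ltac:(apply Rdiv_lt_0_compat; lra)) as [n Hn].
  specialize (Hn n (Nat.le_refl n)); rewrite Rabs_right in Hn by (left; apply Rlt_gt, pow_lt; lra).
  exists n. apply Rle_lt_trans with ((M + 1) * (/ 2) ^ n).
  - apply Rmult_le_compat_r; [apply pow_le; lra|lra].
  - replace eps with ((M + 1) * (eps / (M + 1))) by (field; lra). apply Rmult_lt_compat_l; lra.
Qed.

Lemma cont_unif (S : R -> R) x : (forall eps, 0 < eps -> exists g : R -> R, continuous g x /\
   locally x (fun y => Rabs (S y - g y) <= eps)) -> continuous S x.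
Proof.
  intros H P [eps HP].
  destruct (H (eps / 4)) as [g [Hg Hl]]; [generalize (cond_pos eps); lra|].
  assert (Pe : 0 < eps / 4) by (generalize (cond_pos eps); lra).
  specialize (Hg _ (locally_ball (g x) (mkposreal _ Pe))).
  assert (Lx := locally_singleton _ _ Hl). cbv beta in Lx.
  unfold filtermap in Hg |- *.
  generalize (filter_and _ _ Hl Hg). apply filter_imp; intros y [H1 H2].
  apply HP. change (Rabs (S y - S x) < eps). change (Rabs (g y - g x) < eps / 4) in H2.
  replace (S y - S x) with ((S y - g y) + (g y - g x) - (S x - g x)) by ring.
  eapply Rle_lt_trans; [apply Rabs_triang|]. rewrite Rabs_Ropp.
  assert (Q := Rabs_triang (S y - g y) (g y - g x)). lra.
Qed.

Lemma sum_cont (a : nat -> R -> R) x N : (forall n, continuous (a n) x) ->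
  continuous (fun y => sum_f_R0 (fun n => a n y) N) x.
Proof. intros H; induction N; simpl; [apply H|apply cont_plus; auto]. Qed.

Lemma picard_sum_cont f g u0 w0 x : piecewise_continuous f -> piecewise_continuous g ->
  continuous (fun y => Series (fun n => picard f g u0 w0 n y)) x.
Proof.
  intros Hf Hg; apply cont_unif; intros eps He.
  destruct (picard_unif f g u0 w0 (Rabs x + 1) Hf Hg) as [M [HM B]].
  destruct (half_pow_small M eps HM He) as [N HN].
  exists (fun y => sum_f_R0 (fun n => picard f g u0 w0 n y) N); split.
  - apply sum_cont; intros; now apply picard_cont.
  - exists (mkposreal 1 Rlt_0_1); intros y Hy; change (Rabs (y - x) < 1) in Hy.
    left; eapply Rle_lt_trans; [apply B|exact HN].
    apply Rabs_le_between. replace y with ((y - x) + x) by ring.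
    eapply Rle_trans; [apply Rabs_triang|lra].
Qed.

(** Series and integral need not be exchanged: a partial sum minus the claimed right-hand side has
    derivative [f] times the error of a partial sum of the other component, which is uniformly
    small. *)
Lemma picard_sum_eq f g u0 w0 x : piecewise_continuous f -> piecewise_continuous g ->
  Series (fun n => picard f g u0 w0 n x) =
    u0 + RInt (fun y => f y * Series (fun n => picard g f w0 u0 n y)) 0 x.
Proof.
  intros Hf Hg. set (u := fun x => Series (fun n => picard f g u0 w0 n x)).
  set (w := fun x => Series (fun n => picard g f w0 u0 n x)).
  assert (Cw : forall y, continuous w y) by (intros; now apply picard_sum_cont).
  assert (Pf : piecewise_continuous (fun y => f y * w y)) by (apply pwc_mult; auto; now apply pwc_cont).
  set (L := Rabs x).
  assert (HL : 0 <= L) by apply Rabs_pos.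
  assert (Hx : - L <= x <= L) by (apply Rabs_le_between; unfold L; lra).
  destruct (picard_unif f g u0 w0 L Hf Hg) as [M1 [HM1 B1]], (picard_unif g f w0 u0 L Hg Hf) as [M2 [HM2 B2]].
  destruct (pwc_bounded2 f g L Hf Hg) as [K [HK Kb]].
  assert (Main : forall N, Rabs (u x - (u0 + RInt (fun y => f y * w y) 0 x)) <= (M1 + K * M2 * L) * (/ 2) ^ N).
  { intros N.
    set (h := fun y => sum_f_R0 (fun n => picard f g u0 w0 n y) (S N) - u0 - RInt (fun y => f y * w y) 0 y).
    assert (Dh : forall y, continuous f y -> is_derive h y (f y * (sum_f_R0 (fun n => picard g f w0 u0 n y) N - w y))).
    { intros y Gy.
      assert (DS : forall m, is_derive (fun z => sum_f_R0 (fun n => picard f g u0 w0 n z) (S m)) y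
                (f y * sum_f_R0 (fun n => picard g f w0 u0 n y) m)).
      { assert (D1 : forall n, is_derive (picard f g u0 w0 (S n)) y (f y * picard g f w0 u0 n y)).
        { intros n; apply (prim_derive (fun z => f z * picard g f w0 u0 n z) 0 y).
          - apply pwc_mult; auto; apply pwc_cont; intros; now apply picard_cont.
          - apply cont_mult; auto; now apply picard_cont. }
        induction m as [|m IH].
        - change (is_derive (fun z => u0 + picard f g u0 w0 1 z) y (f y * picard g f w0 u0 0 y)).
          eapply der_eq; [apply der_plus; [apply der_const|apply (D1 0%nat)]|ring].
        - change (is_derive (fun z => sum_f_R0 (fun n => picard f g u0 w0 n z) (S m) + picard f g u0 w0 (S (S m)) z) y
            (f y * (sum_f_R0 (fun n => picard g f w0 u0 n y) m + picard g f w0 u0 (S m) y))).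
          eapply der_eq; [apply der_plus; [apply IH|apply (D1 (S m))]|ring]. }
      eapply der_eq.
      - apply der_minus; [apply der_minus; [apply DS|apply der_const]|].
        apply (prim_derive _ 0 y Pf), cont_mult; auto.
      - cbv beta; ring. }
    assert (Ch : forall y, continuous h y).
    { intros y; apply cont_minus; [apply cont_minus; [|apply cont_const]|now apply prim_cont].
      apply sum_cont; intros; now apply picard_cont. }
    assert (h0 : h 0 = 0).
    { assert (Z : RInt (fun y => f y * w y) 0 0 = 0) by apply (RInt_point (V := R_CompleteNormedModule)).
      unfold h; rewrite Z.
      assert (Q : forall m, sum_f_R0 (fun n => picard f g u0 w0 n 0) m = u0).
      { induction m as [|m IH]; [reflexivity|]. simpl sum_f_R0. rewrite IH.
        rewrite (RInt_point (V := R_CompleteNormedModule)). change (@zero R_CompleteNormedModule) with 0; ring. }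
      rewrite Q; ring. }
    assert (Dbd : forall y, - L < y < L -> continuous f y -> exists d, is_derive h y d /\ Rabs d <= K * (M2 * (/ 2) ^ N)).
    { intros y Hy Gy; eexists; split; [apply Dh; auto|].
      rewrite Rabs_mult; apply Rmult_le_compat; try apply Rabs_pos; [apply Kb; lra|].
      rewrite Rabs_minus_sym; apply B2; lra. }
    assert (Hh : Rabs (h x) <= K * (M2 * (/ 2) ^ N) * L).
    { unfold L; destruct (Rle_dec 0 x) as [L0|L0].
      - replace (h x) with (h x - h 0) by (rewrite h0; ring). rewrite (Rabs_right x) by lra.
        replace x with (x - 0) at 2 by ring. apply (off_bound _ (pwc_off f Hf)); auto.
        intros y Hy; apply Dbd; lra.
      - replace (h x) with (- (h 0 - h x)) by (rewrite h0; ring). rewrite Rabs_Ropp, (Rabs_left x) by lra.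
        replace (- x) with (0 - x) by ring. apply (off_bound _ (pwc_off f Hf)); auto; [lra|].
        intros y Hy; apply Dbd; lra. }
    replace (u x - (u0 + RInt (fun y => f y * w y) 0 x)) with
      ((u x - sum_f_R0 (fun n => picard f g u0 w0 n x) (S N)) + h x) by (unfold h; ring).
    eapply Rle_trans; [apply Rabs_triang|].
    specialize (B1 (S N) x Hx).
    assert (M1 * (/ 2) ^ S N <= M1 * (/ 2) ^ N).
    { apply Rmult_le_compat_l; auto; simpl. assert (0 < (/ 2) ^ N) by (apply pow_lt; lra). lra. }
    unfold u in *; lra. }
  assert (Z : u x - (u0 + RInt (fun y => f y * w y) 0 x) = 0).
  { destruct (Req_dec (u x - (u0 + RInt (fun y => f y * w y) 0 x)) 0) as [|Nz]; auto; exfalso.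
    assert (HM : 0 <= M1 + K * M2 * L).
    { assert (0 <= K * M2 * L) by (apply Rmult_le_pos; auto; apply Rmult_le_pos; lra). lra. }
    destruct (half_pow_small _ _ HM (Rabs_pos_lt _ Nz)) as [N HN].
    specialize (Main N); lra. }
  unfold u, w in *; lra.
Qed.

(** * Classical solutions *)

Definition good (eps mu : R -> R) (x : R) : Prop := continuous eps x /\ continuous mu x.

(** Solutions on the whole line, differentiated only at common continuity points of the
    coefficients. Here [w] is the quasi-derivative [u' / mu], which stays continuous where [mu]
    jumps. *)
Definition nsol (eps mu : R -> R) (E : R) (u w : R -> R) : Prop :=
  (forall x, continuous u x) /\ (forall x, continuous w x) /\
  forall x, good eps mu x -> is_derive u x (mu x * w x) /\ is_derive w x (- E * eps x * u x).

Section Sols.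
Variables eps mu : R -> R.
Hypothesis Heps : piecewise_continuous eps.
Hypothesis Hmu : piecewise_continuous mu.

Lemma good_off : off_finite (good eps mu).
Proof. apply off_finite_and; now apply pwc_off. Qed.

Lemma nsol_exists E u0 w0 : exists u w, nsol eps mu E u w /\ u 0 = u0 /\ w 0 = w0.
Proof.
  set (f := mu). set (g := fun x => - E * eps x).
  assert (Hg : piecewise_continuous g) by (now apply pwc_scal).
  exists (fun x => Series (fun n => picard f g u0 w0 n x)), (fun x => Series (fun n => picard g f w0 u0 n x)).
  assert (C1 : forall x, continuous (fun x => Series (fun n => picard f g u0 w0 n x)) x) by (intros; now apply picard_sum_cont).
  assert (C2 : forall x, continuous (fun x => Series (fun n => picard g f w0 u0 n x)) x) by (intros; now apply picard_sum_cont).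
  split; [split; [|split]|split]; auto.
  - intros x [Gx1 Gx2]; split.
    + apply (is_derive_ext (fun x => u0 + RInt (fun y => f y * Series (fun n => picard g f w0 u0 n y)) 0 x)).
      { intros t; symmetry; now apply picard_sum_eq. }
      eapply der_eq; [apply der_plus; [apply der_const|apply prim_derive]|cbv beta; ring].
      * apply pwc_mult; auto; now apply pwc_cont.
      * apply cont_mult; auto.
    + apply (is_derive_ext (fun x => w0 + RInt (fun y => g y * Series (fun n => picard f g u0 w0 n y)) 0 x)).
      { intros t; symmetry; now apply picard_sum_eq. }
      eapply der_eq; [apply der_plus; [apply der_const|apply prim_derive]|unfold g; cbv beta; ring].
      * apply pwc_mult; auto; now apply pwc_cont.
      * apply cont_mult; auto. apply cont_mult; auto; apply cont_const.
  - rewrite picard_sum_eq by auto. rewrite (RInt_point (V := R_CompleteNormedModule)).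
    change (@zero R_CompleteNormedModule) with 0; ring.
  - rewrite picard_sum_eq by auto. rewrite (RInt_point (V := R_CompleteNormedModule)).
    change (@zero R_CompleteNormedModule) with 0; ring.
Qed.

Lemma nsol_lin E u w u' w' s t : nsol eps mu E u w -> nsol eps mu E u' w' ->
  nsol eps mu E (fun x => s * u x + t * u' x) (fun x => s * w x + t * w' x).
Proof.
  intros [U [W D]] [U' [W' D']]; split; [|split].
  - intros; apply cont_plus; apply cont_mult; auto; apply cont_const.
  - intros; apply cont_plus; apply cont_mult; auto; apply cont_const.
  - intros x Gx; destruct (D x Gx), (D' x Gx); split;
    (eapply der_eq; [apply der_plus; apply der_scal; eassumption|cbv beta; ring]).
Qed.

Definition lip (a b : R) (f : R -> R) : Prop :=
  exists K, 0 <= K /\ forall x y, a <= x -> x <= y -> y <= b -> Rabs (f y - f x) <= K * (y - x).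

(** Makes classical solutions absolutely continuous, so that they can be compared with weak ones. *)
Lemma nsol_lip E u w a b : nsol eps mu E u w -> lip a b u /\ lip a b w.
Proof.
  intros [U [W D]].
  assert (Gen : forall f g h, piecewise_continuous f -> (forall x, continuous g x) -> (forall x, continuous h x) ->
     (forall x, good eps mu x -> is_derive h x (f x * g x)) -> lip a b h).
  { intros f g h Hf Hg Hh Dh.
    destruct (pwc_bounded _ a b (pwc_mult _ _ Hf (pwc_cont _ Hg))) as [K [HK Kb]].
    exists K; split; [lra|]; intros x y Hx Hxy Hy.
    apply (off_bound _ good_off); auto; intros z Hz Gz; eexists; split; [now apply Dh|apply Kb; lra]. }
  split.
  - apply (Gen mu w); auto; intros; now apply D.
  - apply (Gen (fun x => - E * eps x) u); auto; [now apply pwc_scal|]; intros; now apply D.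
Qed.

Lemma lip_rac a b f : lip a b f -> rac a b f.
Proof.
  intros [K [HK Kb]] e He; exists (e / (K + 1)).
  split; [apply Rdiv_lt_0_compat; lra|]; intros n l r H1 _ H3.
  apply Rle_lt_trans with (Rsum_lt (fun i => K * (r i - l i)) n).
  - apply Rsum_le; intros i Hi; specialize (H1 i Hi); apply Kb; lra.
  - rewrite Rsum_scal.
    assert (N0 : 0 <= Rsum_lt (fun i => r i - l i) n) by (apply Rsum_nonneg; intros i Hi; specialize (H1 i Hi); lra).
    apply Rle_lt_trans with ((K + 1) * Rsum_lt (fun i => r i - l i) n); [lra|].
    replace e with ((K + 1) * (e / (K + 1))) by (field; lra). apply Rmult_lt_compat_l; lra.
Qed.

Lemma nsol_wsol E u w a b : nsol eps mu E u w -> wsol mu (fun x => - E * eps x) a b u w.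
Proof.
  intros H; destruct (nsol_lip E u w a b H) as [L1 L2]; split; [|split]; try now apply lip_rac.
  exists (fun x => ~ good eps mu x); split; [apply off_finite_null, good_off|].
  intros x _ Gx; apply NNPP in Gx; now apply H.
Qed.

Lemma coef_bounded E a b : exists K, 0 < K /\ forall x, a <= x <= b -> Rabs (mu x) <= K /\ Rabs (- E * eps x) <= K.
Proof.
  destruct (pwc_bounded mu a b Hmu) as [K1 [P1 B1]], (pwc_bounded _ a b (pwc_scal (- E) _ Heps)) as [K2 [P2 B2]].
  exists (K1 + K2); split; [lra|]; intros x Hx; specialize (B1 x Hx); specialize (B2 x Hx); lra.
Qed.

Lemma wsol_unique E a b u w u' w' c : wsol mu (fun x => - E * eps x) a b u w ->
  wsol mu (fun x => - E * eps x) a b u' w' -> a <= c <= b -> u c = u' c -> w c = w' c ->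
  forall x, a <= x <= b -> u x = u' x /\ w x = w' x.
Proof.
  intros H H' Hc Eu Ew x Hx.
  destruct (wsol_zero _ _ a b _ _ c (coef_bounded E a b) (wsol_lin _ _ _ _ _ _ _ _ 1 (-1) H H') Hc) with (x := x) as [Z1 Z2]; auto.
  - rewrite Eu; ring.
  - rewrite Ew; ring.
  - lra.
Qed.

Lemma nsol_unique E u w u' w' c : nsol eps mu E u w -> nsol eps mu E u' w' ->
  u c = u' c -> w c = w' c -> forall x, u x = u' x /\ w x = w' x.
Proof.
  intros H H' Eu Ew x.
  generalize (Rmin_l x c) (Rmin_r x c) (Rmax_l x c) (Rmax_r x c); intros.
  apply (wsol_unique E (Rmin x c) (Rmax x c) u w u' w' c); auto; try lra; now apply nsol_wsol.
Qed.

Lemma nsol_zero E u w c : nsol eps mu E u w -> u c = 0 -> w c = 0 -> forall x, u x = 0 /\ w x = 0.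
Proof.
  intros H Uc Wc x.
  assert (Z := nsol_lin E u w u w 0 0 H H).
  destruct (nsol_unique E _ _ _ _ c H Z ltac:(lra) ltac:(lra) x); split; lra.
Qed.
End Sols.

(** * The monodromy matrix and its dependence on the energy *)

Definition sol (eps mu : R -> R) (E u0 w0 : R) : (R -> R) * (R -> R) :=
  epsilon (inhabits ((fun _ => 0), (fun _ => 0)))
    (fun s => nsol eps mu E (fst s) (snd s) /\ fst s 0 = u0 /\ snd s 0 = w0).
(** The usual cosine-like and sine-like fundamental solutions; the prefix [d] marks the
    quasi-derivative. *)
Definition th eps mu E := fst (sol eps mu E 1 0).
Definition dth eps mu E := snd (sol eps mu E 1 0).
Definition ph eps mu E := fst (sol eps mu E 0 1).
Definition dph eps mu E := snd (sol eps mu E 0 1).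
(* The monodromy matrix over one period is [[pp, qq], [rr, pp]], see [dph1]. *)
Definition pp eps mu E := th eps mu E 1.
Definition qq eps mu E := ph eps mu E 1.
Definition rr eps mu E := dth eps mu E 1.

Section Op.
Variables eps mu : R -> R.
Hypothesis Aeps : admissible_coef eps.
Hypothesis Amu : admissible_coef mu.

Let Heps : piecewise_continuous eps := proj1 (proj2 Aeps).
Let Hmu : piecewise_continuous mu := proj1 (proj2 Amu).
Let Peps : forall x, 0 < eps x := proj1 Aeps.
Let Pmu : forall x, 0 < mu x := proj1 Amu.

Let go := good_off eps mu Heps Hmu.

Lemma sol_spec E u0 w0 : nsol eps mu E (fst (sol eps mu E u0 w0)) (snd (sol eps mu E u0 w0)) /\
  fst (sol eps mu E u0 w0) 0 = u0 /\ snd (sol eps mu E u0 w0) 0 = w0.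
Proof.
  unfold sol; apply epsilon_spec.
  destruct (nsol_exists eps mu Heps Hmu E u0 w0) as [u [w H]]; now exists (u, w).
Qed.

Lemma th_sol E : nsol eps mu E (th eps mu E) (dth eps mu E).
Proof. apply sol_spec. Qed.
Lemma ph_sol E : nsol eps mu E (ph eps mu E) (dph eps mu E).
Proof. apply sol_spec. Qed.
Lemma th0 E : th eps mu E 0 = 1. Proof. apply (sol_spec E 1 0). Qed.
Lemma dth0 E : dth eps mu E 0 = 0. Proof. apply (sol_spec E 1 0). Qed.
Lemma ph0 E : ph eps mu E 0 = 0. Proof. apply (sol_spec E 0 1). Qed.
Lemma dph0 E : dph eps mu E 0 = 1. Proof. apply (sol_spec E 0 1). Qed.

Opaque th dth ph dph.

Lemma nsol_repr E u w : nsol eps mu E u w -> forall x,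
  u x = u 0 * th eps mu E x + w 0 * ph eps mu E x /\
  w x = u 0 * dth eps mu E x + w 0 * dph eps mu E x.
Proof.
  intros H x.
  apply (nsol_unique eps mu Heps Hmu E u w (fun y => u 0 * th eps mu E y + w 0 * ph eps mu E y)
           (fun y => u 0 * dth eps mu E y + w 0 * dph eps mu E y) 0 H).
  - apply nsol_lin; [apply th_sol|apply ph_sol].
  - rewrite th0, ph0; ring.
  - rewrite dth0, dph0; ring.
Qed.

(** The function [u z - w v] has derivative [(E - E') eps u v]. Equal energies give the constancy of
    the Wronskian, different ones the derivatives in [E]. *)
Lemma lagrange E E' u w v z a b : nsol eps mu E u w -> nsol eps mu E' v z -> a <= b ->
  (E - E') * RInt (fun x => eps x * (u x * v x)) a b = (u b * z b - w b * v b) - (u a * z a - w a * v a).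
Proof.
  intros [U [W D]] [V [Z D']] Hab.
  assert (Pk : piecewise_continuous (fun x => eps x * (u x * v x))).
  { apply pwc_mult; auto; apply pwc_cont; intros; apply cont_mult; auto. }
  assert (Q := RInt_FTC (fun x => u x * z x - w x * v x) (fun x => (E - E') * (eps x * (u x * v x))) (good eps mu) a b Hab go).
  rewrite <- Q.
  - symmetry; apply (RInt_scal (V := R_CompleteNormedModule)); now apply pwc_ex_RInt.
  - now apply pwc_scal.
  - intros; apply cont_minus; apply cont_mult; auto.
  - intros x _ Gx; destruct (D x Gx), (D' x Gx).
    eapply der_eq; [apply der_minus; apply der_mult; eassumption|cbv beta; ring].
Qed.

Lemma wronskian E u w v z : nsol eps mu E u w -> nsol eps mu E v z -> forall x, 0 <= x ->
  u x * z x - w x * v x = u 0 * z 0 - w 0 * v 0.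
Proof. intros H H' x Hx. assert (Q := lagrange E E u w v z 0 x H H' Hx). lra. Qed.

Lemma fund_det E x : 0 <= x -> th eps mu E x * dph eps mu E x - dth eps mu E x * ph eps mu E x = 1.
Proof.
  intros Hx; rewrite (wronskian E _ _ _ _ (th_sol E) (ph_sol E) x Hx), th0, dth0, ph0, dph0; ring.
Qed.

Lemma nsol_shift E u w : nsol eps mu E u w -> nsol eps mu E (fun x => u (x + 1)) (fun x => w (x + 1)).
Proof.
  assert (Cs : forall x, continuous (fun y => y + 1) x) by (intros; apply cont_plus; [apply cont_id|apply cont_const]).
  assert (Ds : forall x, is_derive (fun y => y + 1) x 1).
  { intros; eapply der_eq; [apply der_plus; [apply der_id|apply der_const]|ring]. }
  intros [U [W D]]; split; [|split].
  - intros x; apply (cont_comp (fun y => y + 1) u); auto.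
  - intros x; apply (cont_comp (fun y => y + 1) w); auto.
  - intros x [G1 G2].
    assert (G : good eps mu (x + 1)).
    { assert (S : forall f, one_periodic f -> continuous f x -> continuous f (x + 1)).
      { intros f Pf Cf. apply (continuous_ext (fun y => f (y - 1))).
        - intros y; rewrite <- (Pf (y - 1)); f_equal; ring.
        - apply (cont_comp (fun y => y - 1) f); [apply cont_minus; [apply cont_id|apply cont_const]|].
          replace (x + 1 - 1) with x by ring; auto. }
      split; apply S; auto; [apply Aeps|apply Amu]. }
    destruct (D _ G) as [D1 D2].
    replace (mu (x + 1)) with (mu x) in D1 by (symmetry; apply Amu).
    replace (eps (x + 1)) with (eps x) in D2 by (symmetry; apply Aeps).
    split; (eapply der_eq; [apply (der_comp (fun y => y + 1)); [apply Ds|eassumption]|cbv beta; ring]).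
Qed.

(** Evenness of the coefficients allows reflection at the origin, with a sign on the
    quasi-derivative. This is how the left half-line is later reduced to the right one. *)
Lemma nsol_opp E u w : nsol eps mu E u w -> nsol eps mu E (fun x => u (- x)) (fun x => - w (- x)).
Proof.
  assert (Cs : forall x, continuous Ropp x) by (intros; apply cont_opp, cont_id).
  assert (Ds : forall x, is_derive Ropp x (-1)) by (intros; apply der_opp, der_id).
  intros [U [W D]]; split; [|split].
  - intros x; apply (cont_comp Ropp u); auto.
  - intros x; apply cont_opp, (cont_comp Ropp w); auto.
  - intros x [G1 G2].
    assert (G : good eps mu (- x)).
    { assert (S : forall f, even_fun f -> continuous f x -> continuous f (- x)).
      { intros f Pf Cf. apply (continuous_ext (fun y => f (- y))); [apply Pf|].
        apply (cont_comp Ropp f); auto. rewrite Ropp_involutive; auto. }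
      split; apply S; auto; [apply Aeps|apply Amu]. }
    destruct (D _ G) as [D1 D2].
    replace (mu (- x)) with (mu x) in D1 by (symmetry; apply Amu).
    replace (eps (- x)) with (eps x) in D2 by (symmetry; apply Aeps).
    split.
    + eapply der_eq; [apply (der_comp Ropp); [apply Ds|eassumption]|cbv beta; ring].
    + eapply der_eq; [apply der_opp, (der_comp Ropp); [apply Ds|eassumption]|cbv beta; ring].
Qed.

Lemma nsol_refl E u w : nsol eps mu E u w -> nsol eps mu E (fun x => u (1 - x)) (fun x => - w (1 - x)).
Proof.
  intros H; assert (Q := nsol_opp E _ _ (nsol_shift E u w H)). cbv beta in Q.
  destruct Q as [U [W D]].
  assert (E1 : forall f : R -> R, forall x, f (- x + 1) = f (1 - x)) by (intros; f_equal; ring).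
  split; [|split].
  - intros x; apply (continuous_ext (fun x => u (- x + 1))); auto.
  - intros x; apply (continuous_ext (fun x => - w (- x + 1))); auto; intros; now rewrite E1.
  - intros x Gx; destruct (D x Gx) as [D1 D2]; rewrite E1 in D1, D2; split.
    + apply (is_derive_ext (fun x => u (- x + 1))); auto.
    + apply (is_derive_ext (fun x => - w (- x + 1))); auto; intros; now rewrite E1.
Qed.

Notation p := (pp eps mu).
Notation q := (qq eps mu).
Notation r := (rr eps mu).

(* Reflection about 1/2 makes the monodromy matrix conjugate to its inverse. *)
Lemma dph1 E : dph eps mu E 1 = p E.
Proof.
  destruct (nsol_repr E _ _ (nsol_refl E _ _ (th_sol E)) 1) as [T1 T2].
  destruct (nsol_repr E _ _ (nsol_refl E _ _ (ph_sol E)) 1) as [F1 F2].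
  assert (W := fund_det E 1 Rle_0_1).
  rewrite !Rminus_diag, !Rminus_0_r in *. rewrite th0 in T1; rewrite dth0 in T2; rewrite ph0 in F1; rewrite dph0 in F2.
  unfold pp. set (P := th eps mu E 1) in *. set (S := dph eps mu E 1) in *.
  (* With [Q] and [R] the off-diagonal entries, the reflected solutions give [P^2 - Q R = 1] and
     [S^2 - Q R = 1], and the determinant gives [P S - Q R = 1]. *)
  assert (Z : (P - S) * (P - S) = 0) by lra.
  apply Rmult_integral in Z; lra.
Qed.

Lemma pq_det E : p E * p E - q E * r E = 1.
Proof. assert (W := fund_det E 1 Rle_0_1). rewrite dph1 in W. unfold pp, qq, rr in *; lra. Qed.

Lemma nsol_next E u w : nsol eps mu E u w ->
  u 1 = u 0 * p E + w 0 * q E /\ w 1 = u 0 * r E + w 0 * p E.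
Proof. intros H; destruct (nsol_repr E u w H 1); rewrite dph1 in *; auto. Qed.

(** * Dependence on the energy *)

Lemma variation E E' v z x : nsol eps mu E' v z -> 0 <= x ->
  v x = v 0 * th eps mu E x + z 0 * ph eps mu E x
    + (E' - E) * (th eps mu E x * RInt (fun y => eps y * (ph eps mu E y * v y)) 0 x
                  - ph eps mu E x * RInt (fun y => eps y * (th eps mu E y * v y)) 0 x) /\
  z x = v 0 * dth eps mu E x + z 0 * dph eps mu E x
    + (E' - E) * (dth eps mu E x * RInt (fun y => eps y * (ph eps mu E y * v y)) 0 x
                  - dph eps mu E x * RInt (fun y => eps y * (th eps mu E y * v y)) 0 x).
Proof.
  intros H Hx.
  (* Two instances of Lagrange's identity are linear equations for [v x] and [z x] whose determinant
     is the Wronskian 1. The resulting formula is exact, not only of first order in [E' - E]. *)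
  assert (L1 := lagrange E E' _ _ _ _ 0 x (th_sol E) H Hx).
  assert (L2 := lagrange E E' _ _ _ _ 0 x (ph_sol E) H Hx).
  assert (W := fund_det E x Hx).
  rewrite th0, dth0 in L1; rewrite ph0, dph0 in L2.
  set (I1 := RInt (fun y => eps y * (th eps mu E y * v y)) 0 x) in *.
  set (I2 := RInt (fun y => eps y * (ph eps mu E y * v y)) 0 x) in *.
  set (a := th eps mu E x) in *. set (b := ph eps mu E x) in *.
  set (c := dth eps mu E x) in *. set (d := dph eps mu E x) in *.
  assert (K1 : (E - E') * I1 = a * z x - c * v x - z 0) by lra.
  assert (K2 : (E - E') * I2 = b * z x - d * v x + v 0) by lra.
  split.
  - replace ((E' - E) * (a * I2 - b * I1)) with (b * ((E - E') * I1) - a * ((E - E') * I2)) by ring.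
    rewrite K1, K2.
    transitivity (v x * (a * d - c * b)); [rewrite W; ring|ring].
  - replace ((E' - E) * (c * I2 - d * I1)) with (d * ((E - E') * I1) - c * ((E - E') * I2)) by ring.
    rewrite K1, K2.
    transitivity (z x * (a * d - c * b)); [rewrite W; ring|ring].
Qed.

Lemma coef01 : exists K, 0 < K /\ forall x, 0 <= x <= 1 -> eps x <= K /\ mu x <= K.
Proof.
  destruct (pwc_bounded eps 0 1 Heps) as [K1 [P1 B1]], (pwc_bounded mu 0 1 Hmu) as [K2 [P2 B2]].
  exists (K1 + K2); split; [lra|]; intros x Hx; specialize (B1 x Hx); specialize (B2 x Hx).
  apply Rabs_le_between in B1; apply Rabs_le_between in B2; lra.
Qed.

(** The derivative of [u^2 + w^2] is [2 (mu - E eps) u w], at most [c (u^2 + w^2)] with [c] uniform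
    for [|E| <= B]; Gronwall's inequality concludes. *)
Lemma energy_bound B : exists C, 0 < C /\ forall E u w x, Rabs E <= B -> nsol eps mu E u w -> 0 <= x <= 1 ->
  u x * u x + w x * w x <= (u 0 * u 0 + w 0 * w 0) * C.
Proof.
  destruct coef01 as [K [HK Kb]].
  set (c := K + Rabs B * K).
  exists (exp c); split; [apply exp_pos|]; intros E u w x HE [U [W D]] Hx.
  assert (Hc : 0 <= c) by (unfold c; assert (0 <= Rabs B * K) by (apply Rmult_le_pos; [apply Rabs_pos|lra]); lra).
  assert (G := off_gronwall _ go (fun y => u y * u y + w y * w y) c 0 x (proj1 Hx)).
  eapply Rle_trans; [apply G|].
  - intros; apply cont_plus; apply cont_mult; auto.
  - intros y Hy Gy; destruct (D y Gy) as [D1 D2]; eexists; split;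
      [apply der_plus; apply der_mult; eassumption|].
    cbv beta. destruct (Kb y) as [B1 B2]; [lra|].
    assert (Pe := Peps y). assert (Pm := Pmu y).
    assert (AB : Rabs (mu y - E * eps y) <= c).
    { unfold Rminus; eapply Rle_trans; [apply Rabs_triang|]. rewrite Rabs_Ropp, Rabs_mult, !(Rabs_right (mu y)), (Rabs_right (eps y)) by lra.
      assert (Rabs E * eps y <= Rabs B * K).
      { apply Rmult_le_compat; try lra; [apply Rabs_pos|]. generalize (Rle_abs B); lra. }
      unfold c; lra. }
    apply Rabs_le_between in AB.
    assert (S1 : 0 <= (u y - w y) * (u y - w y)) by apply Rle_0_sqr.
    assert (S2 : 0 <= (u y + w y) * (u y + w y)) by apply Rle_0_sqr.
    (* With [d = mu - E eps] and [|d| <= c], the bound comes from [(c - d)(u + w)^2 + (c + d)(u -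
       w)^2 = 2 c (u^2 + w^2) - 4 d u w]. *)
    assert (T1 : 0 <= (c - (mu y - E * eps y)) * ((u y + w y) * (u y + w y))) by (apply Rmult_le_pos; lra).
    assert (T2 : 0 <= (c + (mu y - E * eps y)) * ((u y - w y) * (u y - w y))) by (apply Rmult_le_pos; lra).
    nra.
  - cbv beta. apply Rmult_le_compat_l; [nra|].
    assert (Q : c * (x - 0) <= c * 1) by (apply Rmult_le_compat_l; lra).
    rewrite Rmult_1_r in Q; destruct Q as [Q|Q]; [left; now apply exp_increasing|rewrite Q; lra].
Qed.

Lemma fund_bound B : exists C, 1 <= C /\ forall E x, Rabs E <= B -> 0 <= x <= 1 ->
  Rabs (th eps mu E x) <= C /\ Rabs (ph eps mu E x) <= C /\ Rabs (dth eps mu E x) <= C /\ Rabs (dph eps mu E x) <= C.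
Proof.
  destruct (energy_bound B) as [C [HC H]].
  assert (Q : forall v t, v * v + t * t <= 1 * C -> Rabs v <= C + 1 /\ Rabs t <= C + 1).
  { intros v t Hv; split; apply Rabs_le; nra. }
  exists (C + 1); split; [lra|]; intros E x HE Hx.
  assert (H1 := H E _ _ x HE (th_sol E) Hx). assert (H2 := H E _ _ x HE (ph_sol E) Hx).
  rewrite th0, dth0 in H1; rewrite ph0, dph0 in H2.
  destruct (Q (th eps mu E x) (dth eps mu E x)); [lra|]. destruct (Q (ph eps mu E x) (dph eps mu E x)); [lra|].
  auto.
Qed.

Lemma RInt_bound (f : R -> R) M x : piecewise_continuous f -> 0 <= x <= 1 -> 0 <= M ->
  (forall y, 0 <= y <= 1 -> Rabs (f y) <= M) -> Rabs (RInt f 0 x) <= M.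
Proof.
  intros Hf Hx HM Hb.
  assert (Q : Rabs (RInt f 0 x) <= (x - 0) * M).
  { apply (norm_RInt_le_const f 0 x _ M); [lra|intros; apply Hb; lra|].
    apply (@RInt_correct R_CompleteNormedModule), pwc_ex_RInt; auto. }
  assert ((x - 0) * M <= 1 * M) by (apply Rmult_le_compat_r; lra). lra.
Qed.

(** The correction terms of [variation] are [E' - E] times quantities bounded uniformly on
    [[0, 1]]. *)
Lemma fund_lip B : exists C, 0 <= C /\ forall E E' x, Rabs E <= B -> Rabs E' <= B -> 0 <= x <= 1 ->
  Rabs (th eps mu E' x - th eps mu E x) <= C * Rabs (E' - E) /\
  Rabs (ph eps mu E' x - ph eps mu E x) <= C * Rabs (E' - E) /\
  Rabs (dth eps mu E' x - dth eps mu E x) <= C * Rabs (E' - E) /\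
  Rabs (dph eps mu E' x - dph eps mu E x) <= C * Rabs (E' - E).
Proof.
  destruct (fund_bound B) as [C [HC H]], coef01 as [K [HK Kb]].
  set (M := K * (C * C)).
  assert (HM : 0 <= M) by (unfold M; apply Rmult_le_pos; [lra|apply Rmult_le_pos; lra]).
  exists (2 * (C * M)); split; [assert (0 <= C * M) by (apply Rmult_le_pos; lra); lra|].
  intros E E' x HE HE' Hx.
  assert (IB : forall f g, (forall y, continuous f y) -> (forall y, continuous g y) ->
      (forall y, 0 <= y <= 1 -> Rabs (f y) <= C) -> (forall y, 0 <= y <= 1 -> Rabs (g y) <= C) ->
      Rabs (RInt (fun y => eps y * (f y * g y)) 0 x) <= M).
  { intros f g Cf Cg Bf Bg; apply RInt_bound; auto.
    - apply pwc_mult; auto; apply pwc_cont; intros; now apply cont_mult.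
    - intros y Hy; rewrite !Rabs_mult; unfold M. rewrite (Rabs_right (eps y)) by (left; apply Peps).
      apply Rmult_le_compat; [left; apply Peps|apply Rmult_le_pos; apply Rabs_pos|now apply Kb|].
      apply Rmult_le_compat; try apply Rabs_pos; auto. }
  assert (Alg : forall a b I1 I2, Rabs a <= C -> Rabs b <= C -> Rabs I1 <= M -> Rabs I2 <= M ->
     Rabs ((E' - E) * (a * I1 - b * I2)) <= 2 * (C * M) * Rabs (E' - E)).
  { intros a b I1 I2 Ha Hb H1 H2; rewrite Rabs_mult, Rmult_comm; apply Rmult_le_compat_r; [apply Rabs_pos|].
    unfold Rminus; eapply Rle_trans; [apply Rabs_triang|]; rewrite Rabs_Ropp, !Rabs_mult.
    assert (Rabs a * Rabs I1 <= C * M) by (apply Rmult_le_compat; auto; apply Rabs_pos).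
    assert (Rabs b * Rabs I2 <= C * M) by (apply Rmult_le_compat; auto; apply Rabs_pos). lra. }
  destruct (variation E E' _ _ x (th_sol E') (proj1 Hx)) as [T1 T2].
  destruct (variation E E' _ _ x (ph_sol E') (proj1 Hx)) as [F1 F2].
  rewrite th0, dth0 in T1, T2; rewrite ph0, dph0 in F1, F2.
  assert (St := th_sol E). assert (Sp := ph_sol E). assert (St' := th_sol E'). assert (Sp' := ph_sol E').
  destruct (H E x HE Hx) as [X1 [X2 [X3 X4]]].
  assert (J1 : Rabs (RInt (fun y => eps y * (ph eps mu E y * th eps mu E' y)) 0 x) <= M)
    by (apply IB; try apply Sp; try apply St'; intros; now apply H).
  assert (J2 : Rabs (RInt (fun y => eps y * (th eps mu E y * th eps mu E' y)) 0 x) <= M)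
    by (apply IB; try apply St; try apply St'; intros; now apply H).
  assert (J3 : Rabs (RInt (fun y => eps y * (ph eps mu E y * ph eps mu E' y)) 0 x) <= M)
    by (apply IB; try apply Sp; try apply Sp'; intros; now apply H).
  assert (J4 : Rabs (RInt (fun y => eps y * (th eps mu E y * ph eps mu E' y)) 0 x) <= M)
    by (apply IB; try apply St; try apply Sp'; intros; now apply H).
  split; [|split; [|split]].
  - rewrite T1. match goal with |- Rabs (?a + ?b - ?c) <= _ => replace (a + b - c) with b by ring end. now apply Alg.
  - rewrite F1. match goal with |- Rabs (?a + ?b - ?c) <= _ => replace (a + b - c) with b by ring end. now apply Alg.
  - rewrite T2. match goal with |- Rabs (?a + ?b - ?c) <= _ => replace (a + b - c) with b by ring end. now apply Alg.
  - rewrite F2. match goal with |- Rabs (?a + ?b - ?c) <= _ => replace (a + b - c) with b by ring end. now apply Alg.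
Qed.

Lemma RInt_extR (f g : R -> R) a b : (forall x, f x = g x) -> RInt f a b = RInt g a b.
Proof. intros H; apply RInt_ext; intros; apply H. Qed.

(** This form of differentiability suits [variation], which splits off [E' - E] with a cofactor
    continuous in [E']. *)
Lemma caratheodory (f g : R -> R) x : (forall y, f y - f x = (y - x) * g y) -> continuous g x ->
  is_derive f x (g x).
Proof.
  intros H Hc; apply is_derive_Reals; intros e He.
  destruct (Hc _ (locally_ball (g x) (mkposreal e He))) as [d Hd]; exists d; intros h Hh Hhd.
  assert (Hb : ball x d (x + h)) by (change (Rabs (x + h - x) < d); replace (x + h - x) with h by ring; auto).
  specialize (Hd _ Hb). change (Rabs (g (x + h) - g x) < e) in Hd.
  rewrite H. now replace ((x + h - x) * g (x + h) / h) with (g (x + h)) by (field; auto).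
Qed.

Lemma cont_lip (f : R -> R) x C : (forall y, Rabs y <= Rabs x + 1 -> Rabs (f y - f x) <= C * Rabs (y - x)) -> continuous f x.
Proof.
  intros H P [e HP].
  assert (Pc : 0 < Rabs C + 1) by (generalize (Rabs_pos C); lra).
  assert (Pd : 0 < Rmin 1 (e / (Rabs C + 1))) by (apply Rmin_pos; [lra|apply Rdiv_lt_0_compat; [apply cond_pos|auto]]).
  exists (mkposreal _ Pd); intros y Hy; change (Rabs (y - x) < Rmin 1 (e / (Rabs C + 1))) in Hy.
  generalize (Rmin_l 1 (e / (Rabs C + 1))) (Rmin_r 1 (e / (Rabs C + 1))); intros.
  apply HP; change (Rabs (f y - f x) < e).
  eapply Rle_lt_trans; [apply H|].
  - replace y with (x + (y - x)) by ring; eapply Rle_trans; [apply Rabs_triang|lra].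
  - apply Rle_lt_trans with ((Rabs C + 1) * Rabs (y - x)).
    + apply Rmult_le_compat_r; [apply Rabs_pos|generalize (Rle_abs C); lra].
    + replace (e : R) with ((Rabs C + 1) * (e / (Rabs C + 1))) by (field; lra).
      apply Rmult_lt_compat_l; lra.
Qed.

(** Entries of the Gram matrix of [th] and [ph] for the weight [eps]. *)
Definition TT E := RInt (fun y => eps y * (th eps mu E y * th eps mu E y)) 0 1.
Definition PP E := RInt (fun y => eps y * (th eps mu E y * ph eps mu E y)) 0 1.
Definition QQ E := RInt (fun y => eps y * (ph eps mu E y * ph eps mu E y)) 0 1.

Lemma RInt_eps_cont (a : R -> R) (v : R -> R -> R) E C : (forall y, continuous a y) -> (forall E y, continuous (v E) y) ->
  0 <= C ->
  (forall E' y, Rabs E' <= Rabs E + 1 -> 0 <= y <= 1 -> Rabs (v E' y - v E y) <= C * Rabs (E' - E)) ->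
  continuous (fun E' => RInt (fun y => eps y * (a y * v E' y)) 0 1) E.
Proof.
  intros Ca Cv HC Hl.
  destruct (pwc_bounded (fun y => eps y * a y) 0 1) as [K [HK Kb]]; [apply pwc_mult; auto; now apply pwc_cont|].
  assert (Pw : forall E', piecewise_continuous (fun y => eps y * (a y * v E' y))).
  { intros E'; apply pwc_mult; auto; apply pwc_cont; intros; now apply cont_mult. }
  apply (cont_lip _ E (K * C)); intros E' HE'.
  assert (Eq : RInt (fun y => eps y * (a y * v E' y)) 0 1 - RInt (fun y => eps y * (a y * v E y)) 0 1
     = RInt (fun y => eps y * (a y * v E' y) - eps y * (a y * v E y)) 0 1).
  { symmetry; apply (RInt_minus (V := R_CompleteNormedModule)); now apply pwc_ex_RInt. }
  rewrite Eq. apply RInt_bound; [|lra| |].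
  - apply (pwc_plus _ (fun y => - (eps y * (a y * v E y)))); auto.
    split; [|apply (off_finite_imp (continuous (fun y => eps y * (a y * v E y)))); [intros; now apply cont_opp|now apply pwc_off]].
    destruct (Pw E) as [Pl _]; intros x; destruct (Pl x) as [[l Hl'] [s Hs]]; split.
    + exists (- l); apply (filterlim_comp _ _ _ _ _ _ _ _ Hl' (filterlim_opp l)).
    + exists (- s); apply (filterlim_comp _ _ _ _ _ _ _ _ Hs (filterlim_opp s)).
  - apply Rmult_le_pos; [apply Rmult_le_pos; lra|apply Rabs_pos].
  - intros y Hy. replace (eps y * (a y * v E' y) - eps y * (a y * v E y)) with ((eps y * a y) * (v E' y - v E y)) by ring.
    rewrite Rabs_mult, Rmult_assoc. apply Rmult_le_compat; try apply Rabs_pos; auto.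
Qed.

Lemma fund_int_cont E : 
  continuous (fun E' => RInt (fun y => eps y * (th eps mu E y * th eps mu E' y)) 0 1) E /\
  continuous (fun E' => RInt (fun y => eps y * (ph eps mu E y * th eps mu E' y)) 0 1) E /\
  continuous (fun E' => RInt (fun y => eps y * (th eps mu E y * ph eps mu E' y)) 0 1) E /\
  continuous (fun E' => RInt (fun y => eps y * (ph eps mu E y * ph eps mu E' y)) 0 1) E.
Proof.
  destruct (fund_lip (Rabs E + 1)) as [C [HC HL]].
  assert (HE : Rabs E <= Rabs E + 1) by lra.
  destruct (th_sol E) as [Ct _], (ph_sol E) as [Cf _].
  assert (Ct' : forall E y, continuous (th eps mu E) y) by (intros E' y; destruct (th_sol E') as [Q _]; apply Q).
  assert (Cf' : forall E y, continuous (ph eps mu E) y) by (intros E' y; destruct (ph_sol E') as [Q _]; apply Q).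
  assert (Lt : forall E' y, Rabs E' <= Rabs E + 1 -> 0 <= y <= 1 -> Rabs (th eps mu E' y - th eps mu E y) <= C * Rabs (E' - E)).
  { intros E' y HE' Hy; apply HL; auto. }
  assert (Lf : forall E' y, Rabs E' <= Rabs E + 1 -> 0 <= y <= 1 -> Rabs (ph eps mu E' y - ph eps mu E y) <= C * Rabs (E' - E)).
  { intros E' y HE' Hy; apply HL; auto. }
  split; [|split; [|split]].
  - exact (RInt_eps_cont (th eps mu E) (th eps mu) E C Ct Ct' HC Lt).
  - exact (RInt_eps_cont (ph eps mu E) (th eps mu) E C Cf Ct' HC Lt).
  - exact (RInt_eps_cont (th eps mu E) (ph eps mu) E C Ct Cf' HC Lf).
  - exact (RInt_eps_cont (ph eps mu E) (ph eps mu) E C Cf Cf' HC Lf).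
Qed.

Lemma dp1 E : is_derive p E (p E * PP E - q E * TT E).
Proof.
  destruct (fund_int_cont E) as [C1 [C2 _]].
  eapply der_eq; [apply (caratheodory p (fun E' => p E * RInt (fun y => eps y * (ph eps mu E y * th eps mu E' y)) 0 1
      - q E * RInt (fun y => eps y * (th eps mu E y * th eps mu E' y)) 0 1))|].
  - intros E'; destruct (variation E E' _ _ 1 (th_sol E') Rle_0_1) as [T1 _]; rewrite th0, dth0 in T1.
    unfold pp, qq; rewrite T1; ring.
  - apply cont_minus; apply cont_mult; auto; apply cont_const.
  - cbv beta; unfold PP, TT.
    rewrite (RInt_extR (fun y => eps y * (ph eps mu E y * th eps mu E y)) (fun y => eps y * (th eps mu E y * ph eps mu E y))) by (intros; ring).
    reflexivity.
Qed.

Lemma dq E : is_derive q E (p E * QQ E - q E * PP E).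
Proof.
  destruct (fund_int_cont E) as [_ [_ [C1 C2]]].
  eapply der_eq; [apply (caratheodory q (fun E' => p E * RInt (fun y => eps y * (ph eps mu E y * ph eps mu E' y)) 0 1
      - q E * RInt (fun y => eps y * (th eps mu E y * ph eps mu E' y)) 0 1))|].
  - intros E'; destruct (variation E E' _ _ 1 (ph_sol E') Rle_0_1) as [T1 _]; rewrite ph0, dph0 in T1.
    unfold pp, qq; rewrite T1; ring.
  - apply cont_minus; apply cont_mult; auto; apply cont_const.
  - reflexivity.
Qed.

Lemma dr E : is_derive r E (r E * PP E - p E * TT E).
Proof.
  destruct (fund_int_cont E) as [C1 [C2 _]].
  eapply der_eq; [apply (caratheodory r (fun E' => r E * RInt (fun y => eps y * (ph eps mu E y * th eps mu E' y)) 0 1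
      - p E * RInt (fun y => eps y * (th eps mu E y * th eps mu E' y)) 0 1))|].
  - intros E'; destruct (variation E E' _ _ 1 (th_sol E') Rle_0_1) as [_ T1]; rewrite th0, dth0, dph1 in T1.
    unfold rr; rewrite T1; ring.
  - apply cont_minus; apply cont_mult; auto; apply cont_const.
  - cbv beta; unfold PP, TT.
    rewrite (RInt_extR (fun y => eps y * (ph eps mu E y * th eps mu E y)) (fun y => eps y * (th eps mu E y * ph eps mu E y))) by (intros; ring).
    reflexivity.
Qed.

(** [p] is the value at 1 of both [th] and [dph], and the two resulting derivatives contain [PP]
    with opposite signs. Their mean displays the sign of [p'] wherever [q r < 0]. *)
Lemma dp E : is_derive p E ((r E * QQ E - q E * TT E) / 2).
Proof.
  destruct (fund_int_cont E) as [_ [_ [C1 C2]]].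
  assert (D2 : is_derive p E (r E * QQ E - p E * PP E)).
  { eapply der_eq; [apply (caratheodory p (fun E' => r E * RInt (fun y => eps y * (ph eps mu E y * ph eps mu E' y)) 0 1
      - p E * RInt (fun y => eps y * (th eps mu E y * ph eps mu E' y)) 0 1))|].
    - intros E'; destruct (variation E E' _ _ 1 (ph_sol E') Rle_0_1) as [_ T1]; rewrite ph0, dph0, !dph1 in T1.
      unfold rr; rewrite T1; ring.
    - apply cont_minus; apply cont_mult; auto; apply cont_const.
    - reflexivity. }
  assert (U1 := is_derive_unique _ _ _ (dp1 E)). assert (U2 := is_derive_unique _ _ _ D2).
  apply (der_eq _ _ _ _ D2). rewrite <- U2 at 1. lra.
Qed.

Lemma cont_q E : continuous q E. Proof. eapply cont_derive, dq. Qed.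
Lemma cont_r E : continuous r E. Proof. eapply cont_derive, dr. Qed.

(** At a point of [good] inside the interval [u' = mu w] is zero, hence so is [w]; uniqueness does
    the rest. *)
Lemma nsol_zero_open E u w a b : nsol eps mu E u w -> a < b -> (forall x, a < x < b -> u x = 0) ->
  forall x, u x = 0 /\ w x = 0.
Proof.
  intros H Hab Hz.
  destruct (off_exists _ go a b Hab) as [c [Hc Gc]].
  assert (Uc := Hz c Hc).
  apply (nsol_zero eps mu Heps Hmu E u w c H Uc).
  destruct H as [_ [_ D]]; destruct (D c Gc) as [D1 _].
  assert (D0 : is_derive u c 0).
  { apply (is_derive_ext_loc (fun _ => 0)); [|apply der_const].
    assert (P : 0 < Rmin (c - a) (b - c)) by (apply Rmin_pos; lra).
    exists (mkposreal _ P); intros y Hy.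
    change (Rabs (y - c) < Rmin (c - a) (b - c)) in Hy.
    apply Rabs_lt_between in Hy.
    generalize (Rmin_l (c - a) (b - c)) (Rmin_r (c - a) (b - c)); intros.
    symmetry; apply Hz; lra. }
  apply is_derive_unique in D1; apply is_derive_unique in D0.
  assert (Z : mu c * w c = 0) by lra.
  apply Rmult_integral in Z; generalize (Pmu c); lra.
Qed.

(** Were the integral not positive, its nondecreasing primitive would be constant and [u] would
    vanish wherever [k] is continuous. The weight is left free: [eps] serves for the quadratic
    forms, the constant 1 for square integrability. *)
Lemma weighted_pos E u w (k : R -> R) : piecewise_continuous k -> (forall x, 0 < k x) -> nsol eps mu E u w ->
  (u 0 <> 0 \/ w 0 <> 0) -> 0 < RInt (fun y => k y * (u y * u y)) 0 1.
Proof.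
  intros Hk Pk H Hn.
  assert (Cu : forall y, continuous u y) by apply H.
  assert (Pw : piecewise_continuous (fun y => k y * (u y * u y))).
  { apply pwc_mult; auto; apply pwc_cont; intros; now apply cont_mult. }
  assert (M : forall a b, a <= b -> RInt (fun y => k y * (u y * u y)) 0 a <= RInt (fun y => k y * (u y * u y)) 0 b).
  { intros a b Hab; apply (off_mono _ (pwc_off _ Hk) (fun x => RInt (fun y => k y * (u y * u y)) 0 x)); auto.
    - intros; now apply prim_cont.
    - intros x _ Kx; exists (k x * (u x * u x)); split.
      + apply (prim_derive (fun y => k y * (u y * u y)) 0 x Pw); apply cont_mult; auto; apply cont_mult; auto.
      + apply Rmult_le_pos; [left; auto|apply Rle_0_sqr]. }
  assert (Z0 : RInt (fun y => k y * (u y * u y)) 0 0 = 0) by apply (RInt_point (V := R_CompleteNormedModule)).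
  destruct (Rlt_dec 0 (RInt (fun y => k y * (u y * u y)) 0 1)) as [|N]; auto; exfalso.
  assert (Zu : forall x, 0 < x < 1 -> u x = 0).
  { apply (off_zero _ (pwc_off _ Hk) u 0 1 Cu); intros x Hx Kx.
    assert (D : is_derive (fun x => RInt (fun y => k y * (u y * u y)) 0 x) x (k x * (u x * u x))).
    { apply (prim_derive (fun y => k y * (u y * u y)) 0 x Pw); apply cont_mult; auto; apply cont_mult; auto. }
    assert (D0 : is_derive (fun x => RInt (fun y => k y * (u y * u y)) 0 x) x 0).
    { apply (is_derive_ext_loc (fun _ => 0)); [|apply der_const].
      assert (P : 0 < Rmin x (1 - x)) by (apply Rmin_pos; lra).
      exists (mkposreal _ P); intros y Hy.
      change (Rabs (y - x) < Rmin x (1 - x)) in Hy.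
      apply Rabs_lt_between in Hy.
      generalize (Rmin_l x (1 - x)) (Rmin_r x (1 - x)); intros.
      assert (M1 := M 0 y ltac:(lra)). assert (M2 := M y 1 ltac:(lra)). lra. }
    apply is_derive_unique in D; apply is_derive_unique in D0.
    assert (Z : k x * (u x * u x) = 0) by lra.
    apply Rmult_integral in Z; destruct Z as [Z|Z]; [generalize (Pk x); lra|].
    apply Rmult_integral in Z; lra. }
  destruct (nsol_zero_open E u w 0 1 H Rlt_0_1 Zu 0) as [Z1 Z2]. tauto.
Qed.

(** The form is the weighted square norm of [x th + y ph], whose Cauchy data at the origin are
    [(x, y)]. *)
Lemma form_pos E x y : x <> 0 \/ y <> 0 -> 0 < x * x * TT E + 2 * x * y * PP E + y * y * QQ E.
Proof.
  intros Hxy.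
  assert (H := nsol_lin eps mu E _ _ _ _ x y (th_sol E) (ph_sol E)).
  assert (W := weighted_pos E _ _ eps Heps Peps H). cbv beta in W.
  rewrite th0, dth0, ph0, dph0 in W.
  assert (Z : 0 < RInt (fun t => eps t * ((x * th eps mu E t + y * ph eps mu E t) * (x * th eps mu E t + y * ph eps mu E t))) 0 1).
  { apply W; destruct Hxy; [left|right]; lra. }
  assert (Cp : forall f g : R -> R, (forall t, continuous f t) -> (forall t, continuous g t) ->
     ex_RInt (fun t => eps t * (f t * g t)) 0 1).
  { intros f g Cf Cg; apply pwc_ex_RInt, pwc_mult; auto; apply pwc_cont; intros; now apply cont_mult. }
  destruct (th_sol E) as [Ct _], (ph_sol E) as [Cf _].
  unfold TT, PP, QQ.
  rewrite <- (RInt_scal (V := R_CompleteNormedModule) _ 0 1 (x * x)) by auto.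
  rewrite <- (RInt_scal (V := R_CompleteNormedModule) _ 0 1 (2 * x * y)) by auto.
  rewrite <- (RInt_scal (V := R_CompleteNormedModule) _ 0 1 (y * y)) by auto.
  assert (S : forall c f g, (forall t, continuous f t) -> (forall t, continuous g t) ->
     ex_RInt (fun t => c * (eps t * (f t * g t))) 0 1).
  { intros c f g C1 C2; apply pwc_ex_RInt, pwc_scal, pwc_mult; auto; apply pwc_cont; intros; now apply cont_mult. }
  assert (A1 : RInt (fun t => x * x * (eps t * (th eps mu E t * th eps mu E t)) + 2 * x * y * (eps t * (th eps mu E t * ph eps mu E t))) 0 1 =
     RInt (fun t => x * x * (eps t * (th eps mu E t * th eps mu E t))) 0 1 + RInt (fun t => 2 * x * y * (eps t * (th eps mu E t * ph eps mu E t))) 0 1)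
   by (apply (RInt_plus (V := R_CompleteNormedModule)); auto).
  assert (A2 : RInt (fun t => (x * x * (eps t * (th eps mu E t * th eps mu E t)) + 2 * x * y * (eps t * (th eps mu E t * ph eps mu E t))) + y * y * (eps t * (ph eps mu E t * ph eps mu E t))) 0 1 =
     RInt (fun t => x * x * (eps t * (th eps mu E t * th eps mu E t)) + 2 * x * y * (eps t * (th eps mu E t * ph eps mu E t))) 0 1 + RInt (fun t => y * y * (eps t * (ph eps mu E t * ph eps mu E t))) 0 1).
  { apply (RInt_plus (V := R_CompleteNormedModule)); auto. apply (ex_RInt_plus (V := R_CompleteNormedModule)); auto. }
  change (0 < RInt (fun t => x * x * (eps t * (th eps mu E t * th eps mu E t))) 0 1 + RInt (fun t => 2 * x * y * (eps t * (th eps mu E t * ph eps mu E t))) 0 1 + RInt (fun t => y * y * (eps t * (ph eps mu E t * ph eps mu E t))) 0 1).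
  rewrite <- A1, <- A2. eapply Rlt_le_trans; [exact Z|].
  apply Req_le, RInt_extR; intros t; ring.
Qed.

Lemma TT_pos E : 0 < TT E.
Proof. assert (F := form_pos E 1 0 ltac:(left; lra)). lra. Qed.
Lemma QQ_pos E : 0 < QQ E.
Proof. assert (F := form_pos E 0 1 ltac:(right; lra)). lra. Qed.

(** For [E < 0] both terms of [(u w)' = mu w^2 - E eps u^2] are nonnegative. *)
Lemma low_energy E u w : E < 0 -> nsol eps mu E u w -> u 0 * w 0 = 0 -> (u 0 <> 0 \/ w 0 <> 0) -> 0 < u 1 * w 1.
Proof.
  intros HE H H0 Hn. assert (W := weighted_pos E u w eps Heps Peps H Hn).
  destruct H as [U [V D]].
  assert (Pk : piecewise_continuous (fun y => eps y * (u y * u y))).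
  { apply pwc_mult; auto; apply pwc_cont; intros; now apply cont_mult. }
  assert (M : u 0 * w 0 - - E * RInt (fun y => eps y * (u y * u y)) 0 0 <= u 1 * w 1 - - E * RInt (fun y => eps y * (u y * u y)) 0 1).
  { apply (off_mono _ go (fun x => u x * w x - - E * RInt (fun y => eps y * (u y * u y)) 0 x)); [lra| |].
    - intros; apply cont_minus; apply cont_mult; auto; [apply cont_const|now apply prim_cont].
    - intros x _ Gx; destruct (D x Gx) as [D1 D2]; eexists; split.
      + apply der_minus; [apply der_mult; eassumption|apply der_scal, (prim_derive (fun y => eps y * (u y * u y)) 0 x Pk)].
        apply cont_mult; [apply Gx|apply cont_mult; auto].
      + cbv beta. assert (0 <= mu x * (w x * w x)) by (apply Rmult_le_pos; [left; apply Pmu|apply Rle_0_sqr]). lra. }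
  rewrite H0 in M.
  assert (Z : RInt (fun y => eps y * (u y * u y)) 0 0 = 0) by apply (RInt_point (V := R_CompleteNormedModule)).
  rewrite Z in M. assert (0 < - E * RInt (fun y => eps y * (u y * u y)) 0 1) by (apply Rmult_lt_0_compat; lra). lra.
Qed.

(** For the two fundamental solutions, [low_energy] reads [p r > 0] and [p q > 0], hence [q r > 0]:
    negative energies lie below the spectrum. *)
Lemma neg_energy E : E < 0 -> 1 < p E * p E.
Proof.
  intros HE.
  assert (H1 := low_energy E _ _ HE (th_sol E)). assert (H2 := low_energy E _ _ HE (ph_sol E)).
  rewrite th0, dth0 in H1; rewrite ph0, dph0, dph1 in H2.
  specialize (H1 ltac:(lra) ltac:(left; lra)). specialize (H2 ltac:(lra) ltac:(right; lra)).
  fold (p E) (r E) in H1. fold (q E) in H2. change (th eps mu E 1) with (p E) in *. change (dth eps mu E 1) with (r E) in *. change (ph eps mu E 1) with (q E) in *.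
  assert (W := pq_det E).
  assert (0 < (p E * r E) * (q E * p E)) by (apply Rmult_lt_0_compat; auto).
  assert (Z : 0 < (p E * p E) * (q E * r E)) by lra.
  assert (0 <= p E * p E) by apply Rle_0_sqr.
  assert (0 < q E * r E) by nra. lra.
Qed.

(** At energy 0 the quasi-derivatives are constant, so on [[0, 1]] [th] is 1 and [ph] is the
    primitive of [mu]. This makes 0 the bottom edge of the first band. *)
Lemma zero_energy : p 0 = 1 /\ r 0 = 0 /\ 0 < q 0.
Proof.
  assert (St := th_sol 0). assert (Sp := ph_sol 0).
  assert (Ct : forall x, 0 <= x -> dth eps mu 0 x = 0).
  { intros x Hx. transitivity (dth eps mu 0 0); [|apply dth0]. apply (off_const _ go (dth eps mu 0)); auto; [apply St|].
    intros y _ Gy; destruct St as [_ [_ D]]; destruct (D y Gy) as [_ D2]; apply (der_eq _ _ _ _ D2); ring. }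
  assert (Cp : forall x, 0 <= x -> dph eps mu 0 x = 1).
  { intros x Hx. transitivity (dph eps mu 0 0); [|apply dph0]. apply (off_const _ go (dph eps mu 0)); auto; [apply Sp|].
    intros y _ Gy; destruct Sp as [_ [_ D]]; destruct (D y Gy) as [_ D2]; apply (der_eq _ _ _ _ D2); ring. }
  split; [|split].
  - unfold pp; transitivity (th eps mu 0 0); [|apply th0]. apply (off_const _ go (th eps mu 0)); [lra|apply St|].
    intros y Hy Gy; destruct St as [_ [_ D]]; destruct (D y Gy) as [D1 _]; apply (der_eq _ _ _ _ D1); rewrite Ct by lra; ring.
  - apply Ct; lra.
  - unfold qq; apply Rle_lt_trans with (ph eps mu 0 0); [rewrite ph0; lra|]. apply (off_strict _ go (ph eps mu 0)); [lra|apply Sp|].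
    intros y Hy Gy; destruct Sp as [_ [_ D]]; destruct (D y Gy) as [D1 _]; eexists; split; [exact D1|].
    rewrite Cp by lra. rewrite Rmult_1_r; apply Pmu.
Qed.
End Op.

(** * Oscillation *)

Lemma Rabs_sin_le x : Rabs (sin x) <= Rabs x.
Proof.
  assert (P : forall y, 0 <= y -> Rabs (sin y) <= y).
  { intros y Hy. replace (sin y) with (sin y - sin 0) by (rewrite sin_0; ring).
    replace y with (1 * (y - 0)) at 2 by ring.
    apply (off_bound (fun _ => True)); auto.
    - intros a b; exists nil; auto.
    - intros z; eapply cont_derive, is_derive_sin.
    - intros z _ _; exists (cos z); split; [apply is_derive_sin|].
      apply Rabs_le; generalize (COS_bound z); lra. }
  destruct (Rle_dec 0 x).
  - rewrite (Rabs_right x) by lra; now apply P.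
  - rewrite <- Rabs_Ropp, <- sin_neg, (Rabs_left x) by lra. apply P; lra.
Qed.

Opaque th dth ph dph.

Section Angle.
Variables eps mu : R -> R.
Hypothesis Aeps : admissible_coef eps.
Hypothesis Amu : admissible_coef mu.

Let Heps : piecewise_continuous eps := proj1 (proj2 Aeps).
Let Hmu : piecewise_continuous mu := proj1 (proj2 Amu).
Let Peps : forall x, 0 < eps x := proj1 Aeps.
Let Pmu : forall x, 0 < mu x := proj1 Amu.
Let go := good_off eps mu Heps Hmu.

(* Prüfer angle of the rescaled pair (k th, dth) at energy k^2: rescaling makes its speed at least k * min(mu, eps). *)
Definition rho k x := k * th eps mu (k * k) x * (k * th eps mu (k * k) x) + dth eps mu (k * k) x * dth eps mu (k * k) x.
Definition speed k x := mu x * (k * (dth eps mu (k * k) x * dth eps mu (k * k) x) / rho k x)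
  + eps x * (k * (k * th eps mu (k * k) x * (k * th eps mu (k * k) x)) / rho k x).
(** Integrating the speed fixes a continuous branch without an inverse tangent. The initial pair
    [(k, 0)] has angle [PI / 2] because [k th] goes with the sine. *)
Definition angle k x := PI / 2 + RInt (speed k) 0 x.

Lemma rho_pos k x : 0 < k -> 0 < rho k x.
Proof.
  intros Hk; unfold rho.
  set (a := k * th eps mu (k * k) x). set (b := dth eps mu (k * k) x).
  assert (H1 : 0 <= a * a) by apply Rle_0_sqr. assert (H2 : 0 <= b * b) by apply Rle_0_sqr.
  destruct (Req_dec (a * a + b * b) 0) as [Z|Z]; [exfalso|lra].
  assert (Za : a * a = 0) by lra. assert (Zb : b * b = 0) by lra.
  apply Rmult_integral in Za; apply Rmult_integral in Zb.
  assert (Ya : a = 0) by tauto. assert (Yb : b = 0) by tauto.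
  unfold a in Ya; apply Rmult_integral in Ya; destruct Ya as [Ya|Ya]; [lra|].
  destruct (nsol_zero eps mu Heps Hmu (k * k) _ _ x (th_sol eps mu Aeps Amu (k * k)) Ya Yb 0) as [T _].
  rewrite (th0 eps mu Aeps Amu) in T; lra.
Qed.

Lemma th_cont E x : continuous (th eps mu E) x.
Proof. destruct (th_sol eps mu Aeps Amu E) as [H _]; apply H. Qed.
Lemma dth_cont E x : continuous (dth eps mu E) x.
Proof. destruct (th_sol eps mu Aeps Amu E) as [_ [H _]]; apply H. Qed.

Lemma rho_cont k x : continuous (rho k) x.
Proof.
  assert (CU : continuous (fun x => k * th eps mu (k * k) x) x) by (apply cont_mult; [apply cont_const|apply th_cont]).
  apply cont_plus; apply cont_mult; solve [exact CU | exact (dth_cont _ _)].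
Qed.

Lemma weights_cont k x : 0 < k ->
  continuous (fun x => k * (dth eps mu (k * k) x * dth eps mu (k * k) x) / rho k x) x /\
  continuous (fun x => k * (k * th eps mu (k * k) x * (k * th eps mu (k * k) x)) / rho k x) x.
Proof.
  intros Hk; assert (Hr := rho_pos k x Hk).
  assert (CU : continuous (fun x => k * th eps mu (k * k) x) x) by (apply cont_mult; [apply cont_const|apply th_cont]).
  split; (apply cont_div; [apply cont_mult; [apply cont_const|]|apply rho_cont|lra]).
  - apply cont_mult; exact (dth_cont _ _).
  - exact (cont_mult _ _ _ CU CU).
Qed.

Lemma speed_pwc k : 0 < k -> piecewise_continuous (speed k).
Proof.
  intros Hk; apply pwc_plus; (apply pwc_mult; [assumption|apply pwc_cont; intros x]);
    destruct (weights_cont k x Hk) as [W1 W2]; assumption.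
Qed.

Lemma speed_good k x : 0 < k -> good eps mu x -> continuous (speed k) x.
Proof.
  intros Hk [G1 G2]; destruct (weights_cont k x Hk) as [W1 W2].
  apply cont_plus; apply cont_mult; assumption.
Qed.

Lemma angle_cont k x : 0 < k -> continuous (angle k) x.
Proof. intros Hk; apply cont_plus; [apply cont_const|apply prim_cont; now apply speed_pwc]. Qed.

Lemma angle_der k x : 0 < k -> good eps mu x -> is_derive (angle k) x (speed k x).
Proof.
  intros Hk Gx; eapply der_eq; [apply der_plus; [apply der_const|apply prim_derive]|ring].
  - now apply speed_pwc.
  - now apply speed_good.
Qed.

Lemma angle0 k : angle k 0 = PI / 2.
Proof.
  unfold angle; rewrite (RInt_point (V := R_CompleteNormedModule)).
  change (@zero R_CompleteNormedModule) with 0; ring.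
Qed.

(** With [X = U cos - w sin], the quotient [X^2 / rho] is the squared sine of the difference between
    the polar angle of [(U, w)] and [angle]. Both turn at the same speed and they agree at 0. *)
Lemma angle_spec k x : 0 < k -> 0 <= x ->
  k * th eps mu (k * k) x * cos (angle k x) = dth eps mu (k * k) x * sin (angle k x).
Proof.
  intros Hk Hx.
  set (U := fun x => k * th eps mu (k * k) x). set (w := dth eps mu (k * k)).
  set (X := fun x => U x * cos (angle k x) - w x * sin (angle k x)).
  assert (CU : forall y, continuous U y) by (intros; apply cont_mult; [apply cont_const|apply th_cont]).
  assert (Cw : forall y, continuous w y) by (intros; apply dth_cont).
  assert (CX : forall y, continuous X y).
  { intros y; apply cont_minus; apply cont_mult; auto.
    - apply (cont_comp (angle k) cos); [now apply angle_cont|]. eapply cont_derive, is_derive_cos.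
    - apply (cont_comp (angle k) sin); [now apply angle_cont|]. eapply cont_derive, is_derive_sin. }
  assert (Q : X x * X x / rho k x = X 0 * X 0 / rho k 0).
  { apply (off_const _ go (fun y => X y * X y / rho k y)); auto.
    - intros y; apply cont_div; [now apply cont_mult|apply rho_cont|generalize (rho_pos k y Hk); lra].
    - intros y _ Gy.
      destruct (th_sol eps mu Aeps Amu (k * k)) as [_ [_ D]]; destruct (D y Gy) as [D1 D2].
      assert (DU : is_derive U y (k * (mu y * w y))) by (apply der_scal; exact D1).
      assert (Dw : is_derive w y (- k * eps y * U y)).
      { apply (der_eq _ _ _ _ D2); unfold U; ring. }
      assert (Da := angle_der k y Hk Gy).
      assert (DX : is_derive X y (k * (mu y * w y) * cos (angle k y) + U y * (speed k y * - sin (angle k y))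
           - (- k * eps y * U y * sin (angle k y) + w y * (speed k y * cos (angle k y))))).
      { apply (der_minus (fun x => U x * cos (angle k x)) (fun x => w x * sin (angle k x))).
        - apply (der_mult U (fun x => cos (angle k x)) y _ _ DU).
          apply (der_comp (angle k) cos _ _ _ Da), is_derive_cos.
        - apply (der_mult w (fun x => sin (angle k x)) y _ _ Dw).
          apply (der_comp (angle k) sin _ _ _ Da), is_derive_sin. }
      assert (Dr : is_derive (rho k) y (k * (mu y * w y) * U y + U y * (k * (mu y * w y)) + (- k * eps y * U y * w y + w y * (- k * eps y * U y)))).
      { apply der_plus; apply der_mult; auto. }
      assert (Pr := rho_pos k y Hk).
      eapply der_eq; [apply der_div; [apply der_mult; exact DX|exact Dr|lra]|].
      unfold X, speed. assert (Er : rho k y = U y * U y + w y * w y) by reflexivity.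
      change (k * th eps mu (k * k) y) with (U y). change (dth eps mu (k * k) y) with (w y).
      rewrite Er in *. cbv beta. generalize (U y) (w y) (cos (angle k y)) (sin (angle k y)) (mu y) (eps y) Pr.
      intros a b c s m e Pr'. field. lra. }
  assert (X0 : X 0 = 0).
  { unfold X; rewrite angle0, cos_PI2, sin_PI2; unfold w; rewrite (dth0 eps mu Aeps Amu); ring. }
  rewrite X0 in Q. assert (Pr := rho_pos k x Hk).
  assert (Z : X x * X x = 0).
  { replace (X x * X x) with (X x * X x / rho k x * rho k x) by (field; lra). rewrite Q. unfold Rdiv; ring. }
  apply Rmult_integral in Z. change (U x * cos (angle k x) = w x * sin (angle k x)); unfold X in Z; destruct Z; lra.
Qed.

(** The speed becomes a function of the angle and the coefficients alone, so [angle] solves a scalar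
    equation to which Gronwall's inequality applies. *)
Lemma speed_spec k x : 0 < k -> 0 <= x ->
  speed k x = k * (mu x * (cos (angle k x) * cos (angle k x)) + eps x * (sin (angle k x) * sin (angle k x))).
Proof.
  intros Hk Hx; assert (A := angle_spec k x Hk Hx). assert (Pr := rho_pos k x Hk).
  assert (SC := sin2_cos2 (angle k x)). unfold Rsqr in SC.
  unfold speed. assert (Er : rho k x = k * th eps mu (k * k) x * (k * th eps mu (k * k) x) + dth eps mu (k * k) x * dth eps mu (k * k) x) by reflexivity.
  set (U := k * th eps mu (k * k) x) in *. set (w := dth eps mu (k * k) x) in *.
  set (c := cos (angle k x)) in *. set (s := sin (angle k x)) in *.
  assert (E1 : w * w = rho k x * (c * c)).
  { rewrite Er. transitivity (w * w * (s * s + c * c)); [rewrite SC; ring|].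
    transitivity ((w * s) * (w * s) + w * w * (c * c)); [ring|]. rewrite <- A; ring. }
  assert (E2 : U * U = rho k x * (s * s)).
  { rewrite Er. transitivity (U * U * (s * s + c * c)); [rewrite SC; ring|].
    transitivity ((U * c) * (U * c) + U * U * (s * s)); [ring|]. rewrite A; ring. }
  rewrite E1, E2; field; lra.
Qed.

(** Supplies the continuity in [k] for an intermediate value argument. *)
Lemma angle_lip : exists K, 0 < K /\ forall k k', 0 < k -> 0 < k' ->
  Rabs (angle k' 1 - angle k 1) <= K * exp (1 + 2 * k * K) * Rabs (k' - k).
Proof.
  destruct (coef01 eps mu Aeps Amu) as [K [HK Kb]]; exists K; split; auto; intros k k' Hk Hk'.
  (* [eta] absorbs the inhomogeneity: [2 |dl| K |k' - k| <= dl^2 + eta], so [dl^2 + eta] obeys a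
     homogeneous Gronwall inequality with rate [c]. *)
  set (eta := K * K * ((k' - k) * (k' - k))). set (c := 1 + 2 * k * K).
  assert (Heta : 0 <= eta) by (apply Rmult_le_pos; [apply Rle_0_sqr|apply Rle_0_sqr]).
  assert (Hc : 1 <= c) by (unfold c; assert (0 <= k * K) by (apply Rmult_le_pos; lra); lra).
  set (dl := fun x => angle k' x - angle k x).
  assert (Cd : forall x, continuous dl x) by (intros; apply cont_minus; now apply angle_cont).
  assert (G := off_gronwall _ go (fun x => dl x * dl x + eta) c 0 1 Rle_0_1).
  assert (Z : dl 1 * dl 1 + eta <= (dl 0 * dl 0 + eta) * exp (c * (1 - 0))).
  { apply G.
    - intros; apply cont_plus; [now apply cont_mult|apply cont_const].
    - intros x Hx Gx; eexists; split.
      + apply der_plus; [apply der_mult; apply der_minus; now apply angle_der|apply der_const].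
      + cbv beta. rewrite !speed_spec by (auto; lra).
        change (angle k' x - angle k x) with (dl x).
        destruct (Kb x) as [B1 B2]; [lra|]. assert (Pe := Peps x). assert (Pm := Pmu x).
        set (a' := angle k' x). set (a := angle k x).
        set (h := fun b => mu x * (cos b * cos b) + eps x * (sin b * sin b)).
        change (mu x * (cos a' * cos a') + eps x * (sin a' * sin a')) with (h a').
        change (mu x * (cos a * cos a) + eps x * (sin a * sin a)) with (h a).
        assert (Hh : forall b, 0 <= h b <= K).
        { intros b; unfold h; assert (S := sin2_cos2 b); unfold Rsqr in S.
          assert (0 <= cos b * cos b) by apply Rle_0_sqr. assert (0 <= sin b * sin b) by apply Rle_0_sqr.
          split; [apply Rplus_le_le_0_compat; apply Rmult_le_pos; lra|].
          assert (mu x * (cos b * cos b) <= K * (cos b * cos b)) by (apply Rmult_le_compat_r; lra).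
          assert (eps x * (sin b * sin b) <= K * (sin b * sin b)) by (apply Rmult_le_compat_r; lra).
          replace K with (K * (sin b * sin b + cos b * cos b)) by (rewrite S; ring). lra. }
        assert (Hl : Rabs (h a' - h a) <= K * Rabs (dl x)).
        (* Uses [sin^2 a' - sin^2 a = sin (a' - a) sin (a' + a)]. *)
        { assert (E1 : h a' - h a = (eps x - mu x) * (sin (a' - a) * sin (a' + a))).
          { unfold h. rewrite sin_minus, sin_plus.
            assert (S := sin2_cos2 a); assert (S' := sin2_cos2 a'); unfold Rsqr in S, S'.
            replace (cos a' * cos a') with (1 - sin a' * sin a') by lra.
            replace (cos a * cos a) with (1 - sin a * sin a) by lra.
            replace ((sin a' * cos a - cos a' * sin a) * (sin a' * cos a + cos a' * sin a))
              with (sin a' * sin a' * (cos a * cos a) - cos a' * cos a' * (sin a * sin a)) by ring.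
            replace (cos a' * cos a') with (1 - sin a' * sin a') by lra.
            replace (cos a * cos a) with (1 - sin a * sin a) by lra. ring. }
          rewrite E1, !Rabs_mult.
          apply Rmult_le_compat; [apply Rabs_pos|apply Rmult_le_pos; apply Rabs_pos|apply Rabs_le; lra|].
          rewrite <- (Rmult_1_r (Rabs (dl x))).
          apply Rmult_le_compat; try apply Rabs_pos; [apply Rabs_sin_le|apply Rabs_le; generalize (SIN_bound (a' + a)); lra]. }
        assert (Hd : (k' * h a' - k * h a) = (k' - k) * h a' + k * (h a' - h a)) by ring.
        assert (T1 : dl x * ((k' - k) * h a') <= Rabs (dl x) * (Rabs (k' - k) * K)).
        { eapply Rle_trans; [apply Rle_abs|]. rewrite !Rabs_mult. apply Rmult_le_compat_l; [apply Rabs_pos|].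
          apply Rmult_le_compat_l; [apply Rabs_pos|]. rewrite Rabs_right by (apply Rle_ge, Hh); apply Hh. }
        assert (T2 : dl x * (k * (h a' - h a)) <= k * K * (dl x * dl x)).
        { eapply Rle_trans; [apply Rle_abs|]. rewrite !Rabs_mult, (Rabs_right k) by lra.
          replace (k * K * (dl x * dl x)) with (Rabs (dl x) * (k * (K * Rabs (dl x)))).
          - apply Rmult_le_compat_l; [apply Rabs_pos|]. apply Rmult_le_compat_l; [lra|auto].
          - transitivity (k * K * (Rabs (dl x) * Rabs (dl x))); [ring|]. rewrite <- Rabs_mult, Rabs_right; [ring|].
            apply Rle_ge, Rle_0_sqr. }
        assert (Sq : 2 * (Rabs (dl x) * (Rabs (k' - k) * K)) <= dl x * dl x + eta).
        { assert (Y : 0 <= (Rabs (dl x) - Rabs (k' - k) * K) * (Rabs (dl x) - Rabs (k' - k) * K)) by apply Rle_0_sqr.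
          assert (V1 : Rabs (dl x) * Rabs (dl x) = dl x * dl x) by (rewrite <- Rabs_mult; apply Rabs_right, Rle_ge, Rle_0_sqr).
          assert (V2 : Rabs (k' - k) * Rabs (k' - k) = (k' - k) * (k' - k)) by (rewrite <- Rabs_mult; apply Rabs_right, Rle_ge, Rle_0_sqr).
          unfold eta. rewrite <- V1, <- V2. lra. }
        assert (Nn : 0 <= dl x * dl x) by apply Rle_0_sqr.
        assert (Ce : eta + (2 * k * K) * (dl x * dl x) <= c * eta + 2 * k * K * (dl x * dl x)).
        { assert (1 * eta <= c * eta) by (apply Rmult_le_compat_r; lra). lra. }
        unfold c in *. assert (T3 : dl x * (k' * h a' - k * h a) <= Rabs (dl x) * (Rabs (k' - k) * K) + k * K * (dl x * dl x)).
        { rewrite Hd, Rmult_plus_distr_l. lra. }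
        assert (0 <= 2 * k * K * eta) by (apply Rmult_le_pos; [apply Rmult_le_pos; lra|lra]).
        lra. }
  assert (d0 : dl 0 = 0) by (unfold dl; rewrite !angle0; ring).
  rewrite d0, Rminus_0_r, Rmult_1_r, Rmult_0_r, Rplus_0_l in Z.
  change (Rabs (dl 1) <= K * exp c * Rabs (k' - k)).
  assert (He : 1 <= exp c) by (assert (Q := exp_ineq1_le c); lra).
  apply Rsqr_incr_0_var.
  - unfold Rsqr. rewrite <- Rabs_mult, (Rabs_right (dl 1 * dl 1)) by apply Rle_ge, Rle_0_sqr.
    replace (K * exp c * Rabs (k' - k) * (K * exp c * Rabs (k' - k))) with
      (K * K * (Rabs (k' - k) * Rabs (k' - k)) * exp c * exp c) by ring.
    rewrite <- Rabs_mult, (Rabs_right ((k' - k) * (k' - k))) by apply Rle_ge, Rle_0_sqr.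
    change (dl 1 * dl 1 <= eta * exp c * exp c).
    assert (0 <= eta * exp c) by (apply Rmult_le_pos; lra).
    assert (eta * exp c * 1 <= eta * exp c * exp c) by (apply Rmult_le_compat_l; lra). lra.
  - apply Rmult_le_pos; [apply Rmult_le_pos; lra|apply Rabs_pos].
Qed.

(** Both [mu] and [eps] are at least [mu eps / K], so the speed is at least [k mu eps / K]. The
    product serves as lower bound because the coefficients may tend to 0 at a jump. *)
Lemma angle_grows : exists c, 0 < c /\ forall k, 0 < k -> PI / 2 + k * c <= angle k 1.
Proof.
  destruct (coef01 eps mu Aeps Amu) as [K [HK Kb]].
  assert (Pme : piecewise_continuous (fun x => mu x * eps x)) by now apply pwc_mult.
  set (F := fun x => RInt (fun x => mu x * eps x) 0 x).
  assert (F0 : F 0 = 0) by apply (RInt_point (V := R_CompleteNormedModule)).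
  assert (CF : forall x, continuous F x) by (intros; now apply prim_cont).
  assert (DF : forall x, good eps mu x -> is_derive F x (mu x * eps x)).
  { intros x [G1 G2]; apply (prim_derive (fun x => mu x * eps x) 0 x Pme); now apply cont_mult. }
  assert (F1 : F 0 < F 1).
  { apply (off_strict _ go F); auto; [lra|]. intros x _ Gx; eexists; split; [now apply DF|apply Rmult_lt_0_compat; auto]. }
  exists (F 1 / K); split; [apply Rdiv_lt_0_compat; lra|]; intros k Hk.
  assert (M : angle k 0 - k / K * F 0 <= angle k 1 - k / K * F 1).
  { apply (off_mono _ go (fun x => angle k x - k / K * F x)); [lra| |].
    - intros; apply cont_minus; [now apply angle_cont|apply cont_mult; auto; apply cont_const].
    - intros x Hx Gx; eexists; split; [apply der_minus; [now apply angle_der|apply der_scal, DF; auto]|].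
      cbv beta. rewrite speed_spec by (auto; lra).
      destruct (Kb x) as [B1 B2]; [lra|]. assert (Pe := Peps x). assert (Pm := Pmu x).
      assert (S := sin2_cos2 (angle k x)); unfold Rsqr in S.
      set (s2 := sin (angle k x) * sin (angle k x)) in *. set (c2 := cos (angle k x) * cos (angle k x)) in *.
      assert (0 <= c2) by apply Rle_0_sqr. assert (0 <= s2) by apply Rle_0_sqr.
      assert (E1 : mu x * eps x / K <= mu x).
      { apply Rle_div_l; auto. apply Rmult_le_compat_l; lra. }
      assert (E2 : mu x * eps x / K <= eps x).
      { apply Rle_div_l; auto. rewrite Rmult_comm. apply Rmult_le_compat_l; lra. }
      replace (k * (mu x * c2 + eps x * s2) - k / K * (mu x * eps x)) with
        (k * ((mu x - mu x * eps x / K) * c2 + (eps x - mu x * eps x / K) * s2 + (mu x * eps x / K) * (s2 + c2 - 1))) by (field; lra).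
      rewrite S. apply Rmult_le_pos; [lra|].
      assert (0 <= (mu x - mu x * eps x / K) * c2) by (apply Rmult_le_pos; lra).
      assert (0 <= (eps x - mu x * eps x / K) * s2) by (apply Rmult_le_pos; lra). lra. }
  rewrite angle0, F0 in M. replace (k * (F 1 / K)) with (k / K * F 1) by (field; lra). lra.
Qed.

(** [angle k 1] is continuous and unbounded in [k], so it takes values [PI / 2 + n PI] at
    arbitrarily high energies; there the cosine vanishes, and with it [dth] at 1. *)
Lemma rr_zeros E0 : exists E, E0 < E /\ rr eps mu E = 0.
Proof.
  destruct angle_lip as [K [HK HL]], angle_grows as [c [Hc Hg]].
  set (k0 := Rabs E0 + 1).
  assert (Hk0 : 1 <= k0) by (unfold k0; generalize (Rabs_pos E0); lra).
  (* [Rmax k0 k] keeps the argument positive, so that [f] is continuous on the whole line, as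
     [IVT_gen] requires. *)
  set (f := fun k => angle (Rmax k0 k) 1).
  assert (Pk : forall k, 0 < Rmax k0 k) by (intros k; generalize (Rmax_l k0 k); lra).
  assert (Cf : continuity f).
  { intros k; apply continuity_pt_filterlim.
    apply (cont_lip f k (K * exp (1 + 2 * Rmax k0 k * K))); intros y _.
    eapply Rle_trans; [apply HL; auto|]. apply Rmult_le_compat_l.
    - apply Rmult_le_pos; [lra|left; apply exp_pos].
    - unfold Rmax; destruct (Rle_dec k0 y), (Rle_dec k0 k); unfold Rabs;
      repeat destruct Rcase_abs; lra. }
  destruct (nfloor_ex (Rabs (f k0)) (Rabs_pos _)) as [n [_ Hn]].
  assert (PI3 : 1 < PI) by (generalize PI2_1; lra).
  set (y := PI / 2 + INR (S n) * PI).
  assert (Hy : f k0 <= y).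
  { unfold y. rewrite S_INR. assert (Q := Rle_abs (f k0)). assert (Pn := pos_INR n).
    assert (1 * (INR n + 1) <= PI * (INR n + 1)) by (apply Rmult_le_compat_r; lra). lra. }
  (* By [angle_grows] the angle at [k1] has reached the target [y]. *)
  set (k1 := k0 + INR (S n) * PI / c).
  assert (Hp : 0 <= INR (S n) * PI) by (apply Rmult_le_pos; [apply pos_INR|lra]).
  assert (Hk1 : k0 <= k1).
  { unfold k1; assert (0 <= INR (S n) * PI / c) by (apply Rmult_le_pos; [auto|left; now apply Rinv_0_lt_compat]). lra. }
  assert (Hy1 : y <= f k1).
  { unfold f; rewrite Rmax_right by auto. eapply Rle_trans; [|apply Hg; lra].
    unfold y, k1. replace ((k0 + INR (S n) * PI / c) * c) with (k0 * c + INR (S n) * PI) by (field; lra).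
    assert (0 <= k0 * c) by (apply Rmult_le_pos; lra). lra. }
  destruct (IVT_gen f k0 k1 y Cf) as [k [_ Hk]].
  { rewrite Rmin_left, Rmax_right by lra; lra. }
  set (kk := Rmax k0 k).
  assert (Hkk : k0 <= kk) by apply Rmax_l.
  exists (kk * kk); split.
  - assert (k0 * k0 <= kk * kk) by (apply Rmult_le_compat; lra).
    assert (1 * k0 <= k0 * k0) by (apply Rmult_le_compat_r; lra).
    generalize (Rle_abs E0); unfold k0 in *; lra.
  - assert (A := angle_spec kk 1 (Pk k) Rle_0_1).
    change (angle kk 1) with (f k) in A. rewrite Hk in A.
    assert (Cz : forall m, cos (PI / 2 + INR m * PI) = 0).
    { induction m as [|m IH]; [simpl; rewrite Rmult_0_l, Rplus_0_r; apply cos_PI2|].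
      rewrite S_INR. replace (PI / 2 + (INR m + 1) * PI) with (PI / 2 + INR m * PI + PI) by ring.
      rewrite neg_cos, IH; ring. }
    assert (S := sin2_cos2 y). unfold y in *. rewrite Cz in A, S.
    unfold Rsqr in S. set (s := sin (PI / 2 + INR (Datatypes.S n) * PI)) in *.
    unfold rr. assert (Z : dth eps mu (kk * kk) 1 * s = 0) by lra.
    apply Rmult_integral in Z; destruct Z as [Z|Z]; auto. rewrite Z in S; lra.
Qed.
End Angle.

(** * Bands *)

Lemma der_sign_pos (f : R -> R) (x d : R) : is_derive f x d -> f x = 0 -> 0 < d ->
  exists e, 0 < e /\ (forall y, x < y < x + e -> 0 < f y) /\ (forall y, x - e < y < x -> f y < 0).
Proof.
  intros D Z Hd. apply is_derive_Reals in D. destruct (D d Hd) as [e He].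
  exists e; split; [apply cond_pos|].
  assert (K : forall y, y <> x -> Rabs (y - x) < e -> 0 < f y / (y - x)).
  { intros y Ny Hy. assert (Q := He (y - x) ltac:(lra) Hy).
    replace (x + (y - x)) with y in Q by ring. rewrite Z, Rminus_0_r in Q.
    apply Rabs_lt_between in Q; lra. }
  split; intros y Hy.
  - assert (Q := K y ltac:(lra) ltac:(rewrite Rabs_right; lra)).
    replace (f y) with (f y / (y - x) * (y - x)) by (field; lra). apply Rmult_lt_0_compat; lra.
  - assert (Q := K y ltac:(lra) ltac:(rewrite Rabs_left; lra)).
    replace (f y) with (- (f y / (y - x) * (x - y))) by (field; lra).
    assert (0 < f y / (y - x) * (x - y)) by (apply Rmult_lt_0_compat; lra). lra.
Qed.

Lemma der_sign_neg (f : R -> R) (x d : R) : is_derive f x d -> f x = 0 -> d < 0 ->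
  exists e, 0 < e /\ (forall y, x < y < x + e -> f y < 0) /\ (forall y, x - e < y < x -> 0 < f y).
Proof.
  intros D Z Hd.
  destruct (der_sign_pos (fun y => - f y) x (- d)) as [e [He [H1 H2]]]; [now apply der_opp|lra|lra|].
  exists e; split; auto; split; intros y Hy; [specialize (H1 y Hy)|specialize (H2 y Hy)]; lra.
Qed.

(** The supremum of the zero-free right neighbourhoods of [a]; the hypothesis on [e] keeps zeros
    from accumulating at [a]. *)
Lemma first_zero (g : R -> R) a b e : (forall x, continuous g x) -> 0 < e ->
  (forall x, a < x < a + e -> g x <> 0) -> a < b -> g b = 0 ->
  exists c, a < c /\ g c = 0 /\ forall x, a < x < c -> g x <> 0.
Proof.
  intros Cg He Ha Hb Zb.
  destruct (completeness (fun x => forall y, a < y < x -> g y <> 0)) as [c [Ub Lub]].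
  { exists b; intros x Hx; destruct (Rle_dec x b); auto; exfalso; apply (Hx b); auto; lra. }
  { exists a; intros; lra. }
  assert (Hc : a + e <= c) by (apply Ub; auto).
  assert (Nz : forall x, a < x < c -> g x <> 0).
  { intros x Hx Zx. assert (c <= x); [|lra]. apply Lub; intros y Hy.
    destruct (Rle_dec y x); auto; exfalso; apply (Hy x); auto; lra. }
  exists c; split; [lra|split; auto].
  destruct (Req_dec (g c) 0) as [|N]; auto; exfalso.
  assert (P : 0 < Rabs (g c)) by now apply Rabs_pos_lt.
  destruct (Cg c _ (locally_ball (g c) (mkposreal _ P))) as [d Hd].
  assert (Pd := cond_pos d).
  assert (c + d / 2 <= c); [|lra].
  apply Ub; intros y Hy; destruct (Rlt_dec y c); [apply Nz; lra|].
  intros Zy. assert (B : ball c d y) by (change (Rabs (y - c) < d); rewrite Rabs_right; lra).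
  specialize (Hd y B). change (Rabs (g y - g c) < Rabs (g c)) in Hd.
  rewrite Zy, Rminus_0_l, Rabs_Ropp in Hd; lra.
Qed.

Lemma const_sign (g : R -> R) a b x y : (forall x, continuous g x) ->
  (forall z, a < z < b -> g z <> 0) -> a < x < b -> a < y < b -> 0 < g x -> 0 < g y.
Proof.
  intros Cg Nz Hx Hy Px.
  destruct (Rlt_dec 0 (g y)) as [|N]; auto; exfalso.
  destruct (IVT_gen g x y 0) as [z [Hz Zz]].
  - intros z; apply continuity_pt_filterlim, Cg.
  - split.
    + apply Rle_trans with (g y); [apply Rmin_r|lra].
    + apply Rle_trans with (g x); [lra|apply Rmax_l].
  - apply (Nz z); auto. revert Hz; unfold Rmin, Rmax; destruct (Rle_dec x y); lra.
Qed.

(** Each step records a by-product [h] besides the next state: lower edges will be the states, upper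
    edges the by-products. *)
Lemma dependent_choice2 (St : R -> Prop) (Rel : R -> R -> R -> Prop) s0 : St s0 ->
  (forall s, St s -> exists h s', St s' /\ Rel s h s') ->
  exists lo hi : nat -> R, lo 0%nat = s0 /\ forall n, Rel (lo n) (hi n) (lo (S n)).
Proof.
  intros H0 Hs.
  assert (H : forall s : sig St, exists hs : R * sig St, Rel (proj1_sig s) (fst hs) (proj1_sig (snd hs))).
  { intros [s Ss]; destruct (Hs s Ss) as [h [s' [Ss' Rl]]]; now exists (h, exist _ s' Ss'). }
  set (nx := fun s => proj1_sig (constructive_indefinite_description _ (H s))).
  assert (Hn : forall s, Rel (proj1_sig s) (fst (nx s)) (proj1_sig (snd (nx s)))).
  { intros s; unfold nx; apply (proj2_sig (constructive_indefinite_description _ (H s))). }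
  set (lo := fix lo n := match n with O => exist _ s0 H0 | S m => snd (nx (lo m)) end).
  exists (fun n => proj1_sig (lo n)), (fun n => fst (nx (lo n))); split; [reflexivity|].
  intros n; apply (Hn (lo n)).
Qed.

(* [[lo, hi]] is a band and [lo'] starts the next one; [hi = lo'] is a closed gap (double eigenvalue). *)
Record band_rel (p q r : R -> R) (lo hi lo' : R) : Prop := {
  br_lt : lo < hi;
  br_le : hi <= lo';
  br_in : forall x, lo < x < hi -> p x * p x < 1;
  br_lo : p lo * p lo = 1;
  br_hi : p hi = - p lo;
  br_lo' : p lo' = p hi;
  br_gap : forall x, hi < x < lo' -> 1 < p x * p x;
  br_touch : hi = lo' -> q hi = 0 /\ r hi = 0;
  br_open : hi < lo' -> ~ (q hi = 0 /\ r hi = 0) /\ ~ (q lo' = 0 /\ r lo' = 0) }.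

Section Bands.
Variables p q r P Q T : R -> R.
Hypothesis det : forall E, p E * p E - q E * r E = 1.
Hypothesis Dp : forall E, is_derive p E ((r E * Q E - q E * T E) / 2).
Hypothesis Dq : forall E, is_derive q E (p E * Q E - q E * P E).
Hypothesis Dr : forall E, is_derive r E (r E * P E - p E * T E).
Hypothesis Tpos : forall E, 0 < T E.
Hypothesis Qpos : forall E, 0 < Q E.
Hypothesis edges_unbounded : forall E0, exists E, E0 < E /\ p E * p E = 1.
Hypothesis below : forall E, E < 0 -> 1 < p E * p E.
Hypothesis bottom : p 0 = 1 /\ r 0 = 0 /\ 0 < q 0.

Let Cp : forall x, continuous p x.
Proof. intros; eapply cont_derive, Dp. Qed.
Let Cg : forall x, continuous (fun x => p x * p x - 1) x.
Proof. intros; apply cont_minus; [now apply cont_mult|apply cont_const]. Qed.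

Lemma Rmult_neg_split a b : a * b < 0 -> (a < 0 /\ 0 < b) \/ (0 < a /\ b < 0).
Proof.
  intros H. destruct (Rtotal_order a 0) as [A|[A|A]]; [left|subst; lra|right]; split; auto; nra.
Qed.

(** At such a point [q' = p Q] and [r' = - p T] have opposite signs, so [q r < 0], that is
    [p^2 < 1], on both sides: the gap is closed. *)
Lemma edge_touch E : p E * p E = 1 -> q E = 0 -> r E = 0 ->
  exists e, 0 < e /\ forall x, x <> E -> Rabs (x - E) < e -> p x * p x < 1.
Proof.
  intros H Zq Zr.
  assert (Aux : exists e, 0 < e /\ forall x, x <> E -> Rabs (x - E) < e -> q x * r x < 0).
  { assert (D1 := Dq E). assert (D2 := Dr E). rewrite Zq, Rmult_0_l, Rminus_0_r in D1. rewrite Zr, Rmult_0_l, Rminus_0_l in D2.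
    assert (HT := Tpos E). assert (HQ := Qpos E).
    assert (Hp : p E = 1 \/ p E = -1).
    { assert (Z : (p E - 1) * (p E + 1) = 0) by lra. apply Rmult_integral in Z; destruct Z; lra. }
    destruct Hp as [Hp|Hp]; rewrite Hp in D1, D2.
    - destruct (der_sign_pos q E _ D1 Zq ltac:(lra)) as [e1 [P1 [A1 B1]]].
      destruct (der_sign_neg r E _ D2 Zr ltac:(lra)) as [e2 [P2 [A2 B2]]].
      exists (Rmin e1 e2); split; [now apply Rmin_pos|]; intros x Nx Hx.
      generalize (Rmin_l e1 e2) (Rmin_r e1 e2); intros; apply Rabs_lt_between in Hx.
      destruct (Rlt_dec E x).
      + assert (K1 := A1 x ltac:(lra)). assert (K2 := A2 x ltac:(lra)). nra.
      + assert (K1 := B1 x ltac:(lra)). assert (K2 := B2 x ltac:(lra)). nra.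
    - destruct (der_sign_neg q E _ D1 Zq ltac:(lra)) as [e1 [P1 [A1 B1]]].
      destruct (der_sign_pos r E _ D2 Zr ltac:(lra)) as [e2 [P2 [A2 B2]]].
      exists (Rmin e1 e2); split; [now apply Rmin_pos|]; intros x Nx Hx.
      generalize (Rmin_l e1 e2) (Rmin_r e1 e2); intros; apply Rabs_lt_between in Hx.
      destruct (Rlt_dec E x).
      + assert (K1 := A1 x ltac:(lra)). assert (K2 := A2 x ltac:(lra)). nra.
      + assert (K1 := B1 x ltac:(lra)). assert (K2 := B2 x ltac:(lra)). nra. }
  destruct Aux as [e [He A]]; exists e; split; auto; intros x Nx Hx.
  specialize (A x Nx Hx). specialize (det x). lra.
Qed.

(** Exactly one of [q] and [r] vanishes, so the derivative [p (r Q - q T)] of [p^2] is not zero. *)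
Lemma edge_cross E : p E * p E = 1 -> ~ (q E = 0 /\ r E = 0) ->
  exists e, 0 < e /\
   (((forall x, E < x < E + e -> 1 < p x * p x) /\ (forall x, E - e < x < E -> p x * p x < 1)) \/
    ((forall x, E < x < E + e -> p x * p x < 1) /\ (forall x, E - e < x < E -> 1 < p x * p x))).
Proof.
  intros H Hn.
  assert (D : is_derive (fun x => p x * p x - 1) E (p E * (r E * Q E - q E * T E))).
  { eapply der_eq; [apply der_minus; [apply der_mult; apply Dp|apply der_const]|cbv beta; field]. }
  assert (HT := Tpos E). assert (HQ := Qpos E). assert (dt := det E).
  assert (Zqr : q E * r E = 0) by lra.
  assert (Nz : p E * (r E * Q E - q E * T E) <> 0).
  { intros Z. apply Rmult_integral in Z; destruct Z as [Z|Z]; [rewrite Z in H; lra|].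
    apply Rmult_integral in Zqr; destruct Zqr as [Z'|Z']; rewrite Z' in Z; apply Hn; split; auto.
    - assert (Y : r E * Q E = 0) by lra. apply Rmult_integral in Y; destruct Y; lra.
    - assert (Y : q E * T E = 0) by lra. apply Rmult_integral in Y; destruct Y; lra. }
  destruct (Rtotal_order (p E * (r E * Q E - q E * T E)) 0) as [L|[L|L]]; [|tauto|].
  - destruct (der_sign_neg _ E _ D ltac:(lra) L) as [e [He [A B]]]; exists e; split; auto; right.
    split; intros x Hx; [specialize (A x Hx)|specialize (B x Hx)]; lra.
  - destruct (der_sign_pos _ E _ D ltac:(lra) L) as [e [He [A B]]]; exists e; split; auto; left.
    split; intros x Hx; [specialize (A x Hx)|specialize (B x Hx)]; lra.
Qed.

(** Otherwise [r Q = q T] at an interior point by the mean value theorem, which is impossible since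
    [q r < 0] there. *)
Lemma band_inj a b : a < b -> (forall x, a < x < b -> p x * p x < 1) -> p a <> p b.
Proof.
  intros Hab Hin Heq.
  destruct (MVT_cor2 p (fun E => (r E * Q E - q E * T E) / 2) a b Hab) as [c [Hc1 Hc2]].
  { intros c _; apply is_derive_Reals, Dp. }
  rewrite Heq, Rminus_diag in Hc1. symmetry in Hc1; apply Rmult_integral in Hc1; destruct Hc1 as [Z|Z]; [|lra].
  assert (H := Hin c Hc2). assert (dt := det c). assert (HT := Tpos c). assert (HQ := Qpos c).
  destruct (Rmult_neg_split (q c) (r c) ltac:(lra)) as [[A B]|[A B]].
  - assert (0 < r c * Q c) by now apply Rmult_lt_0_compat.
    assert (0 < - q c * T c) by (apply Rmult_lt_0_compat; lra). lra.
  - assert (0 < - r c * Q c) by (apply Rmult_lt_0_compat; lra).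
    assert (0 < q c * T c) by now apply Rmult_lt_0_compat. lra.
Qed.

(** The state of the recursion: a band opens immediately to the right. *)
Definition band_start (E : R) : Prop :=
  p E * p E = 1 /\ exists e, 0 < e /\ forall x, E < x < E + e -> p x * p x < 1.

(** [hi] is the first return to [p^2 = 1]. Either [q = r = 0] there and the next band starts at
    once, or [p^2] crosses 1 and [lo'] is the next return. *)
Lemma band_step lo : band_start lo -> exists hi lo', band_start lo' /\ band_rel p q r lo hi lo'.
Proof.
  intros [Hlo [e [He Hin]]].
  destruct (edges_unbounded lo) as [b [Hb Zb]].
  destruct (first_zero (fun x => p x * p x - 1) lo b e Cg He) as [hi [Hhi [Zhi Nhi]]]; auto; [|lra|].
  { intros x Hx; specialize (Hin x Hx); lra. }
  assert (In : forall x, lo < x < hi -> p x * p x < 1).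
  { intros x Hx.
    set (y := lo + Rmin e (hi - lo) / 2).
    assert (0 < Rmin e (hi - lo)) by (apply Rmin_pos; lra).
    generalize (Rmin_l e (hi - lo)) (Rmin_r e (hi - lo)); intros.
    assert (Hy : 0 < - (p y * p y - 1)) by (assert (Z := Hin y ltac:(unfold y; lra)); lra).
    assert (K := const_sign (fun x => - (p x * p x - 1)) lo hi y x (fun z => cont_opp _ _ (Cg z))).
    specialize (K ltac:(intros z Hz; specialize (Nhi z Hz); lra) ltac:(unfold y; lra) Hx Hy). lra. }
  assert (Phi : p hi = - p lo).
  { assert (N := band_inj lo hi Hhi In).
    assert (Z : (p hi - p lo) * (p hi + p lo) = 0) by lra.
    apply Rmult_integral in Z; destruct Z; lra. }
  destruct (classic (q hi = 0 /\ r hi = 0)) as [[Zq Zr]|Nt].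
  - exists hi, hi; split.
    + split; [lra|]. destruct (edge_touch hi ltac:(lra) Zq Zr) as [d [Hd A]].
      exists d; split; auto; intros x Hx; apply A; [lra|rewrite Rabs_right; lra].
    + constructor; auto; try lra; intros; lra.
  - destruct (edge_cross hi ltac:(lra) Nt) as [d [Hd [[A B]|[A B]]]].
    2:{ exfalso. set (y := hi - Rmin d (hi - lo) / 2).
        assert (0 < Rmin d (hi - lo)) by (apply Rmin_pos; lra).
        generalize (Rmin_l d (hi - lo)) (Rmin_r d (hi - lo)); intros.
        assert (K1 := B y ltac:(unfold y; lra)). assert (K2 := In y ltac:(unfold y; lra)). lra. }
    destruct (edges_unbounded hi) as [b' [Hb' Zb']].
    destruct (first_zero (fun x => p x * p x - 1) hi b' d Cg Hd) as [lo' [Hlo' [Zlo' Nlo']]]; auto; [|lra|].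
    { intros x Hx; specialize (A x Hx); lra. }
    set (y0 := hi + Rmin d (lo' - hi) / 2).
    assert (Hy0 : hi < y0 < lo' /\ 1 < p y0 * p y0).
    { assert (0 < Rmin d (lo' - hi)) by (apply Rmin_pos; lra).
      generalize (Rmin_l d (lo' - hi)) (Rmin_r d (lo' - hi)); intros.
      split; [unfold y0; lra|apply A; unfold y0; lra]. }
    destruct Hy0 as [Hy0 Py0].
    assert (Gap : forall x, hi < x < lo' -> 1 < p x * p x).
    { intros x Hx.
      assert (K := const_sign (fun x => p x * p x - 1) hi lo' y0 x Cg Nlo' Hy0 Hx ltac:(lra)). lra. }
    (* A sign change of [p] across the gap would produce a zero, where [p^2 > 1] fails. *)
    assert (Plo' : p lo' = p hi).
    { destruct (Req_dec (p lo') (p hi)) as [|N]; auto; exfalso.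
      assert (Z : (p lo' - p hi) * (p lo' + p hi) = 0) by lra.
      apply Rmult_integral in Z; destruct Z as [Z|Z]; [lra|].
      assert (Hp : p hi = 1 \/ p hi = -1).
      { assert (Y : (p hi - 1) * (p hi + 1) = 0) by lra. apply Rmult_integral in Y; destruct Y; lra. }
      destruct (IVT_gen p hi lo' 0) as [z [Hz Zz]].
      - intros z; apply continuity_pt_filterlim, Cp.
      - unfold Rmin, Rmax; destruct (Rle_dec (p hi) (p lo')); destruct Hp; lra.
      - rewrite Rmin_left, Rmax_right in Hz by lra.
        destruct (Req_dec z hi) as [->|]; [rewrite Zz in *; lra|].
        destruct (Req_dec z lo') as [->|]; [rewrite Zz in *; lra|].
        assert (K := Gap z ltac:(lra)). rewrite Zz in K; lra. }
    assert (NB : forall e, 0 < e -> (forall x, lo' - e < x < lo' -> p x * p x < 1) -> False).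
    { intros e' He' B'. set (y := lo' - Rmin e' (lo' - hi) / 2).
      assert (0 < Rmin e' (lo' - hi)) by (apply Rmin_pos; lra).
      generalize (Rmin_l e' (lo' - hi)) (Rmin_r e' (lo' - hi)); intros.
      assert (K1 := B' y ltac:(unfold y; lra)). assert (K2 := Gap y ltac:(unfold y; lra)). lra. }
    assert (Nt' : ~ (q lo' = 0 /\ r lo' = 0)).
    { intros [Zq Zr]. destruct (edge_touch lo' ltac:(lra) Zq Zr) as [e' [He' A']].
      apply (NB e' He'); intros x Hx; apply A'; [lra|rewrite Rabs_left; lra]. }
    exists hi, lo'; split.
    + split; [lra|]. destruct (edge_cross lo' ltac:(lra) Nt') as [e' [He' [[A' B']|[A' B']]]].
      * exfalso; now apply (NB e' He').
      * now exists e'.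
    + constructor; auto; try lra; intros; lra.
Qed.

Definition band_edges (lo hi : nat -> R) : Prop :=
  lo 0%nat = 0 /\ forall n, band_rel p q r (lo n) (hi n) (lo (S n)).

(** A band opens at 0 because the derivative of [p^2 - 1] there is [- q T < 0]. *)
Lemma bands_exist : exists lo hi, band_edges lo hi.
Proof.
  destruct bottom as [B1 [B2 B3]].
  apply (dependent_choice2 band_start (band_rel p q r) 0); [|intros; now apply band_step].
  split; [rewrite B1; ring|].
  assert (D : is_derive (fun x => p x * p x - 1) 0 (- (q 0 * T 0))).
  { eapply der_eq; [apply der_minus; [apply der_mult; apply Dp|apply der_const]|cbv beta].
    rewrite B1, B2; field. }
  assert (0 < q 0 * T 0) by now apply Rmult_lt_0_compat.
  destruct (der_sign_neg _ 0 _ D ltac:(cbv beta; rewrite B1; ring) ltac:(lra)) as [e [He [A _]]].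
  exists e; split; auto; intros x Hx; specialize (A x Hx); lra.
Qed.

Section Edges.
Variables lo hi : nat -> R.
Hypothesis HB : band_edges lo hi.
Let rel n := proj2 HB n.

Lemma lo_lt n m : (n < m)%nat -> lo n < lo m.
Proof.
  intros H; induction H.
  - generalize (br_lt _ _ _ _ _ _ (rel n)) (br_le _ _ _ _ _ _ (rel n)); lra.
  - generalize (br_lt _ _ _ _ _ _ (rel m)) (br_le _ _ _ _ _ _ (rel m)); lra.
Qed.

Lemma lo_le n m : (n <= m)%nat -> lo n <= lo m.
Proof. intros H; apply Nat.lt_eq_cases in H; destruct H as [H|H]; [left; now apply lo_lt|subst; lra]. Qed.

(* The edges carry alternating values of p, so they cannot accumulate. *)
Lemma lo_unbounded E : exists n, E < lo n.
Proof.
  destruct (classic (exists n, E < lo n)) as [|N]; auto; exfalso.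
  destruct (completeness (fun x => exists n, x = lo n)) as [L [Ub Lub]].
  { exists E; intros x [n ->]; destruct (Rle_dec (lo n) E); auto; exfalso; apply N; exists n; lra. }
  { exists (lo 0%nat); now exists 0%nat. }
  destruct (Cp L _ (locally_ball (p L) (mkposreal (1 / 2) ltac:(lra)))) as [d Hd].
  assert (Pd := cond_pos d).
  assert (Hn : exists n, L - d < lo n).
  { destruct (classic (exists n, L - d < lo n)) as [|N']; auto; exfalso.
    assert (L <= L - d); [|lra]. apply Lub; intros x [n ->].
    destruct (Rle_dec (lo n) (L - d)); auto; exfalso; apply N'; exists n; lra. }
  destruct Hn as [n Hn].
  assert (K : forall m, (n <= m)%nat -> Rabs (p (lo m) - p L) < 1 / 2).
  { intros m Hm; apply (Hd (lo m)). change (Rabs (lo m - L) < d).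
    assert (lo m <= L) by (apply Ub; now exists m). assert (lo n <= lo m) by now apply lo_le.
    apply Rabs_lt_between; lra. }
  assert (K1 := K n (le_n n)). assert (K2 := K (S n) ltac:(lia)).
  rewrite (br_lo' _ _ _ _ _ _ (rel n)), (br_hi _ _ _ _ _ _ (rel n)) in K2.
  apply Rabs_lt_between in K1; apply Rabs_lt_between in K2.
  assert (Z := br_lo _ _ _ _ _ _ (rel n)).
  assert (Y : (p (lo n) - 1) * (p (lo n) + 1) = 0) by lra. apply Rmult_integral in Y; destruct Y; lra.
Qed.

(** The bound [E < lo (S n)] settles the ambiguity at a closed gap in favour of the upper band. *)
Lemma band_locate E : p E * p E <= 1 -> exists n, lo n <= E <= hi n /\ E < lo (S n).
Proof.
  intros H.
  assert (H0 : 0 <= E) by (destruct (Rle_dec 0 E); auto; specialize (below E ltac:(lra)); lra).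
  destruct (lo_unbounded E) as [N HN].
  assert (Hn : exists n, lo n <= E < lo (S n)).
  { induction N as [|N IH]; [rewrite (proj1 HB) in HN; lra|].
    destruct (Rlt_dec E (lo N)); auto. exists N; lra. }
  destruct Hn as [n Hn]; exists n; split; [|lra]; split; [lra|].
  destruct (Rle_dec E (hi n)); auto.
  assert (K := br_gap _ _ _ _ _ _ (rel n) E ltac:(lra)). lra.
Qed.

Lemma band_solve n t : t * t <= 1 -> exists E, lo n <= E <= hi n /\ p E = t.
Proof.
  intros Ht. assert (R1 := rel n).
  assert (Z := br_lo _ _ _ _ _ _ R1). assert (L := br_lt _ _ _ _ _ _ R1). assert (Hh := br_hi _ _ _ _ _ _ R1).
  assert (Y : (p (lo n) - 1) * (p (lo n) + 1) = 0) by lra.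
  destruct (IVT_gen p (lo n) (hi n) t) as [E [HE pE]].
  - intros z; apply continuity_pt_filterlim, Cp.
  - rewrite Hh. assert (-1 <= t <= 1) by nra.
    unfold Rmin, Rmax; destruct (Rle_dec _ _); apply Rmult_integral in Y; destruct Y; lra.
  - exists E; split; auto. rewrite Rmin_left, Rmax_right in HE by lra; auto.
Qed.

Lemma band_unique n E E' : lo n <= E <= hi n -> lo n <= E' <= hi n -> p E = p E' -> E = E'.
Proof.
  intros H H' Heq. assert (R1 := br_in _ _ _ _ _ _ (rel n)).
  destruct (Rtotal_order E E') as [L|[L|L]]; auto; exfalso.
  - apply (band_inj E E' L); auto; intros; apply R1; lra.
  - apply (band_inj E' E L); auto; intros; apply R1; lra.
Qed.

Section Enumeration.
Variables (t : R) (lam : nat -> R).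
Hypothesis Ht : t * t <= 1.
Hypothesis Hlam : forall n, lo n <= lam n <= hi n /\ p (lam n) = t.

Lemma lam_nondecreasing n : lam n <= lam (S n).
Proof.
  destruct (Hlam n) as [H1 _], (Hlam (S n)) as [H2 _].
  assert (L := br_le _ _ _ _ _ _ (rel n)). lra.
Qed.

Lemma lam_hits E n : p E = t -> lo n <= E <= hi n -> lam n = E.
Proof. intros pE HE; destruct (Hlam n) as [H1 H2]; apply (band_unique n); auto; lra. Qed.

Lemma lam_other E n j : lo n <= E -> E < lo (S n) -> lam j = E -> j = n \/ (S j = n /\ E = hi j /\ E = lo n).
Proof.
  intros H1 H2 Hj. destruct (Hlam j) as [H3 _].
  destruct (Nat.lt_total j n) as [L|[L|L]]; auto.
  - right. assert (A := lo_le (S j) n L). assert (B := br_le _ _ _ _ _ _ (rel j)).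
    assert (E = hi j /\ E = lo n) as [E1 E2] by lra.
    split; auto. destruct (Nat.lt_total (S j) n) as [L'|[L'|L']]; auto; [|lia].
    assert (C := lo_lt _ _ L'). lra.
  - exfalso. assert (A := lo_le (S n) j L). lra.
Qed.

Lemma lam_none E : p E <> t -> forall j, lam j <> E.
Proof. intros H j Hj; apply H; rewrite <- Hj; apply Hlam. Qed.

(** With [lam_twice] and [lam_none], this matches the number of occurrences of [E] to the dimension
    of its eigenspace. *)
Lemma lam_once E : p E = t -> ~ (q E = 0 /\ r E = 0) -> exists m, forall j, lam j = E <-> j = m.
Proof.
  intros pE Nt. destruct (band_locate E ltac:(rewrite pE; auto)) as [n [H1 H2]].
  exists n; intros j; split; [|intros ->; now apply lam_hits].
  intros Hj; destruct (lam_other E n j (proj1 H1) H2 Hj) as [|[A [B C]]]; auto.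
  exfalso; apply Nt; rewrite B. apply (br_touch _ _ _ _ _ _ (rel j)). rewrite A; lra.
Qed.

Lemma lam_twice E : p E = t -> q E = 0 -> r E = 0 -> exists m, forall j, lam j = E <-> (j = m \/ j = S m).
Proof.
  intros pE Zq Zr. destruct (band_locate E ltac:(rewrite pE; auto)) as [n [H1 H2]].
  assert (dt := det E). rewrite Zq in dt.
  (* Here [p^2 = 1], so [E] is an edge. At an upper edge the gap would be open because
     [E < lo (S n)], and edges of open gaps are simple. *)
  assert (En : E = lo n).
  { destruct (Req_dec E (lo n)) as [|N1]; auto; exfalso.
    destruct (Req_dec E (hi n)) as [E2|N2].
    - apply (proj1 (br_open _ _ _ _ _ _ (rel n) ltac:(lra))); rewrite <- E2; auto.
    - assert (K := br_in _ _ _ _ _ _ (rel n) E ltac:(lra)). lra. }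
  destruct n as [|m].
  (* The lowest edge is simple because [q 0 > 0]. *)
  { exfalso. rewrite (proj1 HB) in En; subst E; destruct bottom as [_ [_ B]]; lra. }
  assert (Hm : E = hi m).
  { assert (L := br_le _ _ _ _ _ _ (rel m)). destruct (Rle_lt_or_eq_dec _ _ L) as [L'|L']; [|lra].
    exfalso; apply (proj2 (br_open _ _ _ _ _ _ (rel m) L')); rewrite <- En; auto. }
  exists m; intros j; split.
  - intros Hj; destruct (lam_other E (S m) j (proj1 H1) H2 Hj) as [|[A _]]; [auto|left; lia].
  - intros [->| ->]; apply lam_hits; auto. assert (L := br_lt _ _ _ _ _ _ (rel m)). lra.
Qed.
End Enumeration.
End Edges.
End Bands.

(** * Floquet eigenspaces *)

(** The modulus of the remainder dominates both of its coordinates. *)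
Lemma derC_parts (f : R -> C) (x : R) (l : C) : is_derive f x l ->
  is_derive (fun y => fst (f y)) x (fst l) /\ is_derive (fun y => snd (f y)) x (snd l).
Proof.
  intros [_ D].
  assert (H : forall e : posreal, exists d : posreal, forall y, Rabs (y - x) < d ->
     Rabs (fst (f y) - fst (f x) - (y - x) * fst l) <= e * Rabs (y - x) /\
     Rabs (snd (f y) - snd (f x) - (y - x) * snd l) <= e * Rabs (y - x)).
  { intros e; destruct (D x (fun P H => H) e) as [d Hd]; exists d; intros y Hy.
    specialize (Hd y Hy).
    set (z := (fst (f y) - fst (f x) - (y - x) * fst l, snd (f y) - snd (f x) - (y - x) * snd l) : C).
    assert (Z : Cmod z <= e * Rabs (y - x)) by (unfold Cmod; rewrite <- (pow2_abs (fst z)), <- (pow2_abs (snd z)); exact Hd).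
    assert (M := Rmax_Cmod z). simpl in M.
    split; (eapply Rle_trans; [|exact Z]; eapply Rle_trans; [|exact M]); [apply Rmax_l|apply Rmax_r]. }
  assert (Aux : forall (g : R -> R) (a : R), (forall e : posreal, exists d : posreal, forall y, Rabs (y - x) < d ->
     Rabs (g y - g x - (y - x) * a) <= e * Rabs (y - x)) -> is_derive g x a).
  { intros g a Hg; apply is_derive_Reals; intros e He.
    assert (P : 0 < e / 2) by lra.
    destruct (Hg (mkposreal _ P)) as [d Hd]; exists d; intros h Nh Hh.
    specialize (Hd (x + h)). replace (x + h - x) with h in Hd by ring. specialize (Hd Hh).
    replace ((g (x + h) - g x) / h - a) with ((g (x + h) - g x - h * a) / h) by (field; auto).
    assert (Ph := Rabs_pos_lt h Nh).
    unfold Rdiv; rewrite Rabs_mult, Rabs_inv. simpl in Hd.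
    apply Rle_lt_trans with (e / 2 * Rabs h * / Rabs h).
    - apply Rmult_le_compat_r; [left; now apply Rinv_0_lt_compat|exact Hd].
    - replace (e / 2 * Rabs h * / Rabs h) with (e / 2) by (field; lra). lra. }
  split; apply Aux; intros e; destruct (H e) as [d Hd]; exists d; intros y Hy; now apply Hd.
Qed.

Lemma derC_pair (f g : R -> R) (x a b : R) : is_derive f x a -> is_derive g x b ->
  is_derive (fun y => (f y, g y) : C) x ((a, b) : C).
Proof.
  intros Df Dg.
  assert (D1 := is_derive_scal_l (V := C_R_NormedModule) f x a (1, 0) Df).
  assert (D2 := is_derive_scal_l (V := C_R_NormedModule) g x b (0, 1) Dg).
  assert (D := is_derive_plus (V := C_R_NormedModule) _ _ _ _ _ D1 D2).
  assert (S : forall u v : R, (u, v) = @plus C_R_NormedModule (@scal R_AbsRing C_R_NormedModule u (1, 0)) (@scal R_AbsRing C_R_NormedModule v (0, 1))).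
  { intros u v; apply injective_projections.
    - change (u = u * 1 + v * 0); ring.
    - change (v = u * 0 + v * 1); ring. }
  rewrite S. apply (is_derive_ext (V := C_R_NormedModule) (fun y => @plus C_R_NormedModule (@scal R_AbsRing C_R_NormedModule (f y) (1, 0)) (@scal R_AbsRing C_R_NormedModule (g y) (0, 1)))); auto.
Qed.

Lemma Cmod_le_sum (z : C) : Cmod z <= Rabs (fst z) + Rabs (snd z).
Proof.
  unfold Cmod. assert (P1 := Rabs_pos (fst z)). assert (P2 := Rabs_pos (snd z)).
  rewrite <- (sqrt_Rsqr (Rabs (fst z) + Rabs (snd z))) by lra.
  apply sqrt_le_1_alt. rewrite <- (pow2_abs (fst z)), <- (pow2_abs (snd z)). unfold Rsqr. nra.
Qed.

Lemma AC_parts a b (u : R -> C) : abs_cont_on a b u ->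
  rac a b (fun x => fst (u x)) /\ rac a b (fun x => snd (u x)).
Proof.
  intros H; split; intros e He; destruct (H e He) as [d [Hd K]]; exists d; split; auto; intros n l r H1 H2 H3;
    (eapply Rle_lt_trans; [|apply (K n l r H1 H2 H3)]); apply Rsum_le; intros i _;
    (eapply Rle_trans; [|apply Rmax_Cmod]); [apply Rmax_l|apply Rmax_r].
Qed.

Lemma AC_pair a b (f g : R -> R) : rac a b f -> rac a b g -> abs_cont_on a b (fun x => (f x, g x)).
Proof.
  intros Hf Hg e He.
  destruct (Hf (e / 2) ltac:(lra)) as [d [Hd K]], (Hg (e / 2) ltac:(lra)) as [d' [Hd' K']].
  exists (Rmin d d'); split; [now apply Rmin_pos|]; intros n l r H1 H2 H3.
  generalize (Rmin_l d d') (Rmin_r d d'); intros.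
  assert (A := K n l r H1 H2 ltac:(lra)). assert (B := K' n l r H1 H2 ltac:(lra)).
  apply Rle_lt_trans with (Rsum_lt (fun i => Rabs (f (r i) - f (l i)) + Rabs (g (r i) - g (l i))) n).
  - apply Rsum_le; intros i _; apply Cmod_le_sum.
  - rewrite Rsum_plus; lra.
Qed.

Lemma Cmult_eq0 (z w : C) : Cmult z w = RtoC 0 -> z = RtoC 0 \/ w = RtoC 0.
Proof.
  intros H; destruct (classic (z = RtoC 0)) as [|Nz]; auto; destruct (classic (w = RtoC 0)) as [|Nw]; auto.
  exfalso; now apply (Cmult_neq_0 z w Nz Nw).
Qed.

Lemma Csum_ext f g n : (forall i, (i < n)%nat -> f i = g i) -> Csum_lt f n = Csum_lt g n.
Proof.
  induction n as [|n IH]; intros H; simpl; auto; rewrite IH, (H n); auto; intros; apply H; lia.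
Qed.
Lemma Csum_zero f n : (forall i, (i < n)%nat -> f i = RtoC 0) -> Csum_lt f n = RtoC 0.
Proof.
  induction n as [|n IH]; intros H; simpl; auto.
  rewrite IH, (H n) by (intros; try apply H; lia); ring.
Qed.
Lemma Csum_trunc f n m : (m <= n)%nat -> (forall i, (m <= i < n)%nat -> f i = RtoC 0) -> Csum_lt f n = Csum_lt f m.
Proof.
  intros H; induction H as [|n H IH]; intros Hz; auto; simpl.
  rewrite IH, (Hz n); [ring|lia|intros; apply Hz; lia].
Qed.

(** Three vectors of C^2 are dependent, with 2 by 2 minors as coefficients; if the first two are
    already dependent, the third gets coefficient 0. *)
Lemma C2_dependent (x y : nat -> C) : exists c : nat -> C,
  (exists i, (i < 3)%nat /\ c i <> RtoC 0) /\
  Csum_lt (fun i => Cmult (c i) (x i)) 3 = RtoC 0 /\ Csum_lt (fun i => Cmult (c i) (y i)) 3 = RtoC 0.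
Proof.
  set (mk := fun (a b c : C) (i : nat) => match i with O => a | 1%nat => b | _ => c end).
  assert (Red : forall a b c, (a <> RtoC 0 \/ b <> RtoC 0 \/ c <> RtoC 0) ->
     Cplus (Cplus (Cmult a (x 0%nat)) (Cmult b (x 1%nat))) (Cmult c (x 2%nat)) = RtoC 0 ->
     Cplus (Cplus (Cmult a (y 0%nat)) (Cmult b (y 1%nat))) (Cmult c (y 2%nat)) = RtoC 0 ->
     exists c : nat -> C, (exists i, (i < 3)%nat /\ c i <> RtoC 0) /\
       Csum_lt (fun i => Cmult (c i) (x i)) 3 = RtoC 0 /\ Csum_lt (fun i => Cmult (c i) (y i)) 3 = RtoC 0).
  { intros a b c H H1 H2; exists (mk a b c); split; [|split].
    - destruct H as [H|[H|H]]; [exists 0%nat|exists 1%nat|exists 2%nat]; split; auto.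
    - simpl; etransitivity; [|exact H1]; ring.
    - simpl; etransitivity; [|exact H2]; ring. }
  set (D01 := Cminus (Cmult (x 0%nat) (y 1%nat)) (Cmult (x 1%nat) (y 0%nat))).
  destruct (classic (D01 = RtoC 0)) as [Z|Nz].
  - destruct (classic (x 0%nat = RtoC 0 /\ y 0%nat = RtoC 0)) as [[Zx Zy]|N].
    + apply (Red (RtoC 1) (RtoC 0) (RtoC 0)).
      * left; intros H; apply RtoC_inj in H; lra.
      * rewrite Zx; ring.
      * rewrite Zy; ring.
    + destruct (classic (x 0%nat = RtoC 0)) as [Zx|Nx].
      * apply (Red (y 1%nat) (Copp (y 0%nat)) (RtoC 0)).
        -- right; left; intros H; apply N; split; auto. transitivity (Copp (Copp (y 0%nat))); [ring|rewrite H; ring].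
        -- etransitivity; [|exact Z]; unfold D01; ring.
        -- ring.
      * apply (Red (x 1%nat) (Copp (x 0%nat)) (RtoC 0)).
        -- right; left; intros H; apply Nx. transitivity (Copp (Copp (x 0%nat))); [ring|rewrite H; ring].
        -- ring.
        -- transitivity (Copp D01); [unfold D01; ring|rewrite Z; ring].
  - apply (Red (Cminus (Cmult (x 1%nat) (y 2%nat)) (Cmult (x 2%nat) (y 1%nat)))
             (Cminus (Cmult (x 2%nat) (y 0%nat)) (Cmult (x 0%nat) (y 2%nat))) D01); auto; unfold D01; ring.
Qed.

Section Spectral.
Variables eps mu : R -> R.
Hypothesis Aeps : admissible_coef eps.
Hypothesis Amu : admissible_coef mu.

Let Heps : piecewise_continuous eps := proj1 (proj2 Aeps).
Let Hmu : piecewise_continuous mu := proj1 (proj2 Amu).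

Notation p := (pp eps mu).
Notation q := (qq eps mu).
Notation r := (rr eps mu).

(** The complex solution with Cauchy data [(a, b)] at 0, in coordinates because the fundamental
    solutions are real. *)
Definition comb (E : R) (a b : C) (x : R) : C :=
  (fst a * th eps mu E x + fst b * ph eps mu E x, snd a * th eps mu E x + snd b * ph eps mu E x).
Definition dcomb (E : R) (a b : C) (x : R) : C :=
  (fst a * dth eps mu E x + fst b * dph eps mu E x, snd a * dth eps mu E x + snd b * dph eps mu E x).

Lemma comb_sol E s t : nsol eps mu E (fun x => s * th eps mu E x + t * ph eps mu E x) (fun x => s * dth eps mu E x + t * dph eps mu E x).
Proof. apply nsol_lin; [now apply th_sol|now apply ph_sol]. Qed.

Lemma comb_0 E a b : comb E a b 0 = a /\ dcomb E a b 0 = b.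
Proof.
  unfold comb, dcomb; rewrite (th0 eps mu Aeps Amu), (ph0 eps mu Aeps Amu), (dth0 eps mu Aeps Amu), (dph0 eps mu Aeps Amu).
  split; apply injective_projections; simpl; ring.
Qed.

Lemma comb_1 E a b : comb E a b 1 = Cplus (Cmult a (RtoC (p E))) (Cmult b (RtoC (q E))) /\
  dcomb E a b 1 = Cplus (Cmult a (RtoC (r E))) (Cmult b (RtoC (p E))).
Proof.
  unfold comb, dcomb; rewrite (dph1 eps mu Aeps Amu).
  change (th eps mu E 1) with (p E). change (ph eps mu E 1) with (q E). change (dth eps mu E 1) with (r E).
  split; apply injective_projections; simpl; ring.
Qed.

Lemma comb_lin E a b a' b' c x : Cplus (comb E a b x) (Cmult c (comb E a' b' x)) =
  comb E (Cplus a (Cmult c a')) (Cplus b (Cmult c b')) x.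
Proof. apply injective_projections; simpl; ring. Qed.

Lemma comb_scal E a b c x : Cmult c (comb E a b x) = comb E (Cmult c a) (Cmult c b) x.
Proof. apply injective_projections; simpl; ring. Qed.

Lemma comb_zero E a b : (forall x, 0 < x < 1 -> comb E a b x = RtoC 0) -> a = RtoC 0 /\ b = RtoC 0.
Proof.
  intros H.
  assert (Z : forall s t, (forall x, 0 < x < 1 -> s * th eps mu E x + t * ph eps mu E x = 0) -> s = 0 /\ t = 0).
  { intros s t Hst. destruct (nsol_zero_open eps mu Aeps Amu E _ _ 0 1 (comb_sol E s t) Rlt_0_1 Hst 0) as [Z1 Z2].
    rewrite (th0 eps mu Aeps Amu), (ph0 eps mu Aeps Amu) in Z1; rewrite (dth0 eps mu Aeps Amu), (dph0 eps mu Aeps Amu) in Z2.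
    lra. }
  destruct (Z (fst a) (fst b)) as [A1 A2].
  { intros x Hx; apply (f_equal fst (H x Hx)). }
  destruct (Z (snd a) (snd b)) as [B1 B2].
  { intros x Hx; apply (f_equal snd (H x Hx)). }
  split; apply injective_projections; simpl; auto.
Qed.

(** The bridge from the weak definitions: real and imaginary parts are weak solutions, determined by
    their data at 0. It serves eigenfunctions on [[0, 1]] and modes on both half-lines. *)
Lemma AC_repr E a b (u w : R -> C) : a <= 0 <= b -> abs_cont_on a b u -> abs_cont_on a b w ->
  ae_on (fun x => a <= x <= b) (fun x => is_derive u x (Cmult (RtoC (mu x)) (w x))) ->
  ae_on (fun x => a <= x <= b) (fun x => is_derive w x (Cmult (RtoC (- E * eps x)) (u x))) ->
  forall x, a <= x <= b -> u x = comb E (u 0) (w 0) x /\ w x = dcomb E (u 0) (w 0) x.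
Proof.
  intros Hab Hu Hw [N1 [HN1 D1]] [N2 [HN2 D2]].
  destruct (AC_parts a b u Hu) as [U1 U2], (AC_parts a b w Hw) as [W1 W2].
  assert (Pt : forall x, a <= x <= b -> ~ (N1 x \/ N2 x) ->
    (is_derive (fun y => fst (u y)) x (mu x * fst (w x)) /\ is_derive (fun y => fst (w y)) x (- E * eps x * fst (u x))) /\
    (is_derive (fun y => snd (u y)) x (mu x * snd (w x)) /\ is_derive (fun y => snd (w y)) x (- E * eps x * snd (u x)))).
  { intros x Hx Nx. destruct (derC_parts _ _ _ (D1 x Hx ltac:(tauto))) as [A1 A2].
    destruct (derC_parts _ _ _ (D2 x Hx ltac:(tauto))) as [B1 B2].
    split; split.
    - apply (der_eq _ _ _ _ A1); simpl; ring.
    - apply (der_eq _ _ _ _ B1); simpl; ring.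
    - apply (der_eq _ _ _ _ A2); simpl; ring.
    - apply (der_eq _ _ _ _ B2); simpl; ring. }
  assert (S1 : wsol mu (fun x => - E * eps x) a b (fun x => fst (u x)) (fun x => fst (w x))).
  { split; [auto|split; auto]. exists (fun x => N1 x \/ N2 x); split; [now apply null_union|]. intros x Hx Nx; now apply Pt. }
  assert (S2 : wsol mu (fun x => - E * eps x) a b (fun x => snd (u x)) (fun x => snd (w x))).
  { split; [auto|split; auto]. exists (fun x => N1 x \/ N2 x); split; [now apply null_union|]. intros x Hx Nx; now apply Pt. }
  intros x Hx.
  assert (Gen : forall f g, wsol mu (fun x => - E * eps x) a b f g ->
    f x = f 0 * th eps mu E x + g 0 * ph eps mu E x /\ g x = f 0 * dth eps mu E x + g 0 * dph eps mu E x).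
  { intros f g S.
    apply (wsol_unique eps mu Heps Hmu E a b f g _ _ 0 S (nsol_wsol eps mu Heps Hmu E _ _ a b (comb_sol E (f 0) (g 0))) Hab); auto.
    - rewrite (th0 eps mu Aeps Amu), (ph0 eps mu Aeps Amu); ring.
    - rewrite (dth0 eps mu Aeps Amu), (dph0 eps mu Aeps Amu); ring. }
  destruct (Gen _ _ S1), (Gen _ _ S2). split; apply injective_projections; simpl; auto.
Qed.

Lemma comb_AC E a b s t : abs_cont_on s t (comb E a b) /\ abs_cont_on s t (dcomb E a b).
Proof.
  destruct (nsol_lip eps mu Heps Hmu E _ _ s t (comb_sol E (fst a) (fst b))) as [L1 L2].
  destruct (nsol_lip eps mu Heps Hmu E _ _ s t (comb_sol E (snd a) (snd b))) as [L3 L4].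
  split; apply AC_pair; now apply lip_rac.
Qed.

Lemma comb_der E a b x : good eps mu x ->
  is_derive (comb E a b) x (Cmult (RtoC (mu x)) (dcomb E a b x)) /\
  is_derive (dcomb E a b) x (Cmult (RtoC (- E * eps x)) (comb E a b x)).
Proof.
  intros Gx.
  destruct (comb_sol E (fst a) (fst b)) as [_ [_ D1]], (comb_sol E (snd a) (snd b)) as [_ [_ D2]].
  destruct (D1 x Gx) as [A1 A2], (D2 x Gx) as [B1 B2]. split.
  - replace (Cmult (RtoC (mu x)) (dcomb E a b x)) with
      ((mu x * (fst a * dth eps mu E x + fst b * dph eps mu E x), mu x * (snd a * dth eps mu E x + snd b * dph eps mu E x)) : C).
    + now apply derC_pair.
    + apply injective_projections; simpl; ring.
  - replace (Cmult (RtoC (- E * eps x)) (comb E a b x)) with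
      ((- E * eps x * (fst a * th eps mu E x + fst b * ph eps mu E x), - E * eps x * (snd a * th eps mu E x + snd b * ph eps mu E x)) : C).
    + now apply derC_pair.
    + apply injective_projections; simpl; ring.
Qed.

(** The Cauchy data form an eigenvector of the monodromy matrix (or zero) for the multiplier
    [cexpi k]. *)
Definition floquet (k E : R) (a b : C) : Prop :=
  Cplus (Cmult a (RtoC (p E))) (Cmult b (RtoC (q E))) = Cmult (cexpi k) a /\
  Cplus (Cmult a (RtoC (r E))) (Cmult b (RtoC (p E))) = Cmult (cexpi k) b.

Lemma floquet_eigen k E a b : floquet k E a b -> in_eigenspace eps mu k E (comb E a b).
Proof.
  intros [F1 F2]; destruct (comb_AC E a b 0 1) as [A1 A2]. split; auto.
  destruct (comb_0 E a b) as [Z1 Z2], (comb_1 E a b) as [O1 O2].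
  exists (dcomb E a b); split; [auto|split; [|split; [|split]]].
  - exists (fun x => ~ good eps mu x); split; [apply off_finite_null; now apply good_off|].
    intros x _ Gx; apply NNPP in Gx; now apply comb_der.
  - exists (fun x => ~ good eps mu x); split; [apply off_finite_null; now apply good_off|].
    intros x _ Gx; apply NNPP in Gx; now apply comb_der.
  - now rewrite O1, Z1.
  - now rewrite O2, Z2.
Qed.

Lemma eigen_floquet k E u : in_eigenspace eps mu k E u ->
  exists a b, floquet k E a b /\ forall x, in01 x -> u x = comb E a b x.
Proof.
  intros [Hu [w [Hw [D1 [D2 [B1 B2]]]]]].
  assert (Rp := AC_repr E 0 1 u w ltac:(lra) Hu Hw D1 D2).
  exists (u 0), (w 0); split.
  - destruct (comb_1 E (u 0) (w 0)) as [O1 O2]. destruct (Rp 1 ltac:(lra)) as [P1 P2].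
    split; [rewrite <- O1, <- P1|rewrite <- O2, <- P2]; auto.
  - intros x Hx; now apply Rp.
Qed.

Lemma cexpi_sq k : Cplus (Cmult (cexpi k) (cexpi k)) (RtoC 1) = Cmult (RtoC (2 * cos k)) (cexpi k).
Proof.
  assert (S := sin2_cos2 k); unfold Rsqr in S.
  apply injective_projections; simpl; lra.
Qed.

Lemma cexpi_neq0 k : cexpi k <> RtoC 0.
Proof.
  intros H. assert (S := sin2_cos2 k); unfold Rsqr in S.
  injection H as H1 H2. rewrite H1, H2 in S; lra.
Qed.

Lemma detC E : Cminus (Cmult (RtoC (p E)) (RtoC (p E))) (Cmult (RtoC (q E)) (RtoC (r E))) = RtoC 1.
Proof. rewrite <- !RtoC_mult, <- RtoC_minus, (pq_det eps mu Aeps Amu); auto. Qed.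

(** At [z = cexpi k] the characteristic polynomial [z^2 - 2 p z + 1] has the nonzero value
    [2 (cos k - p) z]. Applying the adjugate matrix to the two equations shows that this number
    annihilates [a] and [b]. *)
Lemma floquet_trivial k E a b : p E <> cos k -> floquet k E a b -> a = RtoC 0 /\ b = RtoC 0.
Proof.
  intros Hp [F1 F2].
  set (e := cexpi k) in *. set (P := RtoC (p E)) in *. set (Qc := RtoC (q E)) in *. set (Rc := RtoC (r E)) in *.
  assert (Dt : Cminus (Cmult P P) (Cmult Qc Rc) = RtoC 1) by apply detC.
  assert (Sq : Cplus (Cmult e e) (RtoC 1) = Cmult (RtoC (2 * cos k)) e) by apply cexpi_sq.
  assert (K : Cminus (Cplus (Cmult e e) (RtoC 1)) (Cmult (Cplus P P) e) = Cmult (RtoC (2 * (cos k - p E))) e).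
  { rewrite Sq. unfold P. rewrite <- RtoC_plus. apply injective_projections; simpl; ring. }
  assert (Nz : Cmult (RtoC (2 * (cos k - p E))) e <> RtoC 0).
  { apply Cmult_neq_0; [|apply cexpi_neq0]. intros H; apply RtoC_inj in H; lra. }
  assert (Z1 : Cmult (Cmult (RtoC (2 * (cos k - p E))) e) a = RtoC 0).
  { rewrite <- K, <- Dt.
    transitivity (Cminus (Cmult (Cminus P e) (Cminus (Cplus (Cmult a P) (Cmult b Qc)) (Cmult e a)))
       (Cmult Qc (Cminus (Cplus (Cmult a Rc) (Cmult b P)) (Cmult e b)))); [ring|rewrite F1, F2; ring]. }
  assert (Z2 : Cmult (Cmult (RtoC (2 * (cos k - p E))) e) b = RtoC 0).
  { rewrite <- K, <- Dt.
    transitivity (Cminus (Cmult (Cminus P e) (Cminus (Cplus (Cmult a Rc) (Cmult b P)) (Cmult e b)))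
       (Cmult Rc (Cminus (Cplus (Cmult a P) (Cmult b Qc)) (Cmult e a)))); [ring|rewrite F1, F2; ring]. }
  apply Cmult_eq0 in Z1; apply Cmult_eq0 in Z2; tauto.
Qed.

Lemma floquet_line k E : p E = cos k -> ~ (q E = 0 /\ r E = 0) ->
  exists a0 b0, floquet k E a0 b0 /\ (a0 <> RtoC 0 \/ b0 <> RtoC 0) /\
    forall a b, floquet k E a b -> exists c, a = Cmult c a0 /\ b = Cmult c b0.
Proof.
  intros Hp Hn. assert (dt := pq_det eps mu Aeps Amu E). rewrite Hp in dt.
  assert (S := sin2_cos2 k); unfold Rsqr in S.
  destruct (Req_dec (q E) 0) as [Zq|Nq].
  - assert (Zs : sin k = 0).
    { rewrite Zq in dt. assert (Y : sin k * sin k = 0) by lra. apply Rmult_integral in Y; tauto. }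
    assert (He : cexpi k = RtoC (p E)) by (unfold cexpi; rewrite Zs, Hp; auto).
    (* Here [cexpi k = p], the matrix is lower triangular and [r] is not zero. *)
    exists (RtoC 0), (RtoC 1); split; [|split].
    + split; rewrite He; [rewrite Zq|]; ring.
    + right; intros H; apply RtoC_inj in H; lra.
    + intros a b [F1 F2]. rewrite He in F2. exists b.
      assert (Z : Cmult a (RtoC (r E)) = RtoC 0).
      { transitivity (Cminus (Cplus (Cmult a (RtoC (r E))) (Cmult b (RtoC (p E)))) (Cmult b (RtoC (p E)))); [ring|rewrite F2; ring]. }
      apply Cmult_eq0 in Z; destruct Z as [Z|Z].
      * rewrite Z; split; ring.
      * exfalso; apply Hn; split; auto; now apply RtoC_inj in Z.
  - assert (Nqc : RtoC (q E) <> RtoC 0) by (intros H; apply RtoC_inj in H; lra).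
    (* [(0, sin k)] is [cexpi k - p], so this solves the first eigenvector equation, and the
       determinant gives the second. *)
    exists (RtoC (q E)), ((0, sin k) : C); split; [|split].
    + split.
      * apply injective_projections; simpl; rewrite Hp; ring.
      * apply injective_projections; simpl; rewrite Hp; lra.
    + left; auto.
    + intros a b [F1 F2]. exists (Cdiv a (RtoC (q E))). split; [field; auto|].
      assert (Eb : Cmult b (RtoC (q E)) = Cmult ((0, sin k) : C) a).
      { transitivity (Cminus (Cplus (Cmult a (RtoC (p E))) (Cmult b (RtoC (q E)))) (Cmult a (RtoC (p E)))); [ring|rewrite F1].
        apply injective_projections; simpl; rewrite Hp; ring. }
      transitivity (Cdiv (Cmult b (RtoC (q E))) (RtoC (q E))); [field; auto|rewrite Eb; field; auto].
Qed.

Lemma floquet_plane k E a b : p E = cos k -> q E = 0 -> r E = 0 -> floquet k E a b.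
Proof.
  intros Hp Zq Zr. assert (dt := pq_det eps mu Aeps Amu E). rewrite Hp, Zq in dt.
  assert (S := sin2_cos2 k); unfold Rsqr in S.
  assert (Zs : sin k = 0).
  { assert (Y : sin k * sin k = 0) by lra. apply Rmult_integral in Y; tauto. }
  assert (He : cexpi k = RtoC (p E)) by (unfold cexpi; rewrite Zs, Hp; auto).
  split; rewrite He, ?Zq, ?Zr; ring.
Qed.

Lemma comb_sum E (c : nat -> C) (A B : nat -> C) x n :
  Csum_lt (fun i => Cmult (c i) (comb E (A i) (B i) x)) n =
  comb E (Csum_lt (fun i => Cmult (c i) (A i)) n) (Csum_lt (fun i => Cmult (c i) (B i)) n) x.
Proof.
  induction n as [|n IH]; cbn [Csum_lt].
  - apply injective_projections; simpl; ring.
  - rewrite IH, comb_lin; auto.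
Qed.

(** Cauchy data embed the eigenspace in C^2. *)
Lemma eig_dim_le2 k E d : eig_dim eps mu k E d -> (d <= 2)%nat.
Proof.
  intros [f [Hf [Ind _]]]. destruct (Nat.le_gt_cases d 2) as [|G]; auto; exfalso.
  assert (H : forall i, exists ab : C * C, (i < d)%nat -> forall x, in01 x -> f i x = comb E (fst ab) (snd ab) x).
  { intros i; destruct (Nat.lt_ge_cases i d) as [L|L].
    - destruct (eigen_floquet k E (f i) (Hf i L)) as [a [b [_ Hab]]]; now exists (a, b).
    - exists (RtoC 0, RtoC 0); lia. }
  set (g := fun i => proj1_sig (constructive_indefinite_description _ (H i))).
  assert (Hg : forall i, (i < d)%nat -> forall x, in01 x -> f i x = comb E (fst (g i)) (snd (g i)) x).
  { intros i; unfold g; apply (proj2_sig (constructive_indefinite_description _ (H i))). }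
  destruct (C2_dependent (fun i => fst (g i)) (fun i => snd (g i))) as [c [[i [Hi Ni]] [Z1 Z2]]].
  (* The dependence among the first three functions is padded with zeros to length [d]. *)
  set (c' := fun i => if Nat.ltb i 3 then c i else RtoC 0).
  apply Ni. replace (c i) with (c' i) by (unfold c'; destruct (Nat.ltb_spec i 3); auto; lia).
  apply (Ind c'); [|lia]. intros x Hx.
  rewrite (Csum_trunc _ d 3) by (lia || (intros j Hj; unfold c'; destruct (Nat.ltb_spec j 3); [lia|ring])).
  rewrite (Csum_ext _ (fun i => Cmult (c i) (comb E (fst (g i)) (snd (g i)) x))).
  - rewrite comb_sum, Z1, Z2. apply injective_projections; simpl; ring.
  - intros j Hj; unfold c'; destruct (Nat.ltb_spec j 3); [|lia]. rewrite Hg; auto; lia.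
Qed.

(** An equivalence, here and in the next two cases, because [is_eigen_seq] quantifies over every [d]
    satisfying [eig_dim]. *)
Lemma eig_dim_none k E d : p E <> cos k -> (eig_dim eps mu k E d <-> d = 0%nat).
Proof.
  intros Hp; split.
  - intros [f [Hf [Ind _]]]. destruct d as [|d]; auto; exfalso.
    assert (Z : RtoC 1 = RtoC 0); [|apply RtoC_inj in Z; lra].
    apply (Ind (fun _ => RtoC 1)) with (i := 0%nat); [|lia]. intros x Hx; apply Csum_zero; intros i Hi.
    destruct (eigen_floquet k E (f i) (Hf i Hi)) as [a [b [Fl Hab]]].
    destruct (floquet_trivial k E a b Hp Fl) as [-> ->]. rewrite Hab by auto. apply injective_projections; simpl; ring.
  - intros ->; exists (fun _ _ => RtoC 0); split; [intros; lia|split; [intros; lia|]].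
    intros u Hu; exists (fun _ => RtoC 0); intros x Hx; simpl.
    destruct (eigen_floquet k E u Hu) as [a [b [Fl Hab]]].
    destruct (floquet_trivial k E a b Hp Fl) as [-> ->]. rewrite Hab by auto. apply injective_projections; simpl; ring.
Qed.

Lemma eig_dim_once k E d : p E = cos k -> ~ (q E = 0 /\ r E = 0) -> (eig_dim eps mu k E d <-> d = 1%nat).
Proof.
  intros Hp Hn; destruct (floquet_line k E Hp Hn) as [a0 [b0 [Fl [Nz Sp]]]].
  assert (Nz0 : ~ forall x, in01 x -> comb E a0 b0 x = RtoC 0).
  { intros H; destruct (comb_zero E a0 b0) as [Z1 Z2]; [|tauto]. intros x Hx; apply H; unfold in01; lra. }
  split.
  - intros Hd. assert (L2 := eig_dim_le2 k E d Hd). destruct Hd as [f [Hf [Ind Span]]].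
    destruct d as [|[|d]]; auto; exfalso.
    + apply Nz0; intros x Hx. destruct (Span _ (floquet_eigen k E a0 b0 Fl)) as [c Hc]. now apply (Hc x Hx).
    + assert (d = 0)%nat by lia; subst d.
      assert (Co : forall i, (i < 2)%nat -> exists c, forall x, in01 x -> f i x = Cmult c (comb E a0 b0 x)).
      { intros i Hi; destruct (eigen_floquet k E (f i) (Hf i Hi)) as [a [b [Fl' Hab]]].
        destruct (Sp a b Fl') as [c [-> ->]]; exists c; intros x Hx; rewrite Hab, comb_scal; auto. }
      destruct (Co 0%nat ltac:(lia)) as [c0 H0], (Co 1%nat ltac:(lia)) as [c1 H1].
      assert (Z : forall c : nat -> C, Cplus (Cmult (c 0%nat) c0) (Cmult (c 1%nat) c1) = RtoC 0 -> c 0%nat = RtoC 0 /\ c 1%nat = RtoC 0).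
      { intros c Hc. assert (K : forall x, in01 x -> Csum_lt (fun i => Cmult (c i) (f i x)) 2 = RtoC 0).
        { intros x Hx; simpl. rewrite H0, H1 by auto.
          transitivity (Cmult (Cplus (Cmult (c 0%nat) c0) (Cmult (c 1%nat) c1)) (comb E a0 b0 x)); [ring|rewrite Hc; ring]. }
        split; apply (Ind c K); lia. }
      (* The coefficients [(c1, - c0)] annihilate the two multiples, so independence forces
         [c0 = c1 = 0]; then [(1, 0)] annihilates them too, a contradiction. *)
      destruct (Z (fun i => match i with O => c1 | _ => Copp c0 end)) as [Z1 Z2]; [simpl; ring|].
      simpl in Z1, Z2.
      destruct (Z (fun i => match i with O => RtoC 1 | _ => RtoC 0 end)) as [Z3 _].
      * simpl. transitivity (Copp (Copp c0)); [ring|rewrite Z2; ring].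
      * simpl in Z3; apply RtoC_inj in Z3; lra.
  - intros ->; exists (fun _ => comb E a0 b0); split; [intros; now apply floquet_eigen|split].
    + intros c Hc i Hi; assert (i = 0)%nat by lia; subst i.
      destruct (classic (c 0%nat = RtoC 0)) as [|N]; auto; exfalso; apply Nz0; intros x Hx.
      specialize (Hc x Hx); simpl in Hc.
      assert (Z : Cmult (c 0%nat) (comb E a0 b0 x) = RtoC 0) by (rewrite <- Hc; ring).
      apply Cmult_eq0 in Z; tauto.
    + intros u Hu; destruct (eigen_floquet k E u Hu) as [a [b [Fl' Hab]]].
      destruct (Sp a b Fl') as [c [-> ->]]; exists (fun _ => c); intros x Hx; simpl.
      rewrite Hab, <- comb_scal by auto; ring.
Qed.

Lemma eig_dim_twice k E d : p E = cos k -> q E = 0 -> r E = 0 -> (eig_dim eps mu k E d <-> d = 2%nat).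
Proof.
  intros Hp Zq Zr.
  assert (Fl : forall a b, in_eigenspace eps mu k E (comb E a b)) by (intros; now apply floquet_eigen, floquet_plane).
  assert (N1 : RtoC 1 <> RtoC 0) by (intros H; apply RtoC_inj in H; lra).
  split.
  - intros Hd. assert (L2 := eig_dim_le2 k E d Hd). destruct Hd as [f [Hf [Ind Span]]].
    destruct d as [|[|d]]; [exfalso|exfalso|lia].
    + destruct (Span _ (Fl (RtoC 1) (RtoC 0))) as [c Hc]. simpl in Hc.
      destruct (comb_zero E (RtoC 1) (RtoC 0)) as [Z _]; [|tauto]. intros x Hx; apply Hc; unfold in01; lra.
    + destruct (Span _ (Fl (RtoC 1) (RtoC 0))) as [c Hc], (Span _ (Fl (RtoC 0) (RtoC 1))) as [c' Hc'].
      simpl in Hc, Hc'.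
      destruct (comb_zero E (c' 0%nat) (Copp (c 0%nat))) as [Z1 Z2].
      { intros x Hx. assert (Ix : in01 x) by (unfold in01; lra).
        transitivity (Cplus (Cmult (c' 0%nat) (comb E (RtoC 1) (RtoC 0) x)) (Cmult (Copp (c 0%nat)) (comb E (RtoC 0) (RtoC 1) x))).
        - rewrite comb_scal, comb_lin. f_equal; ring.
        - rewrite Hc, Hc' by auto. ring. }
      destruct (comb_zero E (RtoC 0) (RtoC 1)) as [_ Z]; [|tauto]. intros x Hx.
      rewrite Hc', Z1 by (unfold in01; lra). ring.
  - intros ->; exists (fun i => match i with O => comb E (RtoC 1) (RtoC 0) | _ => comb E (RtoC 0) (RtoC 1) end).
    assert (Sum : forall c : nat -> C, forall x, Csum_lt (fun i => Cmult (c i) ((match i with O => comb E (RtoC 1) (RtoC 0) | _ => comb E (RtoC 0) (RtoC 1) end) x)) 2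
       = comb E (c 0%nat) (c 1%nat) x).
    { intros c x; cbn [Csum_lt]. rewrite comb_scal.
      transitivity (Cplus (comb E (Cmult (c 0%nat) (RtoC 1)) (Cmult (c 0%nat) (RtoC 0)) x) (Cmult (c 1%nat) (comb E (RtoC 0) (RtoC 1) x))); [ring|].
      rewrite comb_lin; f_equal; ring. }
    split; [|split].
    + intros [|i] _; apply Fl.
    + intros c Hc. destruct (comb_zero E (c 0%nat) (c 1%nat)) as [Z1 Z2].
      { intros x Hx; rewrite <- Sum; apply Hc; unfold in01; lra. }
      intros [|[|i]] Hi; auto; lia.
    + intros u Hu; destruct (eigen_floquet k E u Hu) as [a [b [_ Hab]]].
      exists (fun i => match i with O => a | _ => b end); intros x Hx.
      rewrite Sum; auto.
Qed.

(** * Eigenvalue sequences and band functions *)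

Lemma eig_dim_exists k E : exists d, eig_dim eps mu k E d.
Proof.
  destruct (Req_dec (p E) (cos k)) as [Hp|Hp]; [destruct (classic (q E = 0 /\ r E = 0)) as [[Zq Zr]|Hn]|].
  - exists 2%nat; now apply eig_dim_twice.
  - exists 1%nat; now apply eig_dim_once.
  - exists 0%nat; now apply eig_dim_none.
Qed.

(** At the first disagreement, say [lam n < lam' n], the value [lam n] occurs in [lam'] only before
    [n], where the sequences agree; so it occurs at least once more in [lam], against equal
    multiplicities. *)
Lemma eigen_seq_unique k lam lam' : is_eigen_seq eps mu k lam -> is_eigen_seq eps mu k lam' ->
  forall n, lam n = lam' n.
Proof.
  assert (Half : forall lam lam' n, is_eigen_seq eps mu k lam -> is_eigen_seq eps mu k lam' ->
    (forall i, (i < n)%nat -> lam i = lam' i) -> lam n < lam' n -> False).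
  { clear lam lam'; intros lam lam' n [M1 H1] [M2 H2] Eq Lt.
    destruct (eig_dim_exists k (lam n)) as [d Hd].
    destruct (H1 _ d Hd) as [l [ND [Ln Hl]]], (H2 _ d Hd) as [l' [ND' [Ln' Hl']]].
    assert (Mono : forall j, (n <= j)%nat -> lam' n <= lam' j).
    { intros j Hj; induction Hj; [lra|]. generalize (M2 m); lra. }
    assert (Inc : forall i, In i l' -> (i < n)%nat /\ In i l).
    { intros i Hi. assert (Ei : lam' i = lam n) by now apply Hl'.
      destruct (Nat.lt_ge_cases i n) as [L|L].
      - split; auto; apply Hl. now rewrite Eq.
      - specialize (Mono i L); lra. }
    assert (Len : (length (n :: l') <= length l)%nat).
    { apply NoDup_incl_length.
      - constructor; auto; intros K; destruct (Inc n K); lia.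
      - intros i [<-|Hi]; [now apply Hl|now apply Inc]. }
    simpl in Len; lia. }
  intros H H' n; induction n as [n IH] using (well_founded_induction Wf_nat.lt_wf).
  destruct (Rtotal_order (lam n) (lam' n)) as [L|[L|L]]; auto; exfalso.
  - now apply (Half lam lam' n).
  - apply (Half lam' lam n); auto; intros; symmetry; auto.
Qed.

Lemma pp_bands : exists lo hi, band_edges p q r lo hi.
Proof.
  apply (bands_exist p q r (PP eps mu) (QQ eps mu) (TT eps mu)).
  - now apply pq_det.
  - now apply dp.
  - now apply dq.
  - now apply dr.
  - now apply TT_pos.
  - now apply QQ_pos.
  - intros E0; destruct (rr_zeros eps mu Aeps Amu E0) as [E [HE Z]]; exists E; split; auto.
    assert (dt := pq_det eps mu Aeps Amu E). rewrite Z in dt; lra.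
  - now apply zero_energy.
Qed.

Section WithEdges.
Let Q := QQ eps mu.
Let T := TT eps mu.
Let det := pq_det eps mu Aeps Amu.
Let Dp := dp eps mu Aeps Amu.
Let Tpos := TT_pos eps mu Aeps Amu.
Let Qpos := QQ_pos eps mu Aeps Amu.
Let below := neg_energy eps mu Aeps Amu.
Let bottom := zero_energy eps mu Aeps Amu.
Variables lo hi : nat -> R.
Hypothesis HB : band_edges p q r lo hi.

Lemma lam_exists t : t * t <= 1 -> exists lam : nat -> R, forall n, lo n <= lam n <= hi n /\ p (lam n) = t.
Proof.
  intros Ht.
  assert (S : forall n, exists E, lo n <= E <= hi n /\ p E = t).
  { intros n; exact (band_solve p q r Q T Dp lo hi HB n t Ht). }
  exists (fun n => proj1_sig (constructive_indefinite_description _ (S n))).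
  intros n; apply (proj2_sig (constructive_indefinite_description _ (S n))).
Qed.

Lemma cos_sq_le k : cos k * cos k <= 1.
Proof. generalize (COS_bound k); nra. Qed.

Lemma lam_eigen_seq k lam : (forall n, lo n <= lam n <= hi n /\ p (lam n) = cos k) -> is_eigen_seq eps mu k lam.
Proof.
  intros Hlam; split.
  - intros m; eapply (lam_nondecreasing p q r lo hi HB); eauto.
  - intros E d Hd.
    destruct (Req_dec (p E) (cos k)) as [Hp|Hp]; [destruct (classic (q E = 0 /\ r E = 0)) as [[Zq Zr]|Hn]|].
    + apply eig_dim_twice in Hd; auto; subst d.
      destruct (lam_twice p q r Q T det Dp Tpos Qpos below bottom lo hi HB _ lam (cos_sq_le k) Hlam E Hp Zq Zr) as [m Hm].
      exists (m :: S m :: nil); split; [|split; auto].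
      * constructor; [intros [|[]]; lia|constructor; [intros []|constructor]].
      * intros j; rewrite Hm; simpl; intuition.
    + apply eig_dim_once in Hd; auto; subst d.
      destruct (lam_once p q r Q T det Dp Tpos Qpos below lo hi HB _ lam (cos_sq_le k) Hlam E Hp Hn) as [m Hm].
      exists (m :: nil); split; [|split; auto].
      * constructor; [intros []|constructor].
      * intros j; rewrite Hm; simpl; intuition.
    + apply eig_dim_none in Hd; auto; subst d. exists nil; split; [constructor|split; auto].
      intros j; split; [intros []|]. intros Hj; exfalso; revert Hj; eapply (lam_none p lo hi); eauto.
Qed.

(** Uniqueness transfers the constructed sequence to the one chosen by [epsilon] in [band]. *)
Lemma band_spec m k : lo m <= band eps mu (S m) k <= hi m /\ p (band eps mu (S m) k) = cos k.
Proof.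
  destruct (lam_exists (cos k) (cos_sq_le k)) as [lam Hlam].
  assert (Hs : is_eigen_seq eps mu k lam) by now apply lam_eigen_seq.
  assert (He : is_eigen_seq eps mu k (epsilon (inhabits (fun _ : nat => 0)) (fun lam => is_eigen_seq eps mu k lam))).
  { apply epsilon_spec; now exists lam. }
  simpl. rewrite <- (eigen_seq_unique k lam _ Hs He m). apply Hlam.
Qed.

(** At an edge [p] is 1 or -1, realised by [k = 0] or [k = PI]. *)
Lemma band_edge m x : lo m <= x <= hi m -> p x * p x = 1 -> exists k, inPi k /\ band eps mu (S m) k = x.
Proof.
  intros Hx H.
  assert (Hp : exists k, inPi k /\ cos k = p x).
  { assert (Y : (p x - 1) * (p x + 1) = 0) by lra. assert (PP := PI_RGT_0).
    apply Rmult_integral in Y; destruct Y as [Y|Y].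
    - exists 0; split; [unfold inPi; lra|rewrite cos_0; lra].
    - exists PI; split; [unfold inPi; lra|rewrite cos_PI; lra]. }
  destruct Hp as [k [Hk Ck]]; exists k; split; auto.
  destruct (band_spec m k) as [B1 B2].
  apply (band_unique p q r Q T det Dp Tpos Qpos lo hi HB m); auto; congruence.
Qed.

Lemma band_max_hi m : band_max eps mu (S m) = hi m.
Proof.
  assert (R1 := proj2 HB m).
  destruct (band_edge m (hi m)) as [k0 [Hk0 B0]].
  { generalize (br_lt _ _ _ _ _ _ R1); lra. }
  { rewrite (br_hi _ _ _ _ _ _ R1). generalize (br_lo _ _ _ _ _ _ R1); lra. }
  assert (Sp : (exists k, inPi k /\ band eps mu (S m) k = band_max eps mu (S m)) /\
     forall k, inPi k -> band eps mu (S m) k <= band_max eps mu (S m)).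
  { unfold band_max; apply epsilon_spec; exists (hi m); split; [now exists k0|]. intros; apply band_spec. }
  destruct Sp as [[k [_ Hk]] Hle]. specialize (Hle k0 Hk0). rewrite B0 in Hle.
  destruct (band_spec m k); lra.
Qed.

Lemma band_min_lo m : band_min eps mu (S m) = lo m.
Proof.
  assert (R1 := proj2 HB m).
  destruct (band_edge m (lo m)) as [k0 [Hk0 B0]].
  { generalize (br_lt _ _ _ _ _ _ R1); lra. }
  { apply (br_lo _ _ _ _ _ _ R1). }
  assert (Sp : (exists k, inPi k /\ band eps mu (S m) k = band_min eps mu (S m)) /\
     forall k, inPi k -> band_min eps mu (S m) <= band eps mu (S m) k).
  { unfold band_min; apply epsilon_spec; exists (lo m); split; [now exists k0|]. intros; apply band_spec. }
  destruct Sp as [[k [_ Hk]] Hle]. specialize (Hle k0 Hk0). rewrite B0 in Hle.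
  destruct (band_spec m k); lra.
Qed.
End WithEdges.
End Spectral.

(** * Gaps and bulk indices *)

Section Bulk.
Variables eps mu : R -> R.
Hypothesis Aeps : admissible_coef eps.
Hypothesis Amu : admissible_coef mu.
Notation p := (pp eps mu).
Notation q := (qq eps mu).
Notation r := (rr eps mu).

(** Parity about the origin makes one of the Cauchy data there vanish: the quasi-derivative for an
    even mode, the value for an odd one. The other datum alone forms an eigenvector only if [r],
    respectively [q], is zero. *)
Lemma bulk_edge m g : bulk_index eps mu m g ->
  (g = 1%Z /\ r (band_max eps mu m) = 0) \/ (g = (-1)%Z /\ q (band_max eps mu m) = 0).
Proof.
  intros [k [u [Hk [_ [Hu [[x0 [Hx0 Nx0]] Hg]]]]]]. set (E := band_max eps mu m) in *.
  destruct (eigen_floquet eps mu Aeps Amu k E u Hu) as [a [b [[F1 F2] Hab]]].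
  destruct (comb_0 eps mu Aeps Amu E a b) as [C0 _].
  assert (Nab : ~ (a = RtoC 0 /\ b = RtoC 0)).
  { intros [-> ->]; apply Nx0; rewrite Hab by auto. apply injective_projections; simpl; ring. }
  (* For [x] in [(0, 1)] the point [- x] has integer part -1, so the extension brings in
     [cexpi (- k)], which equals [cexpi k] at both admissible [k]. *)
  assert (Hs : exists s, s * s = 1 /\ cexpi k = RtoC s /\ cexpi (k * -1) = RtoC s).
  { destruct Hk as [->| ->].
    - exists 1; split; [ring|]. unfold cexpi; rewrite Rmult_0_l, cos_0, sin_0; auto.
    - exists (-1); split; [ring|]. unfold cexpi.
      replace (PI * -1) with (- PI) by ring. rewrite cos_neg, sin_neg, cos_PI, sin_PI, Ropp_0; auto. }
  destruct Hs as [s [Ss [Es Es']]]. rewrite Es in F1, F2.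
  destruct Hg as [[-> Hev]|[-> Hod]]; [left|right]; split; auto.
  - assert (Refl : forall x, 0 < x < 1 -> Cmult (RtoC s) (u (1 - x)) = u x).
    { intros x Hx; specialize (Hev x). unfold bloch_ext in Hev.
      rewrite <- (Int_part_spec x 0) in Hev by lra. rewrite <- (Int_part_spec (- x) (-1)) in Hev by lra.
      rewrite Es' in Hev. replace (- x - -1) with (1 - x) in Hev by ring. rewrite Hev.
      unfold cexpi; rewrite Rmult_0_r, cos_0, sin_0, Rminus_0_r. change ((1, 0) : C) with (RtoC 1); ring. }
    assert (Z : forall a1 b1, r E * a1 + p E * b1 = s * b1 ->
       (forall x, 0 < x < 1 -> s * (a1 * th eps mu E (1 - x) + b1 * ph eps mu E (1 - x)) = a1 * th eps mu E x + b1 * ph eps mu E x) -> b1 = 0).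
    { intros a1 b1 H1 H2.
      assert (S := comb_sol eps mu Aeps Amu E a1 b1).
      (* The solution minus [s] times its reflection about 1/2 vanishes on [(0, 1)], and its
         quasi-derivative at 0 is [b1 + s (s b1) = 2 b1]. *)
      assert (S' := nsol_lin eps mu E _ _ _ _ 1 (- s) S (nsol_refl eps mu Aeps Amu E _ _ S)).
      destruct (nsol_zero_open eps mu Aeps Amu E _ _ 0 1 S' Rlt_0_1) with (x := 0) as [_ Zw].
      - intros x Hx; specialize (H2 x Hx); cbv beta; lra.
      - cbv beta in Zw. rewrite Rminus_0_r, (dth0 eps mu Aeps Amu), (dph0 eps mu Aeps Amu), (dph1 eps mu Aeps Amu) in Zw.
        change (dth eps mu E 1) with (r E) in Zw.
        assert (Y : b1 + s * (s * b1) = 0) by (rewrite <- H1 at 1; lra).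
        assert (Y2 : b1 + s * s * b1 = 0) by lra. rewrite Ss in Y2; lra. }
    assert (Zb : b = RtoC 0).
    { apply injective_projections.
      - apply (Z (fst a)); [assert (K := f_equal fst F2); simpl in K; lra|].
        intros x Hx. assert (K := f_equal fst (Refl x Hx)). rewrite !Hab in K by (unfold in01; lra). simpl in K; lra.
      - apply (Z (snd a)); [assert (K := f_equal snd F2); simpl in K; lra|].
        intros x Hx. assert (K := f_equal snd (Refl x Hx)). rewrite !Hab in K by (unfold in01; lra). simpl in K; lra. }
    assert (Zr : Cmult a (RtoC (r E)) = RtoC 0).
    { transitivity (Cplus (Cmult a (RtoC (r E))) (Cmult b (RtoC (p E)))); [rewrite Zb; ring|rewrite F2, Zb; ring]. }
    apply Cmult_eq0 in Zr; destruct Zr as [Za|Zr]; [exfalso; tauto|now apply RtoC_inj in Zr].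
  - assert (Za : a = RtoC 0).
    { specialize (Hod 0). unfold bloch_ext in Hod. rewrite Ropp_0 in Hod.
      rewrite <- (Int_part_spec 0 0) in Hod by lra. rewrite Rminus_0_r, Rmult_0_r in Hod.
      rewrite Hab, C0 in Hod by (unfold in01; lra).
      unfold cexpi in Hod; rewrite cos_0, sin_0 in Hod. change ((1, 0) : C) with (RtoC 1) in Hod.
      rewrite Cmult_1_l in Hod.
      apply injective_projections; [assert (K := f_equal fst Hod)|assert (K := f_equal snd Hod)]; simpl in *; lra. }
    assert (Zq : Cmult b (RtoC (q E)) = RtoC 0).
    { transitivity (Cplus (Cmult a (RtoC (p E))) (Cmult b (RtoC (q E)))); [rewrite Za; ring|rewrite F1, Za; ring]. }
    apply Cmult_eq0 in Zq; destruct Zq as [Zb|Zq]; [exfalso; tauto|now apply RtoC_inj in Zq].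
Qed.
End Bulk.

Record gap_even (p q r : R -> R) (L U : R) : Prop := {
  ge_in : forall E, L < E < U -> 1 < p E * p E /\ p E * q E < 0 /\ p E * r E < 0;
  ge_rL : r L = 0; ge_qL : q L <> 0; ge_qU : q U = 0; ge_rU : r U <> 0 }.
Record gap_odd (p q r : R -> R) (L U : R) : Prop := {
  go_in : forall E, L < E < U -> 1 < p E * p E /\ 0 < p E * q E /\ 0 < p E * r E;
  go_qL : q L = 0; go_rL : r L <> 0; go_rU : r U = 0; go_qU : q U <> 0 }.

Section Gap.
Variables p q r P Q T : R -> R.
Hypothesis det : forall E, p E * p E - q E * r E = 1.
Hypothesis Dp : forall E, is_derive p E ((r E * Q E - q E * T E) / 2).
Hypothesis Dq : forall E, is_derive q E (p E * Q E - q E * P E).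
Hypothesis Dr : forall E, is_derive r E (r E * P E - p E * T E).
Hypothesis Tpos : forall E, 0 < T E.
Hypothesis Qpos : forall E, 0 < Q E.
Hypothesis PTQ : forall E, P E * P E < T E * Q E.

Let Cp : forall x, continuous p x. Proof. intros; eapply cont_derive, Dp. Qed.
Let Cq : forall x, continuous q x. Proof. intros; eapply cont_derive, Dq. Qed.
Let Cr : forall x, continuous r x. Proof. intros; eapply cont_derive, Dr. Qed.

(** At a zero of [r] on an edge the derivative of [p r] is [- p^2 T = - T], whatever the sign of
    [p]; so [p r] always passes from positive to negative. *)
Lemma edge_pr E : p E * p E = 1 -> r E = 0 ->
  exists e, 0 < e /\ (forall x, E < x < E + e -> p x * r x < 0) /\ (forall x, E - e < x < E -> 0 < p x * r x).
Proof.
  intros H Zr.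
  apply (der_sign_neg (fun x => p x * r x) E (- T E)); [|rewrite Zr; ring|generalize (Tpos E); lra].
  eapply der_eq; [apply der_mult; [apply Dp|apply Dr]|cbv beta].
  rewrite Zr. transitivity (- (p E * p E) * T E); [ring|rewrite H; ring].
Qed.

Lemma edge_pq E : p E * p E = 1 -> q E = 0 ->
  exists e, 0 < e /\ (forall x, E < x < E + e -> 0 < p x * q x) /\ (forall x, E - e < x < E -> p x * q x < 0).
Proof.
  intros H Zq.
  apply (der_sign_pos (fun x => p x * q x) E (Q E)); [|rewrite Zq; ring|apply Qpos].
  eapply der_eq; [apply der_mult; [apply Dp|apply Dq]|cbv beta].
  rewrite Zq. transitivity ((p E * p E) * Q E); [ring|rewrite H; ring].
Qed.

Variables L U : R.
Hypothesis HLU : L < U.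
Hypothesis edgeL : p L * p L = 1.
Hypothesis edgeU : p U * p U = 1.
Hypothesis gap : forall E, L < E < U -> 1 < p E * p E.
Hypothesis simpleL : ~ (q L = 0 /\ r L = 0).
Hypothesis simpleU : ~ (q U = 0 /\ r U = 0).

Lemma gap_prod E : L < E < U -> 0 < (p E * q E) * (p E * r E).
Proof.
  intros HE. assert (H := gap E HE). assert (dt := det E).
  replace ((p E * q E) * (p E * r E)) with ((p E * p E) * (q E * r E)) by ring.
  apply Rmult_lt_0_compat; lra.
Qed.

Lemma inner_point e : 0 < e -> exists x y, (L < x < U /\ L < x < L + e) /\ (L < y < U /\ U - e < y < U).
Proof.
  intros He. assert (0 < Rmin e (U - L)) by (apply Rmin_pos; lra).
  generalize (Rmin_l e (U - L)) (Rmin_r e (U - L)); intros.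
  exists (L + Rmin e (U - L) / 2), (U - Rmin e (U - L) / 2); lra.
Qed.

(** [p r] leaves [L] negative and cannot vanish inside, where [q r > 0]; a zero of [r] at [U] would
    require it to arrive positive. Hence [q] is the entry that vanishes at [U]. *)
Lemma gap_even_intro : r L = 0 -> gap_even p q r L U.
Proof.
  intros Zr.
  destruct (edge_pr L edgeL Zr) as [e [He [A _]]].
  destruct (inner_point e He) as [x [_ [[Hx Hx'] _]]].
  assert (Neg : forall E, L < E < U -> p E * r E < 0).
  { intros E HE. assert (K := const_sign (fun x => - (p x * r x)) L U x E).
    specialize (K (fun z => cont_opp _ _ (cont_mult _ _ _ (Cp z) (Cr z)))).
    assert (Nz : forall z, L < z < U -> - (p z * r z) <> 0).
    { intros z Hz; assert (G := gap_prod z Hz); intros Z. replace (p z * r z) with 0 in G by lra. lra. }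
    specialize (K Nz Hx HE). specialize (A x Hx'). lra. }
  assert (NrU : r U <> 0).
  { intros Zu. destruct (edge_pr U edgeU Zu) as [e' [He' [_ B]]].
    destruct (inner_point e' He') as [_ [y [_ [Hy Hy']]]].
    specialize (B y Hy'). specialize (Neg y Hy). lra. }
  constructor; auto.
  - intros E HE; split; [now apply gap|split; [|now apply Neg]].
    assert (G := gap_prod E HE). assert (N := Neg E HE). nra.
  - assert (dt := det U). assert (Z : q U * r U = 0) by lra. apply Rmult_integral in Z; tauto.
Qed.

Lemma gap_odd_intro : q L = 0 -> gap_odd p q r L U.
Proof.
  intros Zq.
  destruct (edge_pq L edgeL Zq) as [e [He [A _]]].
  destruct (inner_point e He) as [x [_ [[Hx Hx'] _]]].
  assert (Ps : forall E, L < E < U -> 0 < p E * q E).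
  { intros E HE. apply (const_sign (fun x => p x * q x) L U x E); auto.
    - intros z; now apply cont_mult.
    - intros z Hz; assert (G := gap_prod z Hz); intros Z. rewrite Z in G. lra. }
  assert (NqU : q U <> 0).
  { intros Zu. destruct (edge_pq U edgeU Zu) as [e' [He' [_ B]]].
    destruct (inner_point e' He') as [_ [y [_ [Hy Hy']]]].
    specialize (B y Hy'). specialize (Ps y Hy). lra. }
  constructor; auto.
  - intros E HE; split; [now apply gap|split; [now apply Ps|]].
    assert (G := gap_prod E HE). assert (N := Ps E HE). nra.
  - assert (dt := det U). assert (Z : q U * r U = 0) by lra. apply Rmult_integral in Z; tauto.
Qed.

(* AM-GM: in the numerator of (r/q)' the diagonal terms dominate the cross term. *)
Lemma ratio_num E : 1 < p E * p E -> (p E * q E) * (p E * r E) > 0 ->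
  Rabs (2 * (q E * r E) * P E) < Rabs (p E * q E * T E + p E * r E * Q E).
Proof.
  intros H HG. assert (dt := det E). assert (HT := Tpos E). assert (HQ := Qpos E). assert (HP := PTQ E).
  set (x := p E * q E) in *. set (y := p E * r E) in *. set (g := q E * r E) in *.
  assert (Exy : x * y = p E * p E * g) by (unfold x, y, g; ring).
  assert (Hg : 0 < g) by lra.
  apply Rsqr_lt_abs_0. unfold Rsqr.
  assert (HTQ : 0 < T E * Q E) by now apply Rmult_lt_0_compat.
  assert (A1 : 4 * (x * y) * (T E * Q E) <= (x * T E + y * Q E) * (x * T E + y * Q E)).
  { assert (0 <= (x * T E - y * Q E) * (x * T E - y * Q E)) by apply Rle_0_sqr. lra. }
  assert (A2 : g * g * (P E * P E) < g * g * (T E * Q E)) by (apply Rmult_lt_compat_l; auto; now apply Rmult_lt_0_compat).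
  assert (A3 : g * g * (T E * Q E) < (x * y) * (T E * Q E)).
  { apply Rmult_lt_compat_r; auto. rewrite Exy. apply Rmult_lt_compat_r; lra. }
  replace (2 * g * P E * (2 * g * P E)) with (4 * (g * g * (P E * P E))) by ring. lra.
Qed.

Lemma ratio_der E : q E <> 0 -> is_derive (fun x => r x / q x) E
  ((2 * (q E * r E) * P E - (p E * q E * T E + p E * r E * Q E)) / (q E * q E)).
Proof.
  intros Nq; eapply der_eq; [apply der_div; [apply Dr|apply Dq|auto]|field; auto].
Qed.
End Gap.

(** * Crossing of the two ratios *)

Lemma ratio_increasing p q r P Q T L U :
  (forall E, p E * p E - q E * r E = 1) ->
  (forall E, is_derive q E (p E * Q E - q E * P E)) -> (forall E, is_derive r E (r E * P E - p E * T E)) ->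
  (forall E, 0 < T E) -> (forall E, 0 < Q E) -> (forall E, P E * P E < T E * Q E) ->
  gap_even p q r L U -> forall E, L < E < U -> exists d, is_derive (fun x => r x / q x) E d /\ 0 < d.
Proof.
  intros det Dq Dr HT HQ HP G E HE. destruct (ge_in _ _ _ _ _ G E HE) as [H1 [H2 H3]].
  assert (Nq : q E <> 0) by (intros Z; rewrite Z in H2; lra).
  eexists; split; [now apply (ratio_der p q r P Q T Dq Dr)|].
  assert (N := ratio_num p q r P Q T det HT HQ HP E H1 ltac:(nra)).
  apply Rdiv_lt_0_compat; [|assert (0 <= q E * q E) by apply Rle_0_sqr; assert (q E * q E <> 0) by (intros Z; apply Rmult_integral in Z; tauto); lra].
  assert (A : p E * q E * T E < 0) by (assert (0 < - (p E * q E) * T E) by (apply Rmult_lt_0_compat; auto; lra); lra).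
  assert (B : p E * r E * Q E < 0) by (assert (0 < - (p E * r E) * Q E) by (apply Rmult_lt_0_compat; auto; lra); lra).
  rewrite (Rabs_left (_ + _)) in N by lra. apply Rabs_lt_between in N; lra.
Qed.

Lemma ratio_decreasing p q r P Q T L U :
  (forall E, p E * p E - q E * r E = 1) ->
  (forall E, is_derive q E (p E * Q E - q E * P E)) -> (forall E, is_derive r E (r E * P E - p E * T E)) ->
  (forall E, 0 < T E) -> (forall E, 0 < Q E) -> (forall E, P E * P E < T E * Q E) ->
  gap_odd p q r L U -> forall E, L < E < U -> exists d, is_derive (fun x => r x / q x) E d /\ d < 0.
Proof.
  intros det Dq Dr HT HQ HP G E HE. destruct (go_in _ _ _ _ _ G E HE) as [H1 [H2 H3]].
  assert (Nq : q E <> 0) by (intros Z; rewrite Z in H2; lra).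
  eexists; split; [now apply (ratio_der p q r P Q T Dq Dr)|].
  assert (N := ratio_num p q r P Q T det HT HQ HP E H1 ltac:(nra)).
  assert (Hqq : 0 < q E * q E) by (assert (0 <= q E * q E) by apply Rle_0_sqr; assert (q E * q E <> 0) by (intros Z; apply Rmult_integral in Z; tauto); lra).
  assert (A : 0 < p E * q E * T E) by (apply Rmult_lt_0_compat; auto).
  assert (B : 0 < p E * r E * Q E) by (apply Rmult_lt_0_compat; auto).
  rewrite (Rabs_right (_ + _)) in N by lra. apply Rabs_lt_between in N.
  assert (K : 0 < (p E * q E * T E + p E * r E * Q E - 2 * (q E * r E) * P E) / (q E * q E)) by (apply Rdiv_lt_0_compat; lra).
  unfold Rdiv in *; lra.
Qed.

Lemma match_unique (f g : R -> R) a b E E' :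
  (forall x, a < x < b -> exists d, is_derive f x d /\ 0 < d) ->
  (forall x, a < x < b -> exists d, is_derive g x d /\ d < 0) ->
  a < E < b -> a < E' < b -> f E = g E -> f E' = g E' -> E = E'.
Proof.
  intros Hf Hg. 
  assert (Aux : forall E E', a < E < b -> a < E' < b -> E < E' -> f E = g E -> f E' = g E' -> False).
  { clear E E'; intros E E' HE HE' L H H'.
    destruct (MVT_cor2 (fun x => f x - g x) (fun x => Derive f x - Derive g x) E E' L) as [c [Hc1 Hc2]].
    - intros c Hc. destruct (Hf c ltac:(lra)) as [d [D _]], (Hg c ltac:(lra)) as [d' [D' _]].
      rewrite (is_derive_unique _ _ _ D), (is_derive_unique _ _ _ D').
      apply is_derive_Reals. now apply der_minus.
    - destruct (Hf c ltac:(lra)) as [d [D Pd]], (Hg c ltac:(lra)) as [d' [D' Pd']].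
      rewrite (is_derive_unique _ _ _ D), (is_derive_unique _ _ _ D') in Hc1.
      rewrite H, H' in Hc1.
      assert (0 < (d - d') * (E' - E)) by (apply Rmult_lt_0_compat; lra). lra. }
  intros HE HE' H H'. destruct (Rtotal_order E E') as [L|[L|L]]; auto; exfalso.
  - now apply (Aux E E').
  - now apply (Aux E' E).
Qed.

Lemma Rabs_eq_same_sign a b : Rabs a = Rabs b -> 0 < a * b -> a = b.
Proof.
  intros H P; unfold Rabs in H; destruct (Rcase_abs a), (Rcase_abs b); try lra; exfalso; nra.
Qed.

Lemma Rmult_pos_factor a b c : 0 < (a * b) * (a * c) -> 0 < b * c.
Proof.
  intros H. replace (a * b * (a * c)) with (a * a * (b * c)) in H by ring.
  assert (0 <= a * a) by apply Rle_0_sqr. nra.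
Qed.

(** The ratios blow up at some gap edges, so the intermediate value theorem is applied to the
    cross-multiplied difference; absolute values remove the unknown signs of the factors. *)
Lemma match_exists p q r p' q' r' L U L' U' :
  (forall x, continuous q x) -> (forall x, continuous r x) -> (forall x, continuous q' x) -> (forall x, continuous r' x) ->
  gap_even p q r L U -> gap_odd p' q' r' L' U' -> L < U -> L' < U' ->
  (exists E, (L < E < U) /\ (L' < E < U')) ->
  exists E, (L < E < U) /\ (L' < E < U') /\ r E / q E = r' E / q' E.
Proof.
  intros Cq Cr Cq' Cr' G G' HLU HLU' [E0 HE0].
  assert (N1 : forall x, L <= x < U -> q x <> 0).
  { intros x [[Hx| <-] Hx']; [|apply G]. destruct (ge_in _ _ _ _ _ G x ltac:(lra)) as [_ [K _]]; intros Z; rewrite Z in K; lra. }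
  assert (N2 : forall x, L < x <= U -> r x <> 0).
  { intros x [Hx' [Hx| ->]]; [|apply G]. destruct (ge_in _ _ _ _ _ G x ltac:(lra)) as [_ [_ K]]; intros Z; rewrite Z in K; lra. }
  assert (N3 : forall x, L' <= x < U' -> r' x <> 0).
  { intros x [[Hx| <-] Hx']; [|apply G']. destruct (go_in _ _ _ _ _ G' x ltac:(lra)) as [_ [_ K]]; intros Z; rewrite Z in K; lra. }
  assert (N4 : forall x, L' < x <= U' -> q' x <> 0).
  { intros x [Hx' [Hx| ->]]; [|apply G']. destruct (go_in _ _ _ _ _ G' x ltac:(lra)) as [_ [K _]]; intros Z; rewrite Z in K; lra. }
  set (F := fun x => Rabs (r x * q' x) - Rabs (r' x * q x)).
  assert (CF : continuity F).
  { intros x; apply continuity_pt_filterlim. apply cont_minus.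
    - apply (cont_comp (fun x => r x * q' x) Rabs); [now apply cont_mult|apply continuous_Rabs].
    - apply (cont_comp (fun x => r' x * q x) Rabs); [now apply cont_mult|apply continuous_Rabs]. }
  set (A := Rmax L L'). set (B := Rmin U U').
  assert (HA : L <= A /\ L' <= A /\ (A = L \/ A = L')) by (unfold A, Rmax; destruct (Rle_dec L L'); lra).
  assert (HB : B <= U /\ B <= U' /\ (B = U \/ B = U')) by (unfold B, Rmin; destruct (Rle_dec U U'); lra).
  assert (HAB : A < B) by (unfold A, B; apply Rlt_trans with E0; [apply Rmax_lub_lt; lra|apply Rmin_glb_lt; lra]).
  destruct HA as [A1 [A2 A3]], HB as [B1 [B2 B3]].
  (* At the lower end of the common gap [r] or [q'] vanishes, depending on which gap begins there,
     while [r' q] does not. The upper end is symmetric. *)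
  assert (FA : F A < 0).
  { unfold F. assert (K : 0 < Rabs (r' A * q A)) by (apply Rabs_pos_lt, Rmult_integral_contrapositive_currified; [apply N3|apply N1]; lra).
    assert (Z : r A * q' A = 0) by (destruct A3 as [-> | ->]; [rewrite (ge_rL _ _ _ _ _ G)|rewrite (go_qL _ _ _ _ _ G')]; ring).
    rewrite Z, Rabs_R0; lra. }
  assert (FB : 0 < F B).
  { unfold F. assert (K : 0 < Rabs (r B * q' B)) by (apply Rabs_pos_lt, Rmult_integral_contrapositive_currified; [apply N2|apply N4]; lra).
    assert (Z : r' B * q B = 0) by (destruct B3 as [-> | ->]; [rewrite (ge_qU _ _ _ _ _ G)|rewrite (go_rU _ _ _ _ _ G')]; ring).
    rewrite Z, Rabs_R0; lra. }
  destruct (IVT_gen F A B 0 CF) as [E [HE FE]].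
  { rewrite Rmin_left, Rmax_right by lra; lra. }
  rewrite Rmin_left, Rmax_right in HE by lra.
  assert (E <> A) by (intros ->; lra). assert (E <> B) by (intros ->; lra).
  exists E; split; [lra|split; [lra|]].
  destruct (ge_in _ _ _ _ _ G E ltac:(lra)) as [P1 [P2 P3]], (go_in _ _ _ _ _ G' E ltac:(lra)) as [P1' [P2' P3']].
  assert (Nq := N1 E ltac:(lra)). assert (Nq' := N4 E ltac:(lra)).
  assert (Eq : r E * q' E = r' E * q E).
  { assert (S1 : 0 < q E * r E).
    { apply (Rmult_pos_factor (p E)). rewrite <- Rmult_opp_opp. apply Rmult_lt_0_compat; lra. }
    assert (S2 : 0 < q' E * r' E).
    { apply (Rmult_pos_factor (p' E)). apply Rmult_lt_0_compat; lra. }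
    assert (S3 : 0 < (r E * q' E) * (r' E * q E)).
    { replace ((r E * q' E) * (r' E * q E)) with ((q E * r E) * (q' E * r' E)) by ring. now apply Rmult_lt_0_compat. }
    assert (Ab : Rabs (r E * q' E) = Rabs (r' E * q E)) by (unfold F in FE; lra).
    now apply Rabs_eq_same_sign. }
  apply (Rmult_eq_reg_r (q E * q' E)); [|now apply Rmult_integral_contrapositive_currified].
  transitivity (r E * q' E); [field; auto|rewrite Eq; field; auto].
Qed.

(** * Decaying solutions *)

(** The decaying Floquet multiplier, [p - sqrt (p^2 - 1)] when [p > 1]; the other one is [1 / l].
    The sign of [(l - p) p] will fix the slope of the decaying solution. *)
Lemma multiplier_exists p : 1 < p * p -> exists l, l * l - 2 * p * l + 1 = 0 /\ l * l < 1 /\ (l - p) * p < 0.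
Proof.
  assert (Pos : forall p, 1 < p -> exists l, l * l - 2 * p * l + 1 = 0 /\ l * l < 1 /\ (l - p) * p < 0).
  { clear p; intros p Hp. assert (Hs : 0 < p * p - 1) by nra.
    assert (S0 := sqrt_lt_R0 _ Hs). assert (S := sqrt_sqrt (p * p - 1) ltac:(lra)).
    set (s := sqrt (p * p - 1)) in *. exists (p - s).
    assert (Hl : p - 1 < s) by (apply Rnot_le_lt; intros K; nra).
    assert (Hu : s < p) by (apply Rnot_le_lt; intros K; nra).
    split; [|split]; nra. }
  intros H. destruct (Rlt_dec 1 p) as [|N]; [now apply Pos|].
  destruct (Pos (- p)) as [l [H1 [H2 H3]]]; [apply Rnot_le_lt; intros K; nra|].
  exists (- l); split; [lra|split; lra].
Qed.

Section Decay.
Variables eps mu : R -> R.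
Hypothesis Aeps : admissible_coef eps.
Hypothesis Amu : admissible_coef mu.
Notation p := (pp eps mu).
Notation q := (qq eps mu).
Notation r := (rr eps mu).

Lemma multiplier_shift E l u w : nsol eps mu E u w ->
  u 0 * p E + w 0 * q E = l * u 0 -> u 0 * r E + w 0 * p E = l * w 0 ->
  forall x, u (x + 1) = l * u x /\ w (x + 1) = l * w x.
Proof.
  intros H H1 H2 x.
  destruct (nsol_next eps mu Aeps Amu E u w H) as [N1 N2].
  assert (Z := nsol_lin eps mu E _ _ _ _ l 0 H H).
  destruct (nsol_unique eps mu (proj1 (proj2 Aeps)) (proj1 (proj2 Amu)) E _ _ _ _ 0 (nsol_shift eps mu Aeps Amu E u w H) Z) with (x := x) as [K1 K2].
  - rewrite Rplus_0_l, N1, H1; ring.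
  - rewrite Rplus_0_l, N2, H2; ring.
  - cbv beta in K1, K2. split; lra.
Qed.

(* [chi] is the component along the growing Floquet multiplier 1/l. *)
Lemma decaying_direction E l u w : nsol eps mu E u w -> l * l - 2 * p E * l + 1 = 0 -> l * l < 1 ->
  (forall e, 0 < e -> exists N, forall n, (N <= n)%nat -> RInt (fun x => u (x + INR n) * u (x + INR n)) 0 1 < e) ->
  u 0 * p E + w 0 * q E = l * u 0 /\ u 0 * r E + w 0 * p E = l * w 0.
Proof.
  intros H Hl Hl1 Hdec.
  destruct (nsol_next eps mu Aeps Amu E u w H) as [N1 N2].
  assert (dt := pq_det eps mu Aeps Amu E).
  set (chi := fun x => 1 * u (x + 1) + - l * u x). set (chw := fun x => 1 * w (x + 1) + - l * w x).
  assert (Hc : nsol eps mu E chi chw) by (apply nsol_lin; auto; now apply nsol_shift).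
  assert (C0 : chi 0 = u 0 * p E + w 0 * q E - l * u 0) by (unfold chi; rewrite Rplus_0_l, N1; ring).
  assert (W0 : chw 0 = u 0 * r E + w 0 * p E - l * w 0) by (unfold chw; rewrite Rplus_0_l, N2; ring).
  (* Cayley-Hamilton: the monodromy matrix minus [l] maps into the eigenspace of the other
     multiplier [1 / l]. *)
  assert (Sh : forall x, chi x = l * chi (x + 1)).
  { intros x.
    assert (Z := nsol_lin eps mu E _ _ _ _ l 0 (nsol_shift eps mu Aeps Amu E _ _ Hc) Hc).
    destruct (nsol_next eps mu Aeps Amu E _ _ Hc) as [M1 M2].
    destruct (nsol_unique eps mu (proj1 (proj2 Aeps)) (proj1 (proj2 Amu)) E _ _ _ _ 0 Hc Z) with (x := x) as [K1 _].
    - rewrite Rplus_0_l, M1, C0, W0.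
      replace (l * ((u 0 * p E + w 0 * q E - l * u 0) * p E + (u 0 * r E + w 0 * p E - l * w 0) * q E) + 0 * (u 0 * p E + w 0 * q E - l * u 0))
        with ((- (l * l - 2 * p E * l + 1) + 1) * (u 0 * p E + w 0 * q E) - l * u 0 * (p E * p E - q E * r E)) by ring.
      rewrite Hl, dt; ring.
    - rewrite Rplus_0_l, M2, C0, W0.
      replace (l * ((u 0 * p E + w 0 * q E - l * u 0) * r E + (u 0 * r E + w 0 * p E - l * w 0) * p E) + 0 * (u 0 * r E + w 0 * p E - l * w 0))
        with ((- (l * l - 2 * p E * l + 1) + 1) * (u 0 * r E + w 0 * p E) - l * w 0 * (p E * p E - q E * r E)) by ring.
      rewrite Hl, dt; ring.
    - cbv beta in K1. lra. }
  (* Hence [chi^2] does not decrease along integer translates, while the integrals of [u^2] become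
     small far out. *)
  assert (Shn : forall n x, chi x * chi x <= chi (x + INR n) * chi (x + INR n)).
  { induction n as [|n IH]; intros x; [simpl; rewrite Rplus_0_r; lra|].
    eapply Rle_trans; [apply IH|]. rewrite (Sh (x + INR n)), S_INR, <- Rplus_assoc.
    set (c := chi (x + INR n + 1)). assert (0 <= c * c) by apply Rle_0_sqr.
    assert (l * l * (c * c) <= 1 * (c * c)) by (apply Rmult_le_compat_r; lra). lra. }
  assert (Cu : forall x, continuous u x) by apply H.
  assert (Cc : forall x, continuous chi x) by apply Hc.
  assert (Csh : forall (f : R -> R) c, (forall x, continuous f x) -> forall x, continuous (fun x => f (x + c)) x).
  { intros f c Cf x; apply (cont_comp (fun x => x + c) f); auto. apply cont_plus; [apply cont_id|apply cont_const]. }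
  assert (Isq : forall f : R -> R, (forall x, continuous f x) -> ex_RInt (fun x => f x * f x) 0 1).
  { intros f Cf; apply pwc_ex_RInt, pwc_cont; intros; now apply cont_mult. }
  assert (Small : ~ 0 < RInt (fun x => 1 * (chi x * chi x)) 0 1).
  { intros Pos. set (e := RInt (fun x => 1 * (chi x * chi x)) 0 1) in *.
    (* Since [l^2 < 1], [chi^2] at [x + N] is at most twice the sum of [u^2] at [x + N + 1] and at
       [x + N]; two unit integrals below [e / 8] give less than [e / 2]. *)
    destruct (Hdec (e / 8) ltac:(lra)) as [N HN].
    assert (B1 := HN N (Nat.le_refl N)). assert (B2 := HN (S N) (Nat.le_succ_diag_r N)).
    assert (Bd : e <= RInt (fun x => 2 * (u (x + INR (S N)) * u (x + INR (S N))) + 2 * (u (x + INR N) * u (x + INR N))) 0 1).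
    { apply RInt_le; [lra| | |].
      - apply (ex_RInt_scal (V := R_CompleteNormedModule) (fun x => chi x * chi x) 0 1 1). now apply Isq.
      - apply (ex_RInt_plus (V := R_CompleteNormedModule)); apply (ex_RInt_scal (V := R_CompleteNormedModule)), (Isq (fun x => u (x + _))), Csh; auto.
      - intros x _. rewrite Rmult_1_l. eapply Rle_trans; [apply (Shn N)|]. unfold chi.
        rewrite S_INR, <- Rplus_assoc. set (a := u (x + INR N + 1)). set (b := u (x + INR N)).
        assert (0 <= (a + l * b) * (a + l * b)) by apply Rle_0_sqr.
        assert (0 <= b * b) by apply Rle_0_sqr.
        assert (l * l * (b * b) <= 1 * (b * b)) by (apply Rmult_le_compat_r; lra). lra. }
    assert (Eq : RInt (fun x => 2 * (u (x + INR (S N)) * u (x + INR (S N))) + 2 * (u (x + INR N) * u (x + INR N))) 0 1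
       = 2 * RInt (fun x => u (x + INR (S N)) * u (x + INR (S N))) 0 1 + 2 * RInt (fun x => u (x + INR N) * u (x + INR N)) 0 1).
    { assert (Sc : forall c, RInt (fun x => 2 * (u (x + c) * u (x + c))) 0 1 = 2 * RInt (fun x => u (x + c) * u (x + c)) 0 1)
        by (intros c; apply (RInt_scal (V := R_CompleteNormedModule) (fun x => u (x + c) * u (x + c)) 0 1 2), (Isq (fun x => u (x + c))), Csh; auto).
      rewrite <- !Sc.
      apply (RInt_plus (V := R_CompleteNormedModule)); apply (ex_RInt_scal (V := R_CompleteNormedModule)), (Isq (fun x => u (x + _))), Csh; auto. }
    rewrite Eq in Bd; lra. }
  destruct (classic (chi 0 <> 0 \/ chw 0 <> 0)) as [Nz|Z].
  - exfalso; apply Small. apply (weighted_pos eps mu Aeps Amu E chi chw (fun _ => 1)); auto; [apply pwc_const|intros; lra].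
  - assert (Z1 : chi 0 = 0) by (apply NNPP; tauto). assert (Z2 : chw 0 = 0) by (apply NNPP; tauto). lra.
Qed.
End Decay.

(** The primitive satisfies [F (x + 1) = F 1 + c F x], so it stays below the fixed point
    [F 1 / (1 - c)]; being monotone, it converges. *)
Lemma geometric_tail_integrable (g : R -> R) c : (forall x, continuous g x) -> (forall x, 0 <= g x) -> 0 <= c < 1 ->
  (forall x, 0 <= x -> g (x + 1) = c * g x) ->
  exists l, forall e, 0 < e -> exists B, 0 < B /\ forall b, B < b -> Rabs (RInt g 0 b - l) < e.
Proof.
  intros Cg Pg Hc Hs.
  set (F := fun b => RInt g 0 b).
  assert (Pw : piecewise_continuous g) by now apply pwc_cont.
  assert (Tr : off_finite (fun _ => True)) by (intros a b; exists nil; auto).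
  assert (DF : forall x, is_derive F x (g x)) by (intros; now apply (prim_derive g 0 x)).
  assert (CF : forall x, continuous F x) by (intros; eapply cont_derive, DF).
  assert (F0 : F 0 = 0) by apply (RInt_point (V := R_CompleteNormedModule)).
  assert (Mono : forall a b, a <= b -> F a <= F b).
  { intros a b Hab; apply (off_mono _ Tr F); auto; intros x _ _; exists (g x); auto. }
  assert (Rec : forall x, 0 <= x -> F (x + 1) = F 1 + c * F x).
  { intros x Hx.
    assert (K : F (x + 1) - c * F x = F (0 + 1) - c * F 0).
    { apply (off_const _ Tr (fun x => F (x + 1) - c * F x)); auto.
      - intros y; apply cont_minus; [apply (cont_comp (fun y => y + 1) F); auto; apply cont_plus; [apply cont_id|apply cont_const]|].
        apply cont_mult; auto; apply cont_const.
      - intros y Hy _; eapply der_eq.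
        + apply der_minus; [apply (der_comp (fun y => y + 1) F); [apply der_plus; [apply der_id|apply der_const]|apply DF]|apply der_scal, DF].
        + cbv beta. rewrite Hs by lra. ring. }
    rewrite F0, Rplus_0_l in K; lra. }
  assert (F1 : 0 <= F 1) by (rewrite <- F0; apply Mono; lra).
  set (M := F 1 / (1 - c)).
  assert (HM : F 1 + c * M = M) by (unfold M; field; lra).
  assert (M0 : 0 <= M) by (unfold M; apply Rmult_le_pos; [auto|left; apply Rinv_0_lt_compat; lra]).
  assert (Bn : forall n, F (INR n) <= M).
  { induction n as [|n IH]; [simpl; rewrite F0; auto|].
    rewrite S_INR, Rec by apply pos_INR. assert (c * F (INR n) <= c * M) by (apply Rmult_le_compat_l; lra). lra. }
  assert (Bb : forall b, F b <= M).
  { intros b; destruct (nfloor_ex (Rabs b) (Rabs_pos b)) as [n [_ Hn]].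
    apply Rle_trans with (F (INR (S n))); auto. apply Mono; rewrite S_INR; generalize (Rle_abs b); lra. }
  destruct (completeness (fun y => exists b, y = F b)) as [l [Ub Lub]].
  { exists M; intros y [b ->]; auto. }
  { exists (F 0); now exists 0. }
  exists l; intros e He.
  destruct (classic (exists b, l - e < F b)) as [[b Hb]|N].
  - exists (Rmax b 1); split; [generalize (Rmax_r b 1); lra|]; intros b' Hb'.
    assert (F b <= F b') by (apply Mono; generalize (Rmax_l b 1); lra).
    assert (F b' <= l) by (apply Ub; now exists b').
    fold (F b'); apply Rabs_lt_between; lra.
  - exfalso; assert (l <= l - e); [|lra]. apply Lub; intros y [b ->].
    destruct (Rle_dec (F b) (l - e)); auto; exfalso; apply N; exists b; lra.
Qed.

Lemma two_sided_integrable (g : R -> R) c c' : (forall x, continuous g x) -> (forall x, 0 <= g x) ->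
  0 <= c < 1 -> 0 <= c' < 1 ->
  (forall x, 0 <= x -> g (x + 1) = c * g x) -> (forall x, 0 <= x -> g (- (x + 1)) = c' * g (- x)) ->
  ex_RInt_gen g (Rbar_locally m_infty) (Rbar_locally p_infty).
Proof.
  intros Cg Pg Hc Hc' H H'.
  assert (Cg' : forall x, continuous (fun x => g (- x)) x) by (intros; apply (cont_comp Ropp g); auto; apply cont_opp, cont_id).
  destruct (geometric_tail_integrable g c) as [l Hl]; auto.
  destruct (geometric_tail_integrable (fun x => g (- x)) c') as [l' Hl']; auto.
  exists (l + l'). intros P [e HP].
  assert (He : 0 < e / 2) by (generalize (cond_pos e); lra).
  destruct (Hl _ He) as [B [HB0 HB]], (Hl' _ He) as [B' [HB0' HB']].
  unfold filtermapi. apply (Filter_prod _ _ _ (fun a => a < - B') (fun b => B < b)).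
  - exists (- B'); auto.
  - exists B; auto.
  - intros a b Ha Hb. simpl. exists (RInt g a b). 
    assert (Ex : forall a b, ex_RInt g a b) by (intros; apply pwc_ex_RInt, pwc_cont; auto).
    split; [now apply (@RInt_correct R_CompleteNormedModule)|].
    apply HP. change (Rabs (RInt g a b - (l + l')) < e).
    assert (Ch : RInt g a 0 + RInt g 0 b = RInt g a b) by (apply (RInt_Chasles (V := R_CompleteNormedModule)); auto).
    assert (Op : RInt (fun x => g (- x)) 0 (- a) = RInt g a 0).
    { assert (Tr : off_finite (fun _ => True)) by (intros s t; exists nil; auto).
      rewrite (RInt_FTC (fun x => - RInt g 0 (- x)) (fun x => g (- x)) _ 0 (- a) ltac:(lra) Tr).
      - rewrite Ropp_involutive, Ropp_0, (RInt_point (V := R_CompleteNormedModule)).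
        change (@zero R_CompleteNormedModule) with 0.
        rewrite <- (opp_RInt_swap (V := R_CompleteNormedModule) g 0 a) by auto.
        change (- RInt g 0 a - - 0 = - RInt g 0 a); ring.
      - now apply pwc_cont.
      - intros x; apply cont_opp, (cont_comp Ropp (fun y => RInt g 0 y)); [apply cont_opp, cont_id|apply prim_cont, pwc_cont; auto].
      - intros x _ _; eapply der_eq.
        + apply der_opp, (der_comp Ropp (fun y => RInt g 0 y)); [apply der_opp, der_id|].
          apply (prim_derive g 0 (- x)); [apply pwc_cont; auto|auto].
        + ring. }
    assert (K1 := HB b Hb). assert (K2 := HB' (- a) ltac:(lra)).
    rewrite Op in K2. rewrite <- Ch.
    replace (RInt g a 0 + RInt g 0 b - (l + l')) with ((RInt g 0 b - l) + (RInt g a 0 - l')) by ring.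
    eapply Rle_lt_trans; [apply Rabs_triang|]. lra.
Qed.

(** Cauchy's criterion: the integral over a far unit interval is the difference of two long
    integrals close to the limit. [is_RInt] is the form in which the generalized integral supplies
    these values. *)
Lemma L2_tails (f : R -> R) : ex_RInt_gen f (Rbar_locally m_infty) (Rbar_locally p_infty) ->
  forall e, 0 < e -> exists N, forall n, (N <= n)%nat ->
    (exists z, is_RInt f (INR n) (INR n + 1) z /\ Rabs z < e) /\
    (exists z, is_RInt f (- (INR n + 1)) (- INR n) z /\ Rabs z < e).
Proof.
  intros [l Hl] e He.
  assert (P2 : 0 < e / 2) by lra.
  destruct (Hl _ (locally_ball l (mkposreal _ P2))) as [Q1 Q2 [A HA] [B HB] H]. simpl in H.
  destruct (nfloor_ex (Rabs A + Rabs B)) as [N [_ HN]]; [generalize (Rabs_pos A) (Rabs_pos B); lra|].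
  exists (S N); intros n Hn. apply le_INR in Hn; rewrite S_INR in Hn.
  assert (LA := Rle_abs (- A)). assert (LB := Rle_abs B). rewrite Rabs_Ropp in LA.
  assert (PA := Rabs_pos A). assert (PB := Rabs_pos B).
  assert (Comb : forall z1 z2, ball l (e / 2) z1 -> ball l (e / 2) z2 -> Rabs (z2 - z1) < e).
  { intros z1 z2 H1 H2. change (Rabs (z1 - l) < e / 2) in H1. change (Rabs (z2 - l) < e / 2) in H2.
    apply Rabs_lt_between in H1; apply Rabs_lt_between in H2; apply Rabs_lt_between; lra. }
  split.
  - destruct (H (A - 1) (INR n) (HA (A - 1) ltac:(lra)) (HB (INR n) ltac:(lra))) as [z1 [I1 B1]].
    destruct (H (A - 1) (INR n + 1) (HA (A - 1) ltac:(lra)) (HB (INR n + 1) ltac:(lra))) as [z2 [I2 B2]].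
    simpl in I1, I2. exists (z2 - z1); split; [|now apply Comb].
    replace (z2 - z1) with (plus (opp z1) z2) by (change (- z1 + z2 = z2 - z1); ring).
    apply (is_RInt_Chasles f (INR n) (A - 1) (INR n + 1)); auto. now apply (is_RInt_swap f).
  - destruct (H (- INR n) (B + 1) (HA (- INR n) ltac:(lra)) (HB (B + 1) ltac:(lra))) as [z1 [I1 B1]].
    destruct (H (- (INR n + 1)) (B + 1) (HA (- (INR n + 1)) ltac:(lra)) (HB (B + 1) ltac:(lra))) as [z2 [I2 B2]].
    simpl in I1, I2. exists (z2 - z1); split; [|now apply Comb].
    change (is_RInt f (- (INR n + 1)) (- INR n) (plus z2 (opp z1))).
    apply (is_RInt_Chasles f (- (INR n + 1)) (B + 1) (- INR n)); auto. now apply (is_RInt_swap f).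
Qed.

(** * Interface modes *)

Lemma Cmod_sqr (z : C) : Cmod z ^ 2 = fst z * fst z + snd z * snd z.
Proof. unfold Cmod; rewrite pow2_sqrt; [ring|nra]. Qed.

Lemma glue_cont (f g : R -> R) : (forall x, continuous f x) -> (forall x, continuous g x) -> f 0 = g 0 ->
  forall x, continuous (glue f g) x.
Proof.
  intros Cf Cg H0 x.
  (* A formula without case distinction, from which continuity is immediate. *)
  assert (E : forall y, glue f g y = f (Rmin y 0) + g (Rmax y 0) - g 0).
  { intros y; unfold glue; destruct (Rlt_dec y 0).
    - rewrite Rmin_left, Rmax_right by lra; lra.
    - rewrite Rmin_right, Rmax_left by lra; lra. }
  apply (continuous_ext (fun y => f (Rmin y 0) + g (Rmax y 0) - g 0)); [intros; now rewrite E|].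
  assert (Cmin : forall y, continuous (fun y => Rmin y 0) y).
  { intros y; apply (cont_lip _ y 1); intros z _; unfold Rmin; destruct (Rle_dec z 0), (Rle_dec y 0);
    unfold Rabs; repeat destruct Rcase_abs; lra. }
  assert (Cmax : forall y, continuous (fun y => Rmax y 0) y).
  { intros y; apply (cont_lip _ y 1); intros z _; unfold Rmax; destruct (Rle_dec z 0), (Rle_dec y 0);
    unfold Rabs; repeat destruct Rcase_abs; lra. }
  apply cont_minus; [apply cont_plus|apply cont_const].
  - apply (cont_comp (fun y => Rmin y 0) f); auto.
  - apply (cont_comp (fun y => Rmax y 0) g); auto.
Qed.

Lemma glue_lip (f g : R -> R) a b : lip a b f -> lip a b g -> f 0 = g 0 -> lip a b (glue f g).
Proof.
  intros [K [HK Kf]] [K' [HK' Kg]] H0; exists (K + K'); split; [lra|]; intros x y Hx Hxy Hy.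
  assert (Mf : forall x y, a <= x -> x <= y -> y <= b -> Rabs (f y - f x) <= (K + K') * (y - x)).
  { intros s t H1 H2 H3; eapply Rle_trans; [now apply Kf|]. apply Rmult_le_compat_r; lra. }
  assert (Mg : forall x y, a <= x -> x <= y -> y <= b -> Rabs (g y - g x) <= (K + K') * (y - x)).
  { intros s t H1 H2 H3; eapply Rle_trans; [now apply Kg|]. apply Rmult_le_compat_r; lra. }
  unfold glue; destruct (Rlt_dec x 0), (Rlt_dec y 0); auto; try lra.
  replace (g y - f x) with ((g y - g 0) + (f 0 - f x)) by (rewrite H0; ring).
  eapply Rle_trans; [apply Rabs_triang|].
  assert (A := Mf x 0 ltac:(lra) ltac:(lra) ltac:(lra)). assert (B := Mg 0 y ltac:(lra) ltac:(lra) ltac:(lra)). lra.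
Qed.

Lemma glue_neg_loc (f g : R -> R) x : x < 0 -> locally x (fun y => f y = glue f g y).
Proof.
  intros Hx. assert (P : 0 < - x) by lra. exists (mkposreal _ P); intros y Hy.
  change (Rabs (y - x) < - x) in Hy. apply Rabs_lt_between in Hy.
  unfold glue; destruct (Rlt_dec y 0); auto; lra.
Qed.

Lemma glue_pos_loc (f g : R -> R) x : 0 < x -> locally x (fun y => g y = glue f g y).
Proof.
  intros Hx. exists (mkposreal _ Hx); intros y Hy.
  change (Rabs (y - x) < x) in Hy. apply Rabs_lt_between in Hy.
  unfold glue; destruct (Rlt_dec y 0); auto; lra.
Qed.

Section HalfLine.
Variables eps mu : R -> R.
Hypothesis Aeps : admissible_coef eps.
Hypothesis Amu : admissible_coef mu.
Notation p := (pp eps mu).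
Notation q := (qq eps mu).
Notation r := (rr eps mu).

(** [F] will be the squared modulus of a mode, which dominates the square of each of its real
    components. *)
Lemma square_integrable_direction E l u w (F : R -> R) : nsol eps mu E u w ->
  l * l - 2 * p E * l + 1 = 0 -> l * l < 1 ->
  (forall x, 0 <= x -> u x * u x <= F x) ->
  (forall e, 0 < e -> exists N, forall n, (N <= n)%nat -> exists z, is_RInt F (INR n) (INR n + 1) z /\ Rabs z < e) ->
  u 0 * p E + w 0 * q E = l * u 0 /\ u 0 * r E + w 0 * p E = l * w 0.
Proof.
  intros H Hl Hl1 HF Ht. apply (decaying_direction eps mu Aeps Amu E l u w H Hl Hl1).
  intros e He; destruct (Ht e He) as [N HN]; exists N; intros n Hn.
  destruct (HN n Hn) as [z [Iz Bz]].
  assert (Cu : forall x, continuous u x) by apply H.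
  assert (Pu : piecewise_continuous (fun x => u x * u x)) by (apply pwc_cont; intros; now apply cont_mult).
  assert (Pn := pos_INR n).
  assert (Le : RInt (fun x => u x * u x) (INR n) (INR n + 1) <= z).
  { apply (is_RInt_le (fun x => u x * u x) F (INR n) (INR n + 1)); auto; [lra| |intros; apply HF; lra].
    apply (@RInt_correct R_CompleteNormedModule). now apply pwc_ex_RInt. }
  assert (Sh : RInt (fun x => u (x + INR n) * u (x + INR n)) 0 1 = RInt (fun x => u x * u x) (INR n) (INR n + 1)).
  { assert (Tr : off_finite (fun _ => True)) by (intros s t; exists nil; auto).
    set (h := fun x => RInt (fun x => u x * u x) (INR n) (x + INR n)).
    rewrite (RInt_FTC h (fun x => u (x + INR n) * u (x + INR n)) _ 0 1 Rle_0_1 Tr).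
    - assert (Z : RInt (fun x => u x * u x) (INR n) (INR n) = 0) by apply (RInt_point (V := R_CompleteNormedModule)).
      unfold h. rewrite Rplus_0_l, Z, (Rplus_comm 1). apply Rminus_0_r.
    - apply pwc_cont; intros x; apply (cont_comp (fun x => x + INR n) (fun x => u x * u x)); [|now apply cont_mult].
      apply cont_plus; [apply cont_id|apply cont_const].
    - intros x; apply (cont_comp (fun x => x + INR n) (fun y => RInt (fun x => u x * u x) (INR n) y)); [|now apply prim_cont].
      apply cont_plus; [apply cont_id|apply cont_const].
    - intros x _ _; eapply der_eq.
      + apply (der_comp (fun x => x + INR n) (fun y => RInt (fun x => u x * u x) (INR n) y)).
        * apply der_plus; [apply der_id|apply der_const].
        * apply (prim_derive (fun x => u x * u x) (INR n) (x + INR n) Pu). now apply cont_mult.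
      + cbv beta; ring. }
  rewrite Sh. generalize (Rle_abs z); lra.
Qed.
End HalfLine.

Section Glued.
Variables eps1 mu1 eps2 mu2 : R -> R.
Hypothesis Aeps1 : admissible_coef eps1.
Hypothesis Amu1 : admissible_coef mu1.
Hypothesis Aeps2 : admissible_coef eps2.
Hypothesis Amu2 : admissible_coef mu2.
Notation p1 := (pp eps1 mu1).
Notation q1 := (qq eps1 mu1).
Notation r1 := (rr eps1 mu1).
Notation p2 := (pp eps2 mu2).
Notation q2 := (qq eps2 mu2).
Notation r2 := (rr eps2 mu2).
Variable E : R.
Hypothesis Hp1 : 1 < p1 E * p1 E.
Hypothesis Hp2 : 1 < p2 E * p2 E.

Lemma gap_q_neq0 eps mu : admissible_coef eps -> admissible_coef mu -> 1 < pp eps mu E * pp eps mu E -> qq eps mu E <> 0.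
Proof. intros A B H Z. assert (dt := pq_det eps mu A B E). rewrite Z in dt; lra. Qed.

Lemma mode_right psi w : 
  loc_abs_cont psi -> loc_abs_cont w ->
  ae_on (fun _ => True) (fun x => is_derive psi x (Cmult (RtoC (glue mu1 mu2 x)) (w x))) ->
  ae_on (fun _ => True) (fun x => is_derive w x (Cmult (RtoC (- E * glue eps1 eps2 x)) (psi x))) ->
  forall x, 0 <= x -> psi x = comb eps2 mu2 E (psi 0) (w 0) x.
Proof.
  intros Hu Hw [N1 [HN1 D1]] [N2 [HN2 D2]] x Hx.
  assert (G : forall f g y, 0 <= y -> glue f g y = g y) by (intros; unfold glue; destruct (Rlt_dec y 0); auto; lra).
  apply (AC_repr eps2 mu2 Aeps2 Amu2 E 0 x psi w); auto; try lra.
  - exists N1; split; auto; intros y Hy Ny. assert (Q := D1 y I Ny). rewrite G in Q by lra; auto.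
  - exists N2; split; auto; intros y Hy Ny. assert (Q := D2 y I Ny). rewrite G in Q by lra; auto.
Qed.

(** At 0 [glue] takes the right-hand coefficients, so that point joins the exceptional null set. *)
Lemma mode_left psi w : 
  loc_abs_cont psi -> loc_abs_cont w ->
  ae_on (fun _ => True) (fun x => is_derive psi x (Cmult (RtoC (glue mu1 mu2 x)) (w x))) ->
  ae_on (fun _ => True) (fun x => is_derive w x (Cmult (RtoC (- E * glue eps1 eps2 x)) (psi x))) ->
  forall x, x <= 0 -> psi x = comb eps1 mu1 E (psi 0) (w 0) x.
Proof.
  intros Hu Hw [N1 [HN1 D1]] [N2 [HN2 D2]] x Hx.
  assert (G : forall f g y, y < 0 -> glue f g y = f y) by (intros; unfold glue; destruct (Rlt_dec y 0); auto; lra).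
  apply (AC_repr eps1 mu1 Aeps1 Amu1 E x 0 psi w); auto; try lra.
  - exists (fun x => N1 x \/ x = 0); split; [apply null_union; auto; apply null_point|].
    intros y Hy Ny. assert (Q := D1 y I ltac:(tauto)). assert (y <> 0) by tauto. rewrite G in Q by lra; auto.
  - exists (fun x => N2 x \/ x = 0); split; [apply null_union; auto; apply null_point|].
    intros y Hy Ny. assert (Q := D2 y I ltac:(tauto)). assert (y <> 0) by tauto. rewrite G in Q by lra; auto.
Qed.

(** On each side square integrability fixes the slope [b / a] at 0, and [(l - p)^2 = p^2 - 1 = q r]
    turns its square into [r / q]. Both sides share the Cauchy data at 0. *)
Lemma mode_match psi : interface_mode eps1 mu1 eps2 mu2 E psi -> r1 E / q1 E = r2 E / q2 E.
Proof.
  intros [[x0 Nx0] [HL2 [Hu [w [Hw [D1 D2]]]]]].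
  assert (Rt := mode_right psi w Hu Hw D1 D2). assert (Lf := mode_left psi w Hu Hw D1 D2).
  assert (Tl := L2_tails _ HL2).
  destruct (multiplier_exists (p1 E) Hp1) as [l1 [L1 [L1' _]]], (multiplier_exists (p2 E) Hp2) as [l2 [L2 [L2' _]]].
  assert (Nq1 := gap_q_neq0 eps1 mu1 Aeps1 Amu1 Hp1). assert (Nq2 := gap_q_neq0 eps2 mu2 Aeps2 Amu2 Hp2).
  assert (dt1 := pq_det eps1 mu1 Aeps1 Amu1 E). assert (dt2 := pq_det eps2 mu2 Aeps2 Amu2 E).
  assert (Dir2 : forall a b, (forall x, 0 <= x -> (a * th eps2 mu2 E x + b * ph eps2 mu2 E x) * (a * th eps2 mu2 E x + b * ph eps2 mu2 E x) <= Cmod (psi x) ^ 2) ->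
     b * q2 E = (l2 - p2 E) * a).
  { intros a b Hab.
    assert (S := comb_sol eps2 mu2 Aeps2 Amu2 E a b).
    destruct (square_integrable_direction eps2 mu2 Aeps2 Amu2 E l2 _ _ (fun x => Cmod (psi x) ^ 2) S L2 L2' Hab) as [K1 _].
    - intros e He; destruct (Tl e He) as [N HN]; exists N; intros n Hn; now apply HN.
    - cbv beta in K1. rewrite (th0 eps2 mu2 Aeps2 Amu2), (ph0 eps2 mu2 Aeps2 Amu2), (dth0 eps2 mu2 Aeps2 Amu2), (dph0 eps2 mu2 Aeps2 Amu2) in K1. lra. }
  (* The left half-line is reflected onto the right one, which changes the sign of [b]. *)
  assert (Dir1 : forall a b, (forall x, x <= 0 -> (a * th eps1 mu1 E x + b * ph eps1 mu1 E x) * (a * th eps1 mu1 E x + b * ph eps1 mu1 E x) <= Cmod (psi x) ^ 2) ->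
     b * q1 E = - (l1 - p1 E) * a).
  { intros a b Hab.
    assert (S := nsol_opp eps1 mu1 Aeps1 Amu1 E _ _ (comb_sol eps1 mu1 Aeps1 Amu1 E a b)).
    destruct (square_integrable_direction eps1 mu1 Aeps1 Amu1 E l1 _ _ (fun x => Cmod (psi (- x)) ^ 2) S L1 L1') as [K1 _].
    - intros x Hx; apply Hab; lra.
    - intros e He; destruct (Tl e He) as [N HN]; exists N; intros n Hn.
      destruct (HN n Hn) as [_ [z [Iz Bz]]]. exists z; split; auto.
      apply is_RInt_swap in Iz.
      assert (Iz' := is_RInt_comp_opp (fun x => Cmod (psi x) ^ 2) (INR n) (INR n + 1) _ Iz).
      apply is_RInt_opp in Iz'. rewrite opp_opp in Iz'.
      apply (is_RInt_ext (fun y => opp (opp (Cmod (psi (- y)) ^ 2)))); [intros; apply opp_opp|exact Iz'].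
    - cbv beta in K1. rewrite Ropp_0, (th0 eps1 mu1 Aeps1 Amu1), (ph0 eps1 mu1 Aeps1 Amu1), (dth0 eps1 mu1 Aeps1 Amu1), (dph0 eps1 mu1 Aeps1 Amu1) in K1. lra. }
  assert (Alg : forall a b, b * q2 E = (l2 - p2 E) * a -> b * q1 E = - (l1 - p1 E) * a -> (a <> 0 \/ b <> 0) -> r1 E / q1 E = r2 E / q2 E).
  { intros a b H2 H1 Nab.
    assert (Na : a <> 0).
    { intros ->. assert (Z : b * q2 E = 0) by lra. apply Rmult_integral in Z; destruct Nab; destruct Z; lra. }
    assert (E2 : b * b * q2 E = r2 E * (a * a)).
    { apply (Rmult_eq_reg_r (q2 E)); auto.
      transitivity ((b * q2 E) * (b * q2 E)); [ring|]. rewrite H2.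
      transitivity ((l2 * l2 - 2 * p2 E * l2 + 1 + (p2 E * p2 E - q2 E * r2 E) - 1 + q2 E * r2 E) * (a * a)); [ring|].
      rewrite L2, dt2; ring. }
    assert (E1 : b * b * q1 E = r1 E * (a * a)).
    { apply (Rmult_eq_reg_r (q1 E)); auto.
      transitivity ((b * q1 E) * (b * q1 E)); [ring|]. rewrite H1.
      transitivity ((l1 * l1 - 2 * p1 E * l1 + 1 + (p1 E * p1 E - q1 E * r1 E) - 1 + q1 E * r1 E) * (a * a)); [ring|].
      rewrite L1, dt1; ring. }
    transitivity (b * b / (a * a)).
    - apply (Rmult_eq_reg_r (q1 E * (a * a))); [|repeat apply Rmult_integral_contrapositive_currified; auto].
      transitivity (r1 E * (a * a)); [field; auto|rewrite <- E1; field; auto].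
    - apply (Rmult_eq_reg_r (q2 E * (a * a))); [|repeat apply Rmult_integral_contrapositive_currified; auto].
      transitivity (b * b * q2 E); [field; auto|rewrite E2; field; auto]. }
  assert (SqF : forall z : C, fst z * fst z <= Cmod z ^ 2) by (intros z; rewrite Cmod_sqr; assert (0 <= snd z * snd z) by apply Rle_0_sqr; lra).
  assert (SqS : forall z : C, snd z * snd z <= Cmod z ^ 2) by (intros z; rewrite Cmod_sqr; assert (0 <= fst z * fst z) by apply Rle_0_sqr; lra).
  (* The real or the imaginary part has nonzero Cauchy data at 0, since otherwise [psi] would vanish
     identically. *)
  destruct (classic (fst (psi 0) <> 0 \/ fst (w 0) <> 0)) as [Nf|Zf].
  - apply (Alg (fst (psi 0)) (fst (w 0))); auto.
    + apply Dir2; intros x Hx; rewrite (Rt x Hx). apply (SqF (comb eps2 mu2 E (psi 0) (w 0) x)).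
    + apply Dir1; intros x Hx; rewrite (Lf x Hx). apply (SqF (comb eps1 mu1 E (psi 0) (w 0) x)).
  - destruct (classic (snd (psi 0) <> 0 \/ snd (w 0) <> 0)) as [Ns|Zs].
    + apply (Alg (snd (psi 0)) (snd (w 0))); auto.
      * apply Dir2; intros x Hx; rewrite (Rt x Hx). apply (SqS (comb eps2 mu2 E (psi 0) (w 0) x)).
      * apply Dir1; intros x Hx; rewrite (Lf x Hx). apply (SqS (comb eps1 mu1 E (psi 0) (w 0) x)).
    + exfalso. apply Nx0.
      assert (F1 : fst (psi 0) = 0) by (apply NNPP; tauto). assert (F2 : fst (w 0) = 0) by (apply NNPP; tauto).
      assert (F3 : snd (psi 0) = 0) by (apply NNPP; tauto). assert (F4 : snd (w 0) = 0) by (apply NNPP; tauto).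
      destruct (Rle_dec 0 x0) as [Hx|Hx]; [rewrite Rt by lra|rewrite Lf by lra];
        apply injective_projections; simpl; rewrite ?F1, ?F2, ?F3, ?F4; ring.
Qed.

(** The slopes of the two decaying solutions at 0 have equal squares by the ratio condition and
    equal signs because [p q] has opposite signs in the two media; so the solutions can be glued. *)
Lemma mode_exists : r1 E / q1 E = r2 E / q2 E -> (p1 E * q1 E) * (p2 E * q2 E) < 0 ->
  exists psi, interface_mode eps1 mu1 eps2 mu2 E psi.
Proof.
  intros Hm Hs.
  destruct (multiplier_exists (p1 E) Hp1) as [l1 [L1 [L1' L1'']]], (multiplier_exists (p2 E) Hp2) as [l2 [L2 [L2' L2'']]].
  assert (Nq1 := gap_q_neq0 eps1 mu1 Aeps1 Amu1 Hp1). assert (Nq2 := gap_q_neq0 eps2 mu2 Aeps2 Amu2 Hp2).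
  assert (dt1 := pq_det eps1 mu1 Aeps1 Amu1 E). assert (dt2 := pq_det eps2 mu2 Aeps2 Amu2 E).
  set (b := (l2 - p2 E) / q2 E).
  assert (B2 : b * q2 E = l2 - p2 E) by (unfold b; field; auto).
  assert (S2 : b * b * q2 E = r2 E).
  { apply (Rmult_eq_reg_r (q2 E)); auto. transitivity ((b * q2 E) * (b * q2 E)); [ring|rewrite B2; lra]. }
  (* [b'] is the slope at 0 of the solution decaying on the left; its square and its sign agree with
     those of [b]. *)
  assert (B1 : b * q1 E = - (l1 - p1 E)).
  { set (b' := - (l1 - p1 E) / q1 E).
    assert (B' : b' * q1 E = - (l1 - p1 E)) by (unfold b'; field; auto).
    assert (S1 : b' * b' * q1 E = r1 E).
    { apply (Rmult_eq_reg_r (q1 E)); auto. transitivity ((b' * q1 E) * (b' * q1 E)); [ring|rewrite B'; lra]. }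
    assert (Sq : b' * b' = b * b).
    { transitivity (r1 E / q1 E); [rewrite <- S1; field; auto|rewrite Hm, <- S2; field; auto]. }
    assert (Sg : 0 < b * b').
    { assert (X2 : b * (p2 E * q2 E) < 0) by (replace (b * (p2 E * q2 E)) with ((b * q2 E) * p2 E) by ring; rewrite B2; auto).
      assert (X1 : 0 < b' * (p1 E * q1 E)) by (replace (b' * (p1 E * q1 E)) with ((b' * q1 E) * p1 E) by ring; rewrite B'; lra).
      assert (X : 0 < - (b * (p2 E * q2 E)) * (b' * (p1 E * q1 E))) by (apply Rmult_lt_0_compat; lra).
      apply (Rmult_lt_reg_r (- ((p1 E * q1 E) * (p2 E * q2 E)))); lra. }
    assert (Z : (b' - b) * (b' + b) = 0) by lra.
    apply Rmult_integral in Z; destruct Z as [Z|Z].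
    - replace b with b' by lra; auto.
    - exfalso. assert (Y : b' = - b) by lra. rewrite Y in Sg. assert (0 <= b * b) by apply Rle_0_sqr. lra. }
  assert (S1 : b * b * q1 E = r1 E).
  { apply (Rmult_eq_reg_r (q1 E)); auto. transitivity ((b * q1 E) * (b * q1 E)); [ring|rewrite B1; lra]. }
  set (u2 := fun x => 1 * th eps2 mu2 E x + b * ph eps2 mu2 E x).
  set (w2 := fun x => 1 * dth eps2 mu2 E x + b * dph eps2 mu2 E x).
  assert (N2 : nsol eps2 mu2 E u2 w2) by (now apply comb_sol).
  assert (I2 : u2 0 = 1 /\ w2 0 = b).
  { unfold u2, w2; rewrite (th0 eps2 mu2 Aeps2 Amu2), (ph0 eps2 mu2 Aeps2 Amu2), (dth0 eps2 mu2 Aeps2 Amu2), (dph0 eps2 mu2 Aeps2 Amu2); lra. }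
  destruct I2 as [U20 W20].
  (* The left solution is built in reflected form, with slope [- b], so that [v] decays to the
     right. *)
  set (v := fun x => 1 * th eps1 mu1 E x + - b * ph eps1 mu1 E x).
  set (z := fun x => 1 * dth eps1 mu1 E x + - b * dph eps1 mu1 E x).
  assert (Nv : nsol eps1 mu1 E v z) by (now apply comb_sol).
  assert (Iv : v 0 = 1 /\ z 0 = - b).
  { unfold v, z; rewrite (th0 eps1 mu1 Aeps1 Amu1), (ph0 eps1 mu1 Aeps1 Amu1), (dth0 eps1 mu1 Aeps1 Amu1), (dph0 eps1 mu1 Aeps1 Amu1); lra. }
  destruct Iv as [V0 Z0].
  assert (N1 := nsol_opp eps1 mu1 Aeps1 Amu1 E v z Nv).
  set (u1 := fun x => v (- x)) in *. set (w1 := fun x => - z (- x)) in *.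
  assert (U10 : u1 0 = u2 0) by (unfold u1; rewrite Ropp_0; lra).
  assert (W10 : w1 0 = w2 0) by (unfold w1; rewrite Ropp_0; lra).
  assert (Sh2 : forall x, u2 (x + 1) = l2 * u2 x).
  { intros x; apply (multiplier_shift eps2 mu2 Aeps2 Amu2 E l2 u2 w2 N2); rewrite U20, W20; [lra|].
    apply (Rmult_eq_reg_r (q2 E)); auto. rewrite <- S2.
    transitivity ((b * q2 E) * (b * q2 E) + (b * q2 E) * p2 E); [ring|]. rewrite B2.
    transitivity (l2 * (b * q2 E)); [rewrite B2; lra|ring]. }
  assert (Sh1 : forall x, v (x + 1) = l1 * v x).
  { intros x; apply (multiplier_shift eps1 mu1 Aeps1 Amu1 E l1 v z Nv); rewrite V0, Z0; [lra|].
    apply (Rmult_eq_reg_r (q1 E)); auto. rewrite <- S1.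
    transitivity ((b * q1 E) * (b * q1 E) - (b * q1 E) * p1 E); [ring|]. rewrite B1.
    transitivity (l1 * - (b * q1 E)); [rewrite B1; lra|ring]. }
  set (U := glue u1 u2). set (W := glue w1 w2).
  assert (CU : forall x, continuous U x) by (apply glue_cont; auto; [apply N1|apply N2]).
  assert (Rac : forall a b, rac a b U /\ rac a b W).
  { intros a c. destruct (nsol_lip eps1 mu1 (proj1 (proj2 Aeps1)) (proj1 (proj2 Amu1)) E u1 w1 a c N1).
    destruct (nsol_lip eps2 mu2 (proj1 (proj2 Aeps2)) (proj1 (proj2 Amu2)) E u2 w2 a c N2).
    split; apply lip_rac, glue_lip; auto. }
  assert (Rac0 : forall a b, rac a b (fun _ => 0)).
  { intros a c; apply lip_rac; exists 0; split; [lra|]; intros; rewrite Rminus_diag, Rabs_R0; lra. }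
  assert (Der : forall x, x <> 0 -> good eps1 mu1 x -> good eps2 mu2 x ->
     is_derive U x (glue mu1 mu2 x * W x) /\ is_derive W x (- E * glue eps1 eps2 x * U x)).
  { intros x Nx G1 G2.
    destruct N1 as [_ [_ D1]], N2 as [_ [_ D2]]. destruct (D1 x G1) as [D1a D1b], (D2 x G2) as [D2a D2b].
    destruct (Rlt_dec x 0) as [Hx|Hx].
    - unfold U, W, glue at 2 3 5 6; destruct (Rlt_dec x 0) as [_|]; [|lra].
      split; [apply (is_derive_ext_loc u1)|apply (is_derive_ext_loc w1)]; auto; now apply glue_neg_loc.
    - unfold U, W, glue at 2 3 5 6; destruct (Rlt_dec x 0) as [|_]; [lra|].
      split; [apply (is_derive_ext_loc u2)|apply (is_derive_ext_loc w2)]; auto; apply glue_pos_loc; lra. }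
  assert (Null : null_set (fun x => (x = 0 \/ ~ good eps1 mu1 x) \/ ~ good eps2 mu2 x)).
  { apply null_union; [apply null_union; [apply null_point|]|]; apply off_finite_null, good_off; first [apply Aeps1|apply Amu1|apply Aeps2|apply Amu2]. }
  exists (fun x => (U x, 0)). split; [|split; [|split]].
  - exists 0. intros H. apply (f_equal fst) in H. simpl in H. unfold U, glue in H.
    destruct (Rlt_dec 0 0); [lra|]. rewrite U20 in H; lra.
  - assert (Sq : forall x, Cmod ((U x, 0) : C) ^ 2 = U x * U x) by (intros; rewrite Cmod_sqr; simpl; ring).
    (* A unit translation outwards multiplies the squared modulus by the square of the
       multiplier. *)
    apply (two_sided_integrable _ (l2 * l2) (l1 * l1)).
    + intros x; apply (continuous_ext (fun x => U x * U x)); [intros; now rewrite Sq|]. now apply cont_mult.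
    + intros x; rewrite Sq; apply Rle_0_sqr.
    + split; [apply Rle_0_sqr|auto].
    + split; [apply Rle_0_sqr|auto].
    + intros x Hx; rewrite !Sq. unfold U, glue. destruct (Rlt_dec (x + 1) 0); [lra|]. destruct (Rlt_dec x 0); [lra|].
      rewrite Sh2; ring.
    + intros x Hx; rewrite !Sq.
      assert (Ul : forall y, 0 <= y -> U (- y) = v y).
      { intros y Hy; unfold U, glue; destruct (Rlt_dec (- y) 0).
        - unfold u1; now rewrite Ropp_involutive.
        - assert (Y0 : y = 0) by lra. rewrite Y0, Ropp_0. rewrite U20; lra. }
      rewrite !Ul by lra. rewrite Sh1; ring.
  - intros a c; apply AC_pair; [apply Rac|apply Rac0].
  - exists (fun x => (W x, 0)); split; [|split].
    + intros a c; apply AC_pair; [apply Rac|apply Rac0].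
    + exists (fun x => (x = 0 \/ ~ good eps1 mu1 x) \/ ~ good eps2 mu2 x); split; auto.
      intros x _ Hx. destruct (Der x) as [Da _]; [tauto|apply NNPP; tauto|apply NNPP; tauto|].
      replace (Cmult (RtoC (glue mu1 mu2 x)) (W x, 0)) with ((glue mu1 mu2 x * W x, 0) : C).
      * apply derC_pair; [exact Da|apply der_const].
      * apply injective_projections; simpl; ring.
    + exists (fun x => (x = 0 \/ ~ good eps1 mu1 x) \/ ~ good eps2 mu2 x); split; auto.
      intros x _ Hx. destruct (Der x) as [_ Da]; [tauto|apply NNPP; tauto|apply NNPP; tauto|].
      replace (Cmult (RtoC (- E * glue eps1 eps2 x)) (U x, 0)) with ((- E * glue eps1 eps2 x * U x, 0) : C).
      * apply derC_pair; [exact Da|apply der_const].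
      * apply injective_projections; simpl; ring.
Qed.
End Glued.

(** * From bulk indices to the interface mode *)

Lemma PTQ_lt eps mu : admissible_coef eps -> admissible_coef mu ->
  forall E, PP eps mu E * PP eps mu E < TT eps mu E * QQ eps mu E.
Proof.
  intros A B E. assert (HT := TT_pos eps mu A B E).
  (* At [(- PP, TT)] the form equals [TT (TT QQ - PP^2)]. *)
  assert (F := form_pos eps mu A B E (- PP eps mu E) (TT eps mu E) ltac:(right; lra)).
  apply Rnot_le_lt; intros K. assert (0 <= TT eps mu E * (PP eps mu E * PP eps mu E - TT eps mu E * QQ eps mu E)) by (apply Rmult_le_pos; lra).
  lra.
Qed.

(** Bands are counted from 1 and edges from 0: with [m = S n], the gap above band [m] runs from
    [hi n] to [lo (S n)], and its lower edge carries the Bloch mode that decides between the two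
    kinds of gap. *)
Lemma bulk_gap eps mu m g : admissible_coef eps -> admissible_coef mu -> (1 <= m)%nat ->
  band_max eps mu m < band_min eps mu (S m) -> bulk_index eps mu m g ->
  (g = 1%Z /\ gap_even (pp eps mu) (qq eps mu) (rr eps mu) (band_max eps mu m) (band_min eps mu (S m))) \/
  (g = (-1)%Z /\ gap_odd (pp eps mu) (qq eps mu) (rr eps mu) (band_max eps mu m) (band_min eps mu (S m))).
Proof.
  intros A B Hm HLU Hg. destruct m as [|n]; [lia|].
  destruct (pp_bands eps mu A B) as [lo [hi HB]].
  assert (Ed := bulk_edge eps mu A B _ _ Hg).
  assert (EL := band_max_hi eps mu A B lo hi HB n). assert (EU := band_min_lo eps mu A B lo hi HB (S n)).
  rewrite EL, EU in *. assert (Rl := proj2 HB n).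
  assert (PL : pp eps mu (hi n) * pp eps mu (hi n) = 1).
  { rewrite (br_hi _ _ _ _ _ _ Rl). generalize (br_lo _ _ _ _ _ _ Rl); lra. }
  assert (PU : pp eps mu (lo (S n)) * pp eps mu (lo (S n)) = 1) by (rewrite (br_lo' _ _ _ _ _ _ Rl); auto).
  destruct (br_open _ _ _ _ _ _ Rl HLU) as [O1 O2].
  assert (det := pq_det eps mu A B). assert (Gp := br_gap _ _ _ _ _ _ Rl).
  destruct Ed as [[-> Z]|[-> Z]]; [left|right]; split; auto.
  - exact (gap_even_intro _ _ _ _ _ _ det (dp eps mu A B) (dr eps mu A B) (TT_pos eps mu A B)
      _ _ HLU PL PU Gp O1 O2 Z).
  - exact (gap_odd_intro _ _ _ _ _ _ det (dp eps mu A B) (dq eps mu A B) (QQ_pos eps mu A B)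
      _ _ HLU PL PU Gp O1 O2 Z).
Qed.

(** The even medium comes first; the theorem uses this with the media in either order. *)
Lemma match_exists_unique eps mu eps' mu' L U L' U' :
  admissible_coef eps -> admissible_coef mu -> admissible_coef eps' -> admissible_coef mu' ->
  gap_even (pp eps mu) (qq eps mu) (rr eps mu) L U -> gap_odd (pp eps' mu') (qq eps' mu') (rr eps' mu') L' U' ->
  L < U -> L' < U' -> (exists E, (L < E < U) /\ (L' < E < U')) ->
  exists E, ((L < E < U) /\ (L' < E < U') /\ rr eps mu E / qq eps mu E = rr eps' mu' E / qq eps' mu' E) /\
   forall E', (L < E' < U) -> (L' < E' < U') -> rr eps mu E' / qq eps mu E' = rr eps' mu' E' / qq eps' mu' E' -> E = E'.
Proof.
  intros A B A' B' G G' HLU HLU' HE.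
  destruct (match_exists (pp eps mu) (qq eps mu) (rr eps mu) (pp eps' mu') (qq eps' mu') (rr eps' mu') L U L' U') as [E [H1 [H2 H3]]]; auto;
    try (intros; now apply cont_q); try (intros; now apply cont_r).
  exists E; split; auto. intros E' H1' H2' H3'.
  assert (Bet : forall x, (L < x < U) -> (L' < x < U') -> Rmax L L' < x < Rmin U U').
  { intros x [? ?] [? ?]; split; [now apply Rmax_lub_lt|now apply Rmin_glb_lt]. }
  assert (Bet' : forall x, Rmax L L' < x < Rmin U U' -> (L < x < U) /\ (L' < x < U')).
  { intros x Hx. generalize (Rmax_l L L') (Rmax_r L L') (Rmin_l U U') (Rmin_r U U'); lra. }
  apply (match_unique (fun x => rr eps mu x / qq eps mu x) (fun x => rr eps' mu' x / qq eps' mu' x) (Rmax L L') (Rmin U U')); auto.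
  - intros x Hx; destruct (Bet' x Hx).
    exact (ratio_increasing _ _ _ _ _ _ L U (pq_det eps mu A B) (dq eps mu A B) (dr eps mu A B)
      (TT_pos eps mu A B) (QQ_pos eps mu A B) (PTQ_lt eps mu A B) G x ltac:(auto)).
  - intros x Hx; destruct (Bet' x Hx).
    exact (ratio_decreasing _ _ _ _ _ _ L' U' (pq_det eps' mu' A' B') (dq eps' mu' A' B') (dr eps' mu' A' B')
      (TT_pos eps' mu' A' B') (QQ_pos eps' mu' A' B') (PTQ_lt eps' mu' A' B') G' x ltac:(auto)).
Qed.

Theorem mainTheorem4 (eps1 mu1 eps2 mu2 : R -> R) (m1 m2 : nat) :
  admissible_coef eps1 -> admissible_coef mu1 ->
  admissible_coef eps2 -> admissible_coef mu2 ->
  (1 <= m1)%nat -> (1 <= m2)%nat ->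
  band_max eps1 mu1 m1 < band_min eps1 mu1 (S m1) ->
  band_max eps2 mu2 m2 < band_min eps2 mu2 (S m2) ->
  (exists E, band_max eps1 mu1 m1 < E < band_min eps1 mu1 (S m1) /\
             band_max eps2 mu2 m2 < E < band_min eps2 mu2 (S m2)) ->
  (exists g1 g2 : Z, bulk_index eps1 mu1 m1 g1 /\ bulk_index eps2 mu2 m2 g2 /\ g1 <> g2) ->
  exists! E,
    (band_max eps1 mu1 m1 < E < band_min eps1 mu1 (S m1) /\
     band_max eps2 mu2 m2 < E < band_min eps2 mu2 (S m2)) /\
    exists psi : R -> C, interface_mode eps1 mu1 eps2 mu2 E psi.
Proof.
  intros A1 B1 A2 B2 Hm1 Hm2 G1 G2 HE [g1 [g2 [Hg1 [Hg2 Ng]]]].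
  destruct (bulk_gap eps1 mu1 m1 g1 A1 B1 Hm1 G1 Hg1) as [[-> K1]|[-> K1]];
  destruct (bulk_gap eps2 mu2 m2 g2 A2 B2 Hm2 G2 Hg2) as [[-> K2]|[-> K2]]; try (exfalso; now apply Ng).
  - destruct (match_exists_unique _ _ _ _ _ _ _ _ A1 B1 A2 B2 K1 K2 G1 G2 HE) as [E [[H1 [H2 H3]] Hu]].
    destruct (ge_in _ _ _ _ _ K1 E H1) as [P1 [S1 _]], (go_in _ _ _ _ _ K2 E H2) as [P2 [S2 _]].
    exists E; split; [split; [now split|]|].
    + apply mode_exists; auto.
      assert (0 < - (pp eps1 mu1 E * qq eps1 mu1 E) * (pp eps2 mu2 E * qq eps2 mu2 E)) by (apply Rmult_lt_0_compat; lra). lra.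
    + intros E' [[H1' H2'] [psi Hpsi]]. apply Hu; auto.
      apply (mode_match eps1 mu1 eps2 mu2 A1 B1 A2 B2 E') with (psi := psi); auto;
      [apply (ge_in _ _ _ _ _ K1 E' H1')|apply (go_in _ _ _ _ _ K2 E' H2')].
  (* The second medium is the even one, so the roles are exchanged and the matching equation is
     reversed at the end. *)
  - destruct HE as [E0 [HE1 HE2]].
    destruct (match_exists_unique _ _ _ _ _ _ _ _ A2 B2 A1 B1 K2 K1 G2 G1 (ex_intro _ E0 (conj HE2 HE1))) as [E [[H2 [H1 H3]] Hu]].
    destruct (ge_in _ _ _ _ _ K2 E H2) as [P2 [S2 _]], (go_in _ _ _ _ _ K1 E H1) as [P1 [S1 _]].
    exists E; split; [split; [now split|]|].
    + apply mode_exists; auto.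
      assert (0 < (pp eps1 mu1 E * qq eps1 mu1 E) * - (pp eps2 mu2 E * qq eps2 mu2 E)) by (apply Rmult_lt_0_compat; lra). lra.
    + intros E' [[H1' H2'] [psi Hpsi]]. apply Hu; auto. symmetry.
      apply (mode_match eps1 mu1 eps2 mu2 A1 B1 A2 B2 E') with (psi := psi); auto;
      [apply (go_in _ _ _ _ _ K1 E' H1')|apply (ge_in _ _ _ _ _ K2 E' H2')].
Qed.
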